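(* Let $\Omega\subset\mathbb R^n$ be a bounded open set, let $\theta:\overline\Omega\to\mathbb R$ be Lipschitz on $\overline\Omega$, and let $(E,F)$ be an interior condenser in $\Omega$. Let \[ \mathcal K_{E,F}(\Omega)=\{u\in W^{1,2}(\Omega):u=0\text{ q.e. on }E,\ u=1\text{ q.e. on }F\}. \] Let $u_*\in\mathcal K_{E,F}(\Omega)$ be a minimizer of the Dirichlet energy $\int_\Omega|\nabla u|^2\,\mathrm{d}x$ in $\mathcal K_{E,F}(\Omega)$, so that $\operatorname{Cap}_{2,\Omega}(E,F)=\int_\Omega|\nabla u_*|^2\,\mathrm{d}x$. Suppose in addition that $u_f=v\circ\theta\in\mathcal K_{E,F}(\Omega)$ for some profile $v:\mathbb R\to\mathbb R$. Then \[ \int_\Omega|\nabla u_f|^2\,\mathrm{d}x-\operatorname{Cap}_{2,\Omega}(E,F)=\int_\Omega|\nabla u_f-\nabla u_*|^2\,\mathrm{d}x. \] In particular, let $R_\theta=\{x\in\Omega:\nabla\theta(x)\ne0\}$ and, for a.e. $x\in R_\theta$, define \[ \nu_\theta(x)=\frac{\nabla\theta(x)}{|\nabla\theta(x)|},\qquad\nabla_\perp u_*(x)=(\nabla u_*(x)\cdot\nu_\theta(x))\,\nu_\theta(x),\qquad\nabla_\Sigma u_*(x)=\nabla u_*(x)-\nabla_\perp u_*(x). \] Then \[ \int_\Omega|\nabla u_f|^2\,\mathrm{d}x-\operatorname{Cap}_{2,\Omega}(E,F)\ge\int_{R_\theta}|\nabla_\Sigma u_*|^2\,\mathrm{d}x.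 \]
   Context: A pair $(E,F)$ of subsets of $\Omega$ is an interior condenser in $\Omega$ if $\overline E\subset\Omega$, $\overline F\subset\Omega$ and $\overline E\cap\overline F=\varnothing$. Its relative $2$-capacity is \[\operatorname{Cap}_{2,\Omega}(E,F)=\inf\left\{\int_\Omega|\nabla u|^2\,\mathrm{d}x: u\in W^{1,2}(\Omega),\ u\le0\text{ q.e. on }E,\ u\ge1\text{ q.e. on }F\right\}.\] Here q.e. (quasi-everywhere) means outside a set of zero Sobolev $2$-capacity, for the quasicontinuous representative. $\nabla\theta$ is the almost everywhere defined gradient of $\theta$. *)

(* Defs.v *)
From HB Require Import structures.
From mathcomp Require Import all_boot all_order all_algebra.
From mathcomp Require Import all_classical all_reals all_analysis.

Set Implicit Arguments.
Unset Strict Implicit.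
Unset Printing Implicit Defensive.

Import Order.TTheory GRing.Theory Num.Theory.
Import numFieldNormedType.Exports.

Local Open Scope classical_set_scope.
Local Open Scope ring_scope.

Section prod_cons.
Context d (T : measurableType d) (R : realType) (n : nat).
Variables (m1 : {sigma_finite_measure set T -> \bar R})
  (m2 : {sigma_finite_measure set (n.-tuple T) -> \bar R}).

Definition tuple_cons (p : T * n.-tuple T) : n.+1.-tuple T :=
  [tuple of p.1 :: p.2].

Let uncons (t : n.+1.-tuple T) : T * n.-tuple T :=
  (thead t, [tuple of behead t]).

Lemma measurable_tuple_cons : measurable_fun setT tuple_cons.
Proof.
by apply: measurable_cons; [exact: measurable_fst|exact: measurable_snd].
Qed.

Let measurable_uncons : measurable_fun setT uncons.
Proof.
apply/measurable_fun_pairP; split; first exact: measurable_tnth.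
apply/measurable_fun_tnthP => i.
rewrite (_ : _ \o _ = (fun t => tnth t (lift ord0 i))).
  exact: measurable_tnth.
apply/funext => t /=; rewrite [in RHS](tuple_eta t).
by rewrite tnthS.
Qed.

Definition prod_cons : set (n.+1.-tuple T) -> \bar R :=
  pushforward (m1 \x m2)%E tuple_cons.

Let nu : {measure set (n.+1.-tuple T) -> \bar R} :=
  measure_function_pushforward__canonical__measure_function_Measure
    (m1 \x m2)%E measurable_tuple_cons.

HB.instance Definition _ := isMeasure.Build _ _ _ prod_cons
  (measure0 nu) (measure_ge0 nu) (@measure_semi_sigma_additive _ _ _ nu).

Let prod_cons_sigma_finite : sigma_finite setT prod_cons.
Proof.
have /sigma_finiteP[F [TF ndF Foo]] := sigma_finiteT m1.
have /sigma_finiteP[G [TG ndG Goo]] := sigma_finiteT m2.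
exists (fun k => uncons @^-1` (F k `*` G k)).
  rewrite -preimage_bigcup (_ : \bigcup_i _ = setT) ?preimage_setT//.
  apply/seteqP; split=> // -[x t] _.
  have [i _ Fix] : (\bigcup_i F i) x by rewrite -TF.
  have [j _ Gjt] : (\bigcup_j G j) t by rewrite -TG.
  exists (maxn i j) => //; split => /=.
    by move: x Fix; exact/subsetPset/ndF/leq_maxl.
  by move: t Gjt; exact/subsetPset/ndG/leq_maxr.
move=> k; have [mF Fk] := Foo k; have [mG Gk] := Goo k; split.
  rewrite -[X in measurable X]setTI.
  by apply: measurable_uncons => //; exact: measurableX.
rewrite (_ : prod_cons _ = (m1 \x m2)%E (F k `*` G k)).
  by rewrite product_measure1E// lte_mul_pinfty// ge0_fin_numE.
congr ((m1 \x m2)%E _); apply/funext => -[x t].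
rewrite -[RHS]/((F k `*` G k) (x, t)).
rewrite -[LHS]/((F k `*` G k) (uncons (tuple_cons (x, t)))).
by congr ((F k `*` G k) _); congr pair; exact/val_inj.
Qed.

HB.instance Definition _ := Measure_isSigmaFinite.Build _ _ _ prod_cons
  prod_cons_sigma_finite.
End prod_cons.

(* iterated product of the Lebesgue measure of [R], on the product sigma-algebra *)
Fixpoint lebesgue_tuple (R : realType) n :
    {sigma_finite_measure set (n.-tuple (measurableTypeR R)) -> \bar R} :=
  if n is n'.+1 then prod_cons lebesgue_measure (lebesgue_tuple R n')
  else \d_[tuple].

Section lebesgue_rV.
Context {R : realType} {n : nat}.

Definition rV_of_tuple (t : n.-tuple R) : 'rV[R]_n := \row_i tnth t i.

Definition lebesgue_outer (A : set 'rV[R]_n) : \bar R :=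
  mu_ext (lebesgue_tuple R n) (rV_of_tuple @^-1` A).

Let outer0 : lebesgue_outer set0 = 0%E.
Proof. by rewrite /lebesgue_outer preimage_set0; exact: outer_measure0. Qed.

Let outer_ge0 A : (0 <= lebesgue_outer A)%E.
Proof. exact: outer_measure_ge0. Qed.

Let outer_le : {homo lebesgue_outer : A B / A `<=` B >-> (A <= B)%E}.
Proof. by move=> A B AB; apply: le_outer_measure => t; exact: AB. Qed.

Let outer_sigma_subadditive : sigma_subadditive lebesgue_outer.
Proof.
move=> F; rewrite /lebesgue_outer preimage_bigcup.
exact: outer_measure_sigma_subadditive.
Qed.

HB.instance Definition _ := isOuterMeasure.Build R 'rV[R]_n lebesgue_outer
  outer0 outer_ge0 outer_le outer_sigma_subadditive.

(* Measurable sets of ['rV[R]_n] are the Lebesgue sets: the outer measure is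
   induced by a sigma-finite measure, so its Caratheodory sets are the
   completion of the Borel sets. *)
HB.instance Definition _ := @isMeasurable.Build (caratheodory_display lebesgue_outer)
  'rV[R]_n lebesgue_outer.-caratheodory
  (caratheodory_measurable_set0 lebesgue_outer)
  (@caratheodory_measurable_setC _ _ lebesgue_outer)
  (@caratheodory_measurable_bigcup _ _ lebesgue_outer).

Definition lebesgue_rV : set 'rV[R]_n -> \bar R := lebesgue_outer.

Let lebesgue_rV_sigma_additive : semi_sigma_additive lebesgue_rV.
Proof. exact: (@caratheodory_measure_sigma_additive _ _ lebesgue_outer). Qed.

HB.instance Definition _ := isMeasure.Build _ _ _ lebesgue_rV
  outer0 outer_ge0 lebesgue_rV_sigma_additive.
End lebesgue_rV.

Section sobolev.
Context {R : realType} {n : nat}.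
Local Notation V := 'rV[R]_n.
Local Notation mu := (@lebesgue_rV R n).
Implicit Types (Omega E F A : set V) (u w phi : V -> R) (g : V -> V).

Definition dotv (x y : V) : R := \sum_i x ord0 i * y ord0 i.

(* the norm [`|x|] of the library is the sup norm *)
Definition enorm (x : V) : R := Num.sqrt (dotv x x).

Definition grad u (x : V) : V := \row_i 'D_('e_i) u x.

Definition smooth phi : Prop := forall (s : seq 'I_n) (x : V),
  differentiable (foldr (fun i f => 'D_('e_i) f) phi s) x.

Definition test_function Omega phi : Prop :=
  [/\ smooth phi, compact (closure [set x | phi x != 0]) &
      closure [set x | phi x != 0] `<=` Omega].

Definition L2 Omega u : Prop :=
  measurable_fun Omega u /\ (\int[mu]_(x in Omega) (u x ^+ 2)%:E < +oo)%E.

Definition is_L2_weak_gradient Omega u g : Prop :=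
  (forall i, L2 Omega (fun x => g x ord0 i)) /\
  (forall i phi, test_function Omega phi ->
    (\int[mu]_(x in Omega) (u x * 'D_('e_i) phi x)%:E =
     - \int[mu]_(x in Omega) (g x ord0 i * phi x)%:E)%E).

Definition W12 Omega u : Prop :=
  L2 Omega u /\ exists g, is_L2_weak_gradient Omega u g.

(* unique up to a null subset of [Omega] when [W12 Omega u] holds *)
Definition wgrad Omega u : V -> V := get [set g | is_L2_weak_gradient Omega u g].

Definition dirichlet_energy Omega u : \bar R :=
  (\int[mu]_(x in Omega) (enorm (wgrad Omega u x) ^+ 2)%:E)%E.

Definition sobolev_cap A : \bar R :=
  ereal_inf [set (\int[mu]_x (u x ^+ 2 + enorm (wgrad setT u x) ^+ 2)%:E)%E |
    u in [set u | W12 setT u /\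
      exists G, [/\ open G, A `<=` G & {ae mu, forall x, G x -> 1 <= u x}]]].

Definition qe A (P : V -> Prop) : Prop :=
  sobolev_cap [set x | A x /\ ~ P x] = 0%E.

(* Quasicontinuous representatives are unique up to sets of zero capacity, so
   the pointwise conditions below may be imposed on one of them. *)
Definition quasicontinuous Omega w : Prop := forall e : R, 0 < e ->
  exists G, [/\ open G, G `<=` Omega, (sobolev_cap G < e%:E)%E &
    {within Omega `\` G, continuous w}].

Definition qc_representative Omega u w : Prop :=
  quasicontinuous Omega w /\ {ae mu, forall x, Omega x -> w x = u x}.

Definition interior_condenser Omega E F : Prop :=
  [/\ closure E `<=` Omega, closure F `<=` Omega &
      closure E `&` closure F = set0].

Definition cap_admissible Omega E F u : Prop :=
  W12 Omega u /\ exists w, [/\ qc_representative Omega u w,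
    qe E (fun x => w x <= 0) & qe F (fun x => 1 <= w x)].

Definition relative_cap Omega E F : \bar R :=
  ereal_inf [set dirichlet_energy Omega u | u in cap_admissible Omega E F].

Definition Kclass Omega E F u : Prop :=
  W12 Omega u /\ exists w, [/\ qc_representative Omega u w,
    qe E (fun x => w x = 0) & qe F (fun x => w x = 1)].

Definition dirichlet_minimizer Omega E F u : Prop :=
  Kclass Omega E F u /\
  forall w, Kclass Omega E F w ->
    (dirichlet_energy Omega u <= dirichlet_energy Omega w)%E.

(* Away from the differentiability points of [theta], a null subset of [Omega],
   [grad theta] is a junk value, which [regular_set] excludes. *)
Definition regular_set Omega (theta : V -> R) : set V :=
  [set x | [/\ Omega x, differentiable theta x & grad theta x != 0]].

Definition normal_dir (theta : V -> R) (x : V) : V :=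
  (enorm (grad theta x))^-1 *: grad theta x.

Definition grad_perp Omega theta u (x : V) : V :=
  dotv (wgrad Omega u x) (normal_dir theta x) *: normal_dir theta x.

Definition grad_tan Omega theta u (x : V) : V :=
  wgrad Omega u x - grad_perp Omega theta u x.
End sobolev.

(* Main.v *)
Require Import Defs.
From mathcomp Require Import all_boot all_order all_algebra.
From mathcomp Require Import all_classical all_reals all_analysis.
From mathcomp Require Import measurable_realfun.
From mathcomp Require Import ring lra.

Set Implicit Arguments.
Unset Strict Implicit.
Unset Printing Implicit Defensive.

Import Order.TTheory GRing.Theory Num.Theory.
Import numFieldNormedType.Exports.

Local Open Scope classical_set_scope.
Local Open Scope ring_scope.

(** A profile composed with [theta] has a gradient parallel to that of [theta]
    at almost every differentiability point of [theta]. If [f = v \o theta] has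
    weak derivatives [g_i], one tests
    [D_i^h f * D_j^-h theta - D_j^h f * D_i^-h theta] against a test function and
    moves the difference quotients off [f]: since they commute, only first
    differences of [theta] remain. These integrate to zero when [theta] is
    replaced by [K \o theta], hence tend to zero against [k \o theta] with
    [k = K'] continuous, and [f] is an [L^1] limit of such functions. So
    [g_i * D_j^-h theta - g_j * D_i^-h theta] tends weakly to zero, and every
    pointwise limit of it vanishes almost everywhere. This needs neither
    Rademacher's theorem nor mollification.

    For the energies, truncating to [[0, 1]] turns an admissible function into an
    element of the affine class without increasing its energy, so that the
    relative capacity is the minimal energy of that class; minimality along the
    lines [ustar + t (f - ustar)] gives the Pythagorean identity. On the regular
    set the tangential part of [grad ustar] is, up to sign, that of
    [grad f - grad ustar]. *)

(** * Lebesgue measure on row vectors *)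

(** The profile [v] is arbitrary, not even measurable, so no chain rule for [v \o theta] is
    available. What remains is that the sets where [f] takes its values in a Borel set are
    measurable and saturated for [theta]; this is what makes [f] a limit of [k \o theta] with [k]
    continuous. An L^1 limit is enough because the factor left beside [f] is bounded through the
    Lipschitz constant independently of the step, whereas second differences of [theta] would not
    be. Weak convergence to zero becomes a pointwise statement through the sets where a sequence
    stays above a positive constant from some rank on; differentiability of [theta] is then used
    only at the points where it is assumed. The capacity is defined by inequalities and the affine
    class by equalities: the truncation that relates them needs the weak derivative of [|u|], a
    second use of the convergence of difference quotients in the mean. *)

Section lebesgue_tuple_theory.
Context {R : realType}.
Local Notation lt n := (lebesgue_tuple R n).

Definition shift_tuple n (c t : n.-tuple R) : n.-tuple (measurableTypeR R) :=
  [tuple tnth t i + tnth c i | i < n].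

Lemma measurable_shift_tuple n (c : n.-tuple R) :
  measurable_fun [set: n.-tuple (measurableTypeR R)] (shift_tuple c).
Proof.
apply/measurable_fun_tnthP => i.
rewrite (_ : _ \o _ = (fun t => tnth t i + tnth c i)); last first.
  by apply/funext => t /=; rewrite tnth_mktuple.
by apply: measurable_funD => //; exact: measurable_tnth.
Qed.

Lemma lebesgue_measure_shift (c : R) (A : set R) : measurable A ->
  lebesgue_measure ((fun x : measurableTypeR R => x + c) @^-1` A) =
  lebesgue_measure A :> \bar R.
Proof.
have mc : measurable_fun setT (fun x : measurableTypeR R => x + c : measurableTypeR R).
  by apply: measurable_funD => //; exact: measurable_id.
pose m : {measure set (measurableTypeR R) -> \bar R} :=
  measure_function_pushforward__canonical__measure_function_Measure
    (@lebesgue_measure R) mc.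
move=> mA; apply/esym; apply: (@lebesgue_measure_unique R m _ A mA) => _ [[a b]] _ <-.
rewrite /m /= /pushforward.
rewrite (_ : _ @^-1` _ = `]a - c, b - c]%classic); last first.
  by apply/seteqP; split=> x /=; rewrite !in_itv/= ltrBlDr lerBrDr.
rewrite !lebesgue_measure_itv/= !lte_fin ltrD2r.
by case: ifPn => // _; rewrite -!EFinD; congr EFin; ring.
Qed.

(** Translation acts separately on the head and on the tail, so it is enough to compare the product
    measure with its image on rectangles, where each factor is invariant. *)
Lemma lebesgue_tuple_shift n (c : n.-tuple R) (A : set (n.-tuple R)) :
  measurable A -> lt n (shift_tuple c @^-1` A) = lt n A.
Proof.
elim: n c A => [|n IH] c A mA.
  rewrite (_ : _ @^-1` A = A)//.
  by apply/seteqP; split => t /=; rewrite [shift_tuple c t]tuple0 [t]tuple0.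
pose c' : n.-tuple R := [tuple of behead c].
pose f (p : measurableTypeR R * n.-tuple (measurableTypeR R)) :=
  (p.1 + thead c : measurableTypeR R, shift_tuple c' p.2).
have mf : measurable_fun setT f.
  apply/measurable_fun_pairP; split.
    by apply: measurable_funD => //; exact: measurable_fst.
  by apply: (measurableT_comp (measurable_shift_tuple c')); exact: measurable_snd.
pose P := (@lebesgue_measure R \x lt n)%E.
pose m : {measure set (measurableTypeR R * n.-tuple (measurableTypeR R)) -> \bar R} :=
  measure_function_pushforward__canonical__measure_function_Measure P mf.
have mE X : measurable X -> P X = m X.
  apply: product_measure_unique => A1 A2 mA1 mA2; rewrite /m /= /pushforward.
  rewrite (_ : _ @^-1` _ =
     ((fun x : measurableTypeR R => x + thead c) @^-1` A1) `*`
     (shift_tuple c' @^-1` A2))//.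
  rewrite product_measure1E//.
  - congr (_ * _)%E; [exact: lebesgue_measure_shift|exact: IH].
  - rewrite -[X in measurable X]setTI.
    by apply: (measurable_funD (measurable_id (D:=setT)) (measurable_cst _)).
  - rewrite -[X in measurable X]setTI.
    exact: measurable_shift_tuple.
rewrite /= /prod_cons /pushforward /=.
rewrite [RHS](mE (@tuple_cons _ _ _ @^-1` A)); last first.
  by rewrite -[X in measurable X]setTI; exact: measurable_tuple_cons.
rewrite /m /= /pushforward; congr (P _); apply/seteqP.
have e (p : measurableTypeR R * n.-tuple (measurableTypeR R)) :
    shift_tuple c (tuple_cons p) = tuple_cons (f p).
  apply: eq_from_tnth => i; rewrite tnth_mktuple.
  case: (unliftP ord0 i) => [j ->|->]; last first.
    by rewrite !(tnth_nth 0) /= /thead (tnth_nth 0).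
  rewrite !tnthS tnth_mktuple; congr (_ + _).
  by rewrite !(tnth_nth 0) /= nth_behead.
by split => p /=; rewrite e.
Qed.

Lemma lebesgue_tuple_cube n (M : R) :
  (lt n [set t : n.-tuple R | forall i, (-M <= tnth t i <= M)%R] < +oo)%E.
Proof.
elim: n => [|n IH].
  by rewrite /= diracE; case: (_ \in _) => //; rewrite ltry.
rewrite /= /prod_cons /pushforward /=.
rewrite (_ : _ @^-1` _ = (`[-M, M]%classic : set (measurableTypeR R)) `*`
  [set t : n.-tuple R | forall i, (-M <= tnth t i <= M)%R]); last first.
  apply/seteqP; split => -[x t] /=.
    move=> h; split; first by have := h ord0; rewrite in_itv.
    by move=> i; have := h (lift ord0 i); rewrite tnthS.
  rewrite in_itv/= => -[hx ht] i.
  case: (unliftP ord0 i) => [j ->|->]; last by [].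
  by rewrite tnthS.
have mC : measurable [set t : n.-tuple (measurableTypeR R) | forall i, (-M <= tnth t i <= M)%R].
  rewrite (_ : [set _ | _] = \bigcap_(i in [set: 'I_n])
    ((fun t : n.-tuple (measurableTypeR R) => tnth t i) @^-1` `[-M, M])); last first.
    by apply/seteqP; split=> t /= h i; have := h i; rewrite /= in_itv//=; exact.
  apply: fin_bigcap_measurable => // i _; rewrite -[X in measurable X]setTI.
  exact: measurable_tnth.
rewrite product_measure1E// lte_mul_pinfty//.
pose I : set R := `[-M, M]%classic.
have h : (@lebesgue_measure R I < +oo)%E.
  by rewrite lebesgue_measure_itv/=; case: ifP => _; rewrite ltry.
rewrite ge0_fin_numE; [exact: h|exact: measure_ge0].
Qed.

End lebesgue_tuple_theory.

Section lebesgue_rV_theory.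
Context {R : realType} {n : nat}.
Local Notation V := 'rV[R]_n.
Local Notation mu := (@lebesgue_rV R n).
Local Notation lt := (lebesgue_tuple R n).

Definition tuple_of_rV (x : V) : n.-tuple (measurableTypeR R) := [tuple x ord0 i | i < n].

Lemma rV_of_tupleK : cancel (@rV_of_tuple R n) tuple_of_rV.
Proof. by move=> t; apply: eq_from_tnth => i; rewrite tnth_mktuple mxE. Qed.

Lemma tuple_of_rVK : cancel tuple_of_rV (@rV_of_tuple R n).
Proof. by move=> x; apply/rowP => i; rewrite mxE tnth_mktuple. Qed.

Lemma borel_measurable_rV (A : set V) :
  measurable (@rV_of_tuple R n @^-1` A : set (n.-tuple (measurableTypeR R))) -> measurable A.
Proof.
move=> mA; have h := caratheodory_measurable_mu_ext lt mA.
by move=> X; exact: (h (@rV_of_tuple R n @^-1` X)).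
Qed.

Lemma borel_lebesgue_rV (A : set V) :
  measurable (@rV_of_tuple R n @^-1` A : set (n.-tuple (measurableTypeR R))) ->
  mu A = lt (@rV_of_tuple R n @^-1` A).
Proof. by move=> mA; exact: measurable_mu_extE. Qed.

Lemma lebesgue_rV_le (A B : set V) : A `<=` B -> (mu A <= mu B)%E.
Proof. exact: le_outer_measure. Qed.

Lemma lebesgue_rV_leU (A B : set V) : (mu (A `|` B) <= mu A + mu B)%E.
Proof. exact: outer_measureU2. Qed.

Lemma lebesgue_rV_outer0 (A : set V) : mu A = 0%E -> measurable A.
Proof.
move=> A0; apply: le_caratheodory_measurable => X.
change (lebesgue_rV (X `&` A) + lebesgue_rV (X `&` ~` A) <= lebesgue_rV X)%E.
have -> : lebesgue_rV (X `&` A) = 0%E; last by rewrite add0e; apply: lebesgue_rV_le.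
apply/eqP; rewrite eq_le outer_measure_ge0 andbT -A0.
by apply: lebesgue_rV_le.
Qed.

Lemma lebesgue_rV_complete : measure_is_complete mu.
Proof.
move=> A [B [mB B0 AB]]; apply: lebesgue_rV_outer0; apply/eqP.
by rewrite eq_le outer_measure_ge0 andbT -B0; exact: lebesgue_rV_le.
Qed.

Lemma negligible_rVP (A : set V) : mu.-negligible A <-> mu A = 0%E.
Proof.
split=> [nA|A0]; last by apply/negligibleP => //; exact: lebesgue_rV_outer0.
by apply/negligibleP => //; exact: lebesgue_rV_complete.
Qed.

(** The sigma-algebra on tuples only knows the coordinates. Balls of the sup norm are finite
    intersections of coordinate conditions, and an open set is the union of the countably many such
    balls, with rational centers and radii [k.+1%:R^-1], that it contains. *)
Lemma open_preimage_rV (O : set V) : open O ->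
  measurable (@rV_of_tuple R n @^-1` O : set (n.-tuple (measurableTypeR R))).
Proof.
move=> oO.
pose B (p : 'rV[rat]_n * nat) : set V :=
  ball (map_mx (fun q => ratr q) p.1 : V) (p.2.+1%:R^-1).
rewrite (_ : _ @^-1` O = \bigcup_(p in [set: 'rV[rat]_n * nat]) (if `[< B p `<=` O >] then
   @rV_of_tuple R n @^-1` B p else set0)); last first.
  apply/seteqP; split => t /=; last first.
    by move=> [p _]; case: ifPn => // /asboolP; exact.
  move=> Ot; have := open_nbhs_nbhs (conj oO Ot) => /nbhs_ballP[e /= e0 eO].
  have [k ke] : exists k : nat, k.+1%:R^-1 < e / 2.
    have e20 : 0 < e / 2 by rewrite divr_gt0.
    have [N _ HN] := near_infty_natSinv_lt (PosNum e20).
    by exists N; exact: (HN N (leqnn N)).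
  have k0 : (0 : R) < k.+1%:R^-1 by rewrite invr_gt0.
  have [q hq] : exists q : 'I_n -> rat, forall i, ball (ratr (q i) : R) (k.+1%:R^-1) (tnth t i).
    have H i : {q : rat | ball (ratr q : R) (k.+1%:R^-1) (tnth t i)}.
      have h : tnth t i - k.+1%:R^-1 < tnth t i + k.+1%:R^-1.
        by rewrite ltrD2l; apply: lt_trans k0; rewrite oppr_lt0.
      have /cid[q] := rat_in_itvoo h.
      rewrite in_itv/= => /andP[h1 h2]; exists q.
      by rewrite /ball/= ltr_norml ltrBlDl h2 andbT ltrBrDl.
    by exists (fun i => projT1 (H i)) => i; exact: projT2 (H i).
  have Bt : B (\row_i q i, k) (rV_of_tuple t).
    by split => // i j; rewrite (ord1 i) !mxE; exact: hq.
  exists (\row_i q i, k) => //; case: ifPn => // /asboolP; case.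
  move=> y By; apply: eO.
  apply: (@le_ball _ _ _ (k.+1%:R^-1 + k.+1%:R^-1)).
    by rewrite [leRHS]splitr lerD// ltW.
  by apply: ball_triangle By; exact: ball_sym.
apply: countable_bigcupT_measurable => // p.
case: ifPn => // _; rewrite (_ : _ @^-1` _ = \bigcap_(i in [set: 'I_n])
   ((fun t : n.-tuple (measurableTypeR R) => tnth t i) @^-1`
     (ball (ratr (p.1 ord0 i) : R) (p.2.+1%:R^-1)))).
  apply: fin_bigcap_measurable => // i _; rewrite -[X in measurable X]setTI.
  apply: measurable_tnth => //; exact: measurable_ball.
apply/seteqP; split => t /=.
  by move=> [_ h] i _; have := h ord0 i; rewrite !mxE.
move=> h; split; first by rewrite invr_gt0.
by move=> i j; rewrite (ord1 i) !mxE; exact: h.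
Qed.

Lemma open_measurable_rV (O : set V) : open O -> measurable O.
Proof. by move=> oO; apply: borel_measurable_rV; exact: open_preimage_rV. Qed.

Lemma closed_measurable_rV (C : set V) : closed C -> measurable C.
Proof.
move=> cC; rewrite -[C]setCK; apply: measurableC.
exact/open_measurable_rV/closed_openC.
Qed.

Lemma compact_closed_rV (K : set V) : compact K -> closed K.
Proof. by move=> cK; apply: compact_closed => //; exact: pseudoMetricNormedZModType_hausdorff. Qed.

Lemma compact_measurable_rV (K : set V) : compact K -> measurable K.
Proof. by move=> /compact_closed_rV/closed_measurable_rV. Qed.

Lemma coord_le_norm (x : V) i : `|x ord0 i| <= `|x|.
Proof.
rewrite [leRHS]/Num.norm /= mx_normrE; apply/bigmax_geP; right => /=.
by exists (ord0, i).
Qed.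

Lemma bounded_lebesgue_fin (A : set V) : bounded_set A -> (mu A < +oo)%E.
Proof.
move=> [M [_ HM]].
apply: le_lt_trans (lebesgue_tuple_cube n (M + 1)).
pose C : set V := [set x | forall i, - (M + 1) <= x ord0 i <= M + 1].
have eC : @rV_of_tuple R n @^-1` C = [set t | (forall i, (- (M+1) <= tnth t i <= M+1)%R)].
  by apply/seteqP; split=> t /= h i; have := h i; rewrite mxE.
rewrite -eC -borel_lebesgue_rV.
  apply: lebesgue_rV_le => x Ax i; rewrite -ler_norml.
  by apply: le_trans (coord_le_norm x i) _; apply: HM => //; rewrite ltrDl.
rewrite eC.
rewrite (_ : [set _ | _] = \bigcap_(i in [set: 'I_n])
    ((fun t : n.-tuple (measurableTypeR R) => tnth t i) @^-1` `[-(M+1), M+1])); last first.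
    by apply/seteqP; split=> t /= h i; have := h i; rewrite /= in_itv//=; exact.
apply: fin_bigcap_measurable => // i _; rewrite -[X in measurable X]setTI.
exact: measurable_tnth.
Qed.

(** Translating a measurable cover of [A] gives a cover of the translate with the same total mass.
    The reverse inequality is this one for [- c]. *)
Let shift_le (c : V) (A : set V) : (mu ((fun x => x + c)%R @^-1` A) <= mu A)%E.
Proof.
rewrite /lebesgue_rV /lebesgue_outer /mu_ext.
apply: le_ereal_inf_tmp => _ [F [mF AF] <-].
pose c' : n.-tuple R := tuple_of_rV c.
apply: ereal_inf_lbound; exists (fun k => shift_tuple c' @^-1` F k).
  split; first by move=> k; rewrite -[X in measurable X]setTI; exact: measurable_shift_tuple.
  move=> t /= At; rewrite -preimage_bigcup; apply: AF => /=.
  rewrite (_ : rV_of_tuple _ = rV_of_tuple t + c)//.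
  by apply/rowP => i; rewrite !mxE !tnth_mktuple.
by apply: eq_eseriesr => k _; apply: lebesgue_tuple_shift; exact: mF.
Qed.

Lemma lebesgue_rV_shift (c : V) (A : set V) : mu ((fun x => x + c) @^-1` A) = mu A.
Proof.
apply/eqP; rewrite eq_le shift_le/=.
have := shift_le (- c) ((fun x => x + c) @^-1` A).
rewrite (_ : _ @^-1` (_ @^-1` _) = A)//.
by apply/seteqP; split => x /=; rewrite subrK.
Qed.

(** Measurability is the Caratheodory condition, and the outer measure is translation invariant on
    all sets: splitting [X] along the preimage of [A] is the same as splitting a translate of [X]
    along [A]. *)
Lemma measurable_shift_rV (c : V) : measurable_fun setT (fun x : V => x + c).
Proof.
move=> _ A mA; rewrite setTI.
suff: lebesgue_outer.-caratheodory ((fun x : V => x + c) @^-1` A) by [].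
move=> X; have := mA ((fun x => x - c) @^-1` X).
have e Y : mu ((fun x : V => x + c) @^-1` Y) = mu Y := lebesgue_rV_shift c Y.
rewrite -[lebesgue_outer _]e -[lebesgue_outer (_ `&` A)]e.
rewrite -[lebesgue_outer (_ `&` ~` A)]e !preimage_setI.
rewrite (_ : _ @^-1` (_ @^-1` X) = X)//.
by apply/seteqP; split => x /=; rewrite addrK.
Qed.

Lemma ge0_integral_shift (c : V) (f : V -> \bar R) : measurable_fun setT f ->
  (forall x, 0 <= f x)%E -> (\int[mu]_x f (x + c)%R = \int[mu]_x f x)%E.
Proof.
move=> mf f0.
pose m : {measure set V -> \bar R} :=
  measure_function_pushforward__canonical__measure_function_Measure
    mu (measurable_shift_rV c).
rewrite [RHS](eq_measure_integral m); last first.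
  by move=> A mA _; rewrite /m /= /pushforward; exact/esym/lebesgue_rV_shift.
exact: (esym (ge0_integral_pushforward (measurable_shift_rV c) mu measurableT mf
  (fun y _ => f0 y))).
Qed.

Lemma integrable_shift (c : V) (f : V -> \bar R) :
  mu.-integrable setT f -> mu.-integrable setT (fun x => f (x + c)).
Proof.
move=> fi; have mf' := measurable_int _ (integrable_abse fi).
move: fi => /integrableP[mf fi]; apply/integrableP; split.
  by apply: (measurableT_comp mf); exact: measurable_shift_rV.
by rewrite (ge0_integral_shift c mf' (fun x => abse_ge0 _)).
Qed.

Lemma integral_shift (c : V) (f : V -> \bar R) : mu.-integrable setT f ->
  (\int[mu]_x f (x + c)%R = \int[mu]_x f x)%E.
Proof.
move=> fi; pose m : {measure set V -> \bar R} :=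
  measure_function_pushforward__canonical__measure_function_Measure
    mu (measurable_shift_rV c).
rewrite [RHS](eq_measure_integral m); last first.
  by move=> A mA _; rewrite /m /= /pushforward; exact/esym/lebesgue_rV_shift.
have fi' := integrable_shift c fi.
exact: (esym (integral_pushforward (measurable_shift_rV c) (measurable_int _ fi) fi'
  measurableT)).
Qed.

End lebesgue_rV_theory.

(** * Inner regularity by compact sets inside a bounded open set *)

Section inner_regularity.
Context {R : realType} {n : nat}.
Local Notation V := 'rV[R]_n.
Local Notation mu := (@lebesgue_rV R n).

Lemma bounded_setS (A B : set V) : A `<=` B -> bounded_set B -> bounded_set A.
Proof. by move=> AB [M [Mr HM]]; exists M; split => // r Mr' x /AB; exact: HM. Qed.

(** The distance to the complement is expressed point by point, which makes the condition vacuous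
    when [A] is the whole space. *)
Lemma open_compact_exhaustion (A : set V) : open A ->
  exists C : (set V)^nat, [/\ (forall k, compact (C k)),
    {homo C : i j / (i <= j)%N >-> i `<=` j} & \bigcup_k C k = A].
Proof.
move=> oA; exists (fun k => [set x | `|x| <= k%:R /\
   forall y, ~ A y -> k.+1%:R^-1 <= `|x - y|]); split.
- move=> k; apply: bounded_closed_compact.
    exists k%:R; split => // r kr x [/= xk _]; exact: le_trans xk (ltW kr).
  rewrite (_ : [set _ | _] = [set x | `|x| <= k%:R] `&`
    \bigcap_(y in ~` A) [set x | k.+1%:R^-1 <= `|x - y|]); last first.
    by apply/seteqP; split => x.
  apply: closedI.
    apply: (@closed_comp _ _ (fun x : V => `|x|) [set r | r <= k%:R]).
      by move=> x _; exact: norm_continuous.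
    exact: closed_le.
  apply: closed_bigI => y _.
  apply: (@closed_comp _ _ (fun x : V => `|x - y|) [set r | k.+1%:R^-1 <= r]).
    move=> x _; have h : {for x, continuous (fun x : V => x - y)}.
      by apply: continuousB; [exact: cvg_id|exact: cst_continuous].
    by apply: (continuous_comp h); exact: norm_continuous.
  exact: closed_ge.
- move=> i j ij x [/= h1 h2]; split; first by apply: le_trans h1 _; rewrite ler_nat.
  move=> y /h2; apply: le_trans; rewrite lef_pV2 ?posrE// ler_nat.
  exact: leq_ltn_trans ij _.
- apply/seteqP; split => [x [k _ [_ h]]|x Ax].
    by apply: contrapT => /h; rewrite subrr normr0 leNgt invr_gt0 ltr0n.
  have := open_nbhs_nbhs (conj oA Ax) => /nbhs_ballP[e /= e0 eA].
  have [N _ HN] := near_infty_natSinv_lt (PosNum e0).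
  pose m := maxn N (Num.truncn `|x|).+1.
  exists m => //; split => /=.
    apply: (@le_trans _ _ (Num.truncn `|x|).+1%:R).
      by apply/ltW; rewrite truncnS_gt.
    by rewrite ler_nat leq_maxr.
  move=> y nAy; rewrite leNgt; apply/negP => h; apply: nAy; apply: eA.
  rewrite mx_norm_ball /ball_ /=; apply: lt_trans h _.
  by apply: HN; rewrite /= leq_maxl.
Qed.

Variable W : set V.
Hypotheses (oW : open W) (bW : bounded_set W).

(** Approximating [A] and its complement in [W] at the same time makes the property symmetric under
    complement, as an induction over a sigma-algebra requires. The pair of disjoint compact sets is
    also what the later separation by continuous functions starts from. *)
Definition inner_regular (A : set V) := forall e : R, 0 < e ->
  exists K K', [/\ compact K, compact K', K `<=` A `&` W, K' `<=` W `\` A &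
    (mu (W `\` (K `|` K')) < e%:E)%E].

Let mW : measurable W. Proof. exact: open_measurable_rV. Qed.
Let fW : (mu W < +oo)%E. Proof. exact: bounded_lebesgue_fin. Qed.

Lemma lebesgue_lt_of_bigcap_lt (F : (set V)^nat) (a : \bar R) :
  (forall k, measurable (F k)) -> F 0%N `<=` W ->
  {homo F : i j / (i <= j)%N >-> j `<=` i} ->
  (mu (\bigcap_k F k) < a)%E -> exists k, (mu (F k) < a)%E.
Proof.
move=> mF F0 ndF Fa.
have h : mu \o F @ \oo --> mu (\bigcap_k F k).
  apply: nonincreasing_cvg_mu => //.
  - by apply: le_lt_trans fW; exact: lebesgue_rV_le.
  - exact: bigcapT_measurable.
  - by move=> i j ij; apply/subsetPset; exact: ndF.
apply: contrapT => /forallNP H; move: Fa; apply/negP; rewrite -leNgt.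
rewrite -(cvg_lim _ h)//; apply: lime_ge.
  by apply/cvg_ex; exists (mu (\bigcap_k F k)).
by apply: nearW => k /=; rewrite leNgt; apply/negP; exact: H.
Qed.

Lemma inner_regularC A : inner_regular A -> inner_regular (~` A).
Proof.
move=> rA e e0; have [K [K' [cK cK' KA K'A KK']]] := rA e e0.
exists K', K; split => //.
- by move=> x /K'A [].
- by move=> x /KA [Ax Wx]; split => //; apply.
- by rewrite setUC.
Qed.

Let mres K K' : compact K -> compact K' -> measurable (W `\` (K `|` K')).
Proof.
move=> cK cK'; apply: measurableD => //.
by apply: measurableU; exact: compact_measurable_rV.
Qed.

(** The two sides behave differently: the intersection of all [K' k] is compact, while the union of
    the [K k] is not and is cut at a finite rank by continuity from above. The infinite union leaves
    out at most [e / 2], which is strictly below [e]. *)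
Lemma inner_regular_bigcup (A : (set V)^nat) :
  (forall k, inner_regular (A k)) -> inner_regular (\bigcup_k A k).
Proof.
move=> rA e e0.
have /choice[K /choice[K' HK]] k : exists K K', [/\ compact K, compact K', K `<=` A k `&` W,
    K' `<=` W `\` A k & (mu (W `\` (K `|` K')) < (e / 2 / (2 ^ k.+1)%:R)%:E)%E].
  by apply: rA; rewrite !divr_gt0// ltr0n expn_gt0.
pose L' := \bigcap_k K' k.
have cL' : compact L'.
  apply: (@subclosed_compact _ _ (K' 0%N)).
  - by apply: closed_bigI => k _; apply: compact_closed_rV; case: (HK k).
  - by case: (HK 0%N).
  - by move=> x; exact.
have cK N : compact (\big[setU/set0]_(k < N) K k).
  apply: bounded_closed_compact.
    apply: bounded_setS bW; rewrite -bigcup_mkord => x [k _].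
    by case: (HK k) => _ _ h _ _ /h[].
  by apply: closed_bigsetU => k _; apply: compact_closed_rV; case: (HK k).
pose F N := W `\` ((\big[setU/set0]_(k < N) K k) `|` L').
have mF N : measurable (F N) by exact: mres.
have [|||N HN] := @lebesgue_lt_of_bigcap_lt F e%:E mF.
- by move=> x [].
- move=> i j ij x [Wx h]; split => // -[h1|h1]; apply: h; [left|by right].
  move: h1; rewrite -!bigcup_mkord => -[k /= ki Kx]; exists k => //=.
  exact: leq_trans ki ij.
- apply: (@le_lt_trans _ _ (e / 2)%:E); last first.
    by rewrite lte_fin ltr_pdivrMr// ltr_pMr// ltr1n.
  apply: le_trans (epsilon_trick0 xpredT _); last by rewrite divr_ge0// ltW.
  apply: (@le_trans _ _ (\sum_(k <oo) mu (W `\` (K k `|` K' k)))%E).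
    apply: measure_sigma_subadditive => //.
    - by move=> k; apply: mres; case: (HK k).
    - exact: bigcapT_measurable.
    - move=> x Fx; have [Wx _] := Fx 0%N I.
      have /existsNP[k nK'] : ~ (forall k, K' k x).
        by move=> h; case: (Fx 0%N I) => _; apply; right => k _; exact: h.
      exists k => //; split => // -[Kx|//].
      case: (Fx k.+1 I) => _; apply; left.
      by rewrite -bigcup_mkord; exists k => /=.
  by apply: lee_nneseries => [k _ _|k _]; [exact: measure_ge0|case: (HK k) => _ _ _ _ /ltW].
exists (\big[setU/set0]_(k < N) K k), L'; split => //.
- move=> x; rewrite -bigcup_mkord => -[k _]; case: (HK k) => _ _ h _ _ Kx.
  by have [Ax Wx] := h x Kx; split => //; exists k.
- move=> x L'x; split; first by case: (HK 0%N) => _ _ _ h _; apply: (h x (L'x 0%N I)).1.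
  by move=> [k _ Ax]; case: (HK k) => _ _ _ h _; by case: (h x (L'x k I)).
Qed.

Lemma inner_regular_open A : open A -> inner_regular A.
Proof.
move=> oA e e0.
have [C [cC ndC CE]] := open_compact_exhaustion (openI oA oW).
have [D [cD ndD DE]] := open_compact_exhaustion oW.
have cDA k : compact (D k `\` A).
  apply: (@subclosed_compact _ _ (D k)) => //.
  by apply: closedI; [exact: compact_closed_rV|exact: open_closedC].
have [|||k Hk] := @lebesgue_lt_of_bigcap_lt (fun k => W `\` (C k `|` D k `\` A)) e%:E
    (fun k => mres (cC k) (cDA k)).
- by move=> x [].
- move=> i j ij x [Wx h]; split => // -[h1|[h1 h2]]; apply: h; [left|right].
    exact: ndC ij _ h1.
  by split => //; exact: ndD ij _ h1.
- rewrite (_ : \bigcap_k _ = set0) ?measure0 ?lte_fin// -subset0 => x Fx.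
  have [Wx _] := Fx 0%N I.
  have [Ax|nAx] := pselect (A x).
    have : (A `&` W) x by [].
    by rewrite -CE => -[k _ Cx]; case: (Fx k I) => _; apply; left.
  move: Wx; rewrite -DE => -[k _ Dx].
  by case: (Fx k I) => _; apply; right.
exists (C k), (D k `\` A); split => //.
- by rewrite -CE => x Cx; exists k.
- by move=> x [Dx nA]; split => //; rewrite -DE; exists k.
Qed.

(** The inner regular sets form a sigma-algebra, so it is enough to treat generators: first
    coordinate preimages of Borel sets of [R], then coordinate preimages of open intervals, which
    are open. *)
Lemma inner_regular_borel (B : set (n.-tuple (measurableTypeR R))) :
  measurable B -> inner_regular (@tuple_of_rV R n @^-1` B).
Proof.
move: B; apply: smallest_sub.
  split.
  - by rewrite preimage_set0; apply: inner_regular_open; exact: open0.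
  - by move=> A rA; rewrite setTD preimage_setC; exact: inner_regularC.
  - by move=> F rF; rewrite preimage_bigcup; exact: inner_regular_bigcup.
move=> A; rewrite -bigcup_seq => -[i _ [M mM <-]]; rewrite setTI.
rewrite -comp_preimage.
suff : (@ocitv R).-sigma.-measurable `<=` [set M : set R | inner_regular ((fun x : V => x ord0 i) @^-1` M)].
  move=> /(_ M mM) /=; congr inner_regular; apply/seteqP.
  by split => x /=; rewrite tnth_mktuple.
rewrite RGenOpens.measurableE; apply: smallest_sub.
  split => /=.
  - by rewrite preimage_set0; apply: inner_regular_open; exact: open0.
  - by move=> B rB; rewrite setTD preimage_setC; exact: inner_regularC.
  - by move=> F rF; rewrite preimage_bigcup; exact: inner_regular_bigcup.
move=> U [a [b ->]] /=; apply: inner_regular_open.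
apply: open_comp; last exact: interval_open.
by move=> x _; exact: coord_continuous.
Qed.

(** [B] is the intersection over [k] of countable covers of [A] whose total mass exceeds that of [A]
    by less than [k.+1%:R^-1]. *)
Lemma borel_envelope (A : set V) : A `<=` W -> measurable A -> exists B,
  [/\ measurable B, A `<=` @tuple_of_rV R n @^-1` B &
      mu ((@tuple_of_rV R n @^-1` B) `\` A) = 0%E].
Proof.
move=> AW mA.
have fA : (mu A < +oo)%E by apply: le_lt_trans fW; exact: lebesgue_rV_le.
have /choice[F HF] k : exists F : (set (n.-tuple (measurableTypeR R)))^nat,
    [/\ forall i, measurable (F i), @rV_of_tuple R n @^-1` A `<=` \bigcup_i F i &
        (\sum_(i <oo) lebesgue_tuple R n (F i) < mu A + (k.+1%:R^-1)%:E)%E].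
  have : (mu A < mu A + (k.+1%:R^-1)%:E)%E.
    by rewrite lteDl ?ge0_fin_numE// lte_fin invr_gt0.
  rewrite {1}/lebesgue_rV /lebesgue_outer /mu_ext => /ereal_inf_lt[_ [F [mF AF] <-] h].
  by exists F; split.
pose B := \bigcap_k \bigcup_i F k i.
have mBk k : measurable (\bigcup_i F k i).
  by apply: bigcupT_measurable => i; case: (HF k).
have mB : measurable B by exact: bigcapT_measurable.
have ABs : A `<=` @tuple_of_rV R n @^-1` B.
  move=> x Ax k _; case: (HF k) => _ h _; apply: h => /=.
  by rewrite tuple_of_rVK.
have pB : @rV_of_tuple R n @^-1` (@tuple_of_rV R n @^-1` B) = B.
  by apply/seteqP; split => t /=; rewrite rV_of_tupleK.
have mB' : measurable (@tuple_of_rV R n @^-1` B).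
  by apply: borel_measurable_rV; rewrite pB.
exists B; split => //.
have BA : (mu (@tuple_of_rV R n @^-1` B) <= mu A)%E.
  apply/lee_addgt0Pr => e e0.
  have [N _ HN] := near_infty_natSinv_lt (PosNum e0).
  have /= Ne := HN N (leqnn N).
  rewrite borel_lebesgue_rV pB//.
  apply: (@le_trans _ _ (\sum_(i <oo) lebesgue_tuple R n (F N i))%E).
    apply: measure_sigma_subadditive => //; first by case: (HF N).
    by move=> t Bt; exact: Bt.
  apply/ltW; case: (HF N) => _ _ h; apply: lt_trans h _.
  by rewrite lteD2lE ?ge0_fin_numE// lte_fin.
rewrite measureD ?setIidr//; last by apply: le_lt_trans BA _.
have e : mu (@tuple_of_rV R n @^-1` B) = mu A.
  by apply/eqP; rewrite eq_le BA/= lebesgue_rV_le.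
change (mu (@tuple_of_rV R n @^-1` B) - mu A = 0)%E.
by rewrite e subee// ge0_fin_numE.
Qed.

(** A point of [W] outside an envelope of [W]\[A] lies in [A], and a point outside an envelope of
    [A]&[W] lies outside [A]. So the compact sets found outside the two envelopes are the ones
    wanted; what the envelopes share in excess is null. *)
Lemma inner_regular_measurable (A : set V) : measurable A -> inner_regular A.
Proof.
move=> mA e e0.
have [B2 [mB2 AB2 n2]] := borel_envelope (@subIsetr _ A W) (measurableI _ _ mA mW).
have mWA : measurable (W `\` A) by exact: measurableD.
have [B1 [mB1 AB1 n1]] := borel_envelope (@subDsetl _ W A) mWA.
have e20 : 0 < e / 2 by rewrite divr_gt0.
have [K1 [K1' [cK1 cK1' s1 s1' l1]]] := inner_regular_borel mB1 e20.
have [K2 [K2' [cK2 cK2' s2 s2' l2]]] := inner_regular_borel mB2 e20.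
exists K1', K2'; split => //.
- move=> x /s1'[Wx nB1]; split => //; apply: contrapT => nA; apply: nB1; exact: AB1.
- by move=> x /s2'[Wx nB2]; split => // Ax; apply: nB2; exact: AB2.
pose N1 := (@tuple_of_rV R n @^-1` B1) `\` (W `\` A).
pose N2 := (@tuple_of_rV R n @^-1` B2) `\` (A `&` W).
pose E1 := W `\` (K1 `|` K1'). pose E2 := W `\` (K2 `|` K2').
apply: (@le_lt_trans _ _ (mu ((E1 `|` E2) `|` (N1 `|` N2)))).
  apply: lebesgue_rV_le => x [Wx /not_orP[h1 h2]].
  have [k1|nk1] := pselect (K1 x); last by left; left; split => // -[].
  have [k2|nk2] := pselect (K2 x); last by left; right; split => // -[].
  right; have [b1 _] := s1 _ k1; have [b2 _] := s2 _ k2.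
  have [Ax|nAx] := pselect (A x); first by left; split => // -[].
  by right; split => // -[].
apply: le_lt_trans (lebesgue_rV_leU _ _) _.
have -> : mu (N1 `|` N2) = 0%E.
  apply/eqP; rewrite eq_le measure_ge0 andbT.
  by apply: le_trans (lebesgue_rV_leU _ _) _; rewrite n1 n2 adde0.
rewrite adde0; apply: le_lt_trans (lebesgue_rV_leU _ _) _.
by rewrite [e]splitr EFinD; exact: lteD.
Qed.

End inner_regularity.

(** * Test functions *)

Section flat_bump.
Context {R : realType}.
Implicit Types (p : {poly R}) (t : R).

(** The polynomial factor in [t^-1] makes the family closed under differentiation, so that
    smoothness follows by induction on the order. *)
Definition flat_exp p t : R := if t <= 0 then 0 else p.[t^-1] * expR (- t^-1).

(** With [x = h^-1], the difference quotient of [flat_exp p] at 0 is [p.[x] * x * expR (- x)].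
    Bounding the expression with one more factor [x] leaves a factor [h] that tends to 0. *)
Lemma flat_exp_bound p : exists C : R, 0 <= C /\
  forall x, 1 <= x -> `|p.[x]| * x ^+ 2 * expR (- x) <= C.
Proof.
exists (\sum_(i < size p) `|p`_i| * (i.+2)`!%:R); split.
  by apply: sumr_ge0 => i _; rewrite mulr_ge0.
move=> x x1; have x0 : 0 <= x by rewrite (le_trans _ x1).
rewrite horner_coef -mulrA.
apply: (@le_trans _ _ ((\sum_(i < size p) `|p`_i * x ^+ i|) * (x ^+ 2 * expR (- x)))).
  by apply: ler_wpM2r (ler_norm_sum _ _ _); rewrite mulr_ge0 ?exprn_ge0 ?expR_ge0.
rewrite mulr_suml; apply: ler_sum => i _.
rewrite normrM -mulrA ler_wpM2l// normrX ger0_norm// mulrA -exprD addn2 expRN.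
rewrite ler_pdivrMr ?expR_gt0// -ler_pdivrMl ?ltr0n ?fact_gt0// mulrC.
by apply: le_trans (expR_ge1Dxn i.+1 x0); rewrite lerDr.
Qed.

Lemma is_derive_flat_exp p t : is_derive t 1 (flat_exp p) (flat_exp ('X^2 * (p - p^`())) t).
Proof.
have [t0|t0|->] := ltgtP t 0.
- rewrite [X in is_derive _ _ _ X](_ : _ = 0); last by rewrite /flat_exp (ltW t0).
  apply: (@near_eq_is_derive _ _ _ (cst 0)).
    by near=> s; rewrite /flat_exp ifT//; apply/ltW; near: s; exact: lt_nbhsl.
- rewrite [X in is_derive _ _ _ X]/flat_exp leNgt t0/=.
  pose h x : R := p.[x] * expR (- x).
  apply: (@near_eq_is_derive _ _ _ (h \o (fun x => x^-1))).
    by near=> s; rewrite /flat_exp/= ifF//; apply/negbTE; rewrite -ltNge; near: s; exact: lt_nbhsr.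
  have tn0 : t != 0 by rewrite gt_eqF.
  have di : is_derive t 1 (fun x : R => x^-1) (- t ^- 2).
    apply: DeriveDef; first exact: derivableV.
    by rewrite (@deriveV _ _ id)// derive_id /GRing.scale/= mulr1.
  have dh (x : R) : is_derive x 1 h ((p^`() - p).[x] * expR (- x)).
    rewrite /h; apply: is_derive_eq.
    by rewrite /GRing.scale/= hornerD hornerN; ring.
  apply: is_derive_eq.
  rewrite !hornerE/= exprVn; ring.
- rewrite [X in is_derive _ _ _ X]/flat_exp lexx.
  have [C [C0 HC]] := flat_exp_bound p.
  suff H : h^-1 *: (flat_exp p (h *: 1 + 0) - flat_exp p 0) @[h --> 0^'] --> (0 : R).
    apply: DeriveDef; first by apply/cvg_ex; exists 0.
    exact: cvg_lim H.
  apply/cvgrPdist_le => e e0; near=> h.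
  rewrite sub0r normrN addr0 /flat_exp lexx subr0 [h *: 1]mulr1.
  have hn0 : h != 0 by near: h; exact: nbhs_dnbhs_neq.
  case: ifPn => [_|]; first by rewrite scaler0 normr0 ltW.
  rewrite -ltNge => h0.
  have h1 : 1 <= h^-1.
    rewrite invf_ge1//; apply: le_trans (ler_norm h) _.
    near: h; apply: dnbhs0_le; exact: ltr01.
  have := HC _ h1.
  rewrite [_ *: _]mulrC !normrM (ger0_norm (expR_ge0 _)).
  rewrite (ger0_norm (x := h^-1)) ?invr_ge0 ?(ltW h0)// => HCh.
  have -> : `|p.[h^-1]| * expR (- h^-1) * h^-1 =
     (`|p.[h^-1]| * h^-1 ^+ 2 * expR (- h^-1)) * h by field.
  apply: (@le_trans _ _ (C * h)); first by rewrite ler_wpM2r// ltW.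
  have he : h <= e / (C + 1).
    apply: le_trans (ler_norm h) _.
    by near: h; apply: dnbhs0_le; rewrite divr_gt0// ltr_wpDl.
  apply: (@le_trans _ _ (C * (e / (C + 1)))); first by rewrite ler_wpM2l.
  by rewrite mulrA ler_pdivrMr ?ltr_wpDl// mulrC ler_wpM2l ?(ltW e0)// lerDl.
Unshelve. all: by end_near.
Qed.

Lemma flat_exp1E t : flat_exp 1 t = if t <= 0 then 0 else expR (- t^-1).
Proof. by rewrite /flat_exp -[1]/(1%:P) hornerC mul1r. Qed.

Lemma flat_exp1_ge0 t : 0 <= flat_exp 1 t.
Proof. by rewrite flat_exp1E; case: ifP => // _; rewrite expR_ge0. Qed.

Lemma flat_exp1_gt0 t : (0 < flat_exp 1 t) = (0 < t).
Proof. by rewrite flat_exp1E; case: (leP t 0) => t0; rewrite ?ltxx ?expR_gt0. Qed.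

Lemma flat_exp1_le1 t : flat_exp 1 t <= 1.
Proof.
rewrite flat_exp1E; case: (leP t 0) => t0 //.
by rewrite expR_le1 oppr_le0 invr_ge0 ltW.
Qed.

End flat_bump.

Section smooth_functions.
Context {R : realType} {n : nat}.
Local Notation V := 'rV[R]_n.
Implicit Types (f g phi : V -> R).

(** [smooth] quantifies over sequences of directions. This layered form gives the induction
    hypotheses that sums and products need, the derivative of a product involving the factors
    themselves one order lower. *)
Fixpoint Ck k f : Prop := (forall x, differentiable f x) /\
  (if k is k'.+1 then forall i, Ck k' (fun x => 'D_('e_i) f x) else True).

Lemma smooth_derive f i : smooth f -> smooth (fun x => 'D_('e_i) f x).
Proof. by move=> sf s x; have := sf (rcons s i) x; rewrite foldr_rcons. Qed.

Lemma smoothP f : smooth f <-> forall k, Ck k f.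
Proof.
split=> [sf k|Cf s].
  elim: k f sf => [|k IH] f sf /=; split => //; try by move=> x; exact: (sf [::] x).
  by move=> i; apply: IH; exact: smooth_derive.
elim/last_ind: s f Cf => [|s i IH] f Cf x; first by case: (Cf 0%N).
by rewrite foldr_rcons; apply: IH => k; case: (Cf k.+1) => _; exact.
Qed.

Lemma Ck_differentiable k f : Ck k f -> forall x, differentiable f x.
Proof. by case: k => [|k] []. Qed.

Lemma CkS k f : Ck k.+1 f -> Ck k f.
Proof.
elim: k f => [|k IH] f [df Df]; first by split.
by split => // i; apply: IH; exact: Df.
Qed.

Lemma Ck_cst k c : Ck k (cst c).
Proof.
elim: k c => [|k IH] c; split; try by [move=> x; exact: differentiable_cst|].
by move=> i; rewrite (_ : (fun x => _) = cst 0)//; apply/funext => x; rewrite derive_cst.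
Qed.

Lemma CkD k f g : Ck k f -> Ck k g -> Ck k (f + g).
Proof.
elim: k f g => [|k IH] f g [df Df] [dg Dg]; split.
- by move=> x; exact: differentiableD.
- by [].
- by move=> x; exact: differentiableD.
- move=> i /=.
  rewrite (_ : (fun x => _) = (fun x => 'D_('e_i) f x) + (fun x => 'D_('e_i) g x)).
    by apply: IH; [exact: Df|exact: Dg].
  by apply/funext => x /=; rewrite deriveD//; exact: diff_derivable.
Qed.

Lemma CkM k f g : Ck k f -> Ck k g -> Ck k (f * g).
Proof.
have dM k' f' g' : Ck k' f' -> Ck k' g' -> forall x, differentiable (f' * g') x.
  by move=> Cf Cg x; apply: differentiableM; [exact: (Ck_differentiable Cf)|exact: (Ck_differentiable Cg)].
elim: k f g => [|k IH] f g Cf Cg; split => //; try exact: (dM _ _ _ Cf Cg).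
move=> i; rewrite (_ : (fun x => _) = (f * (fun x => 'D_('e_i) g x)) +
    (g * (fun x => 'D_('e_i) f x))); last first.
  apply/funext => x /=; rewrite deriveM//; apply: diff_derivable.
    exact: (Ck_differentiable Cf).
  exact: (Ck_differentiable Cg).
by apply: CkD; apply: IH; [exact: CkS|exact: Cg.2|exact: CkS|exact: Cf.2].
Qed.

Lemma smooth_cst c : smooth (cst c : V -> R).
Proof. by apply/smoothP => k; exact: Ck_cst. Qed.

Lemma smoothD f g : smooth f -> smooth g -> smooth (fun x => f x + g x).
Proof. by move=> /smoothP sf /smoothP sg; apply/smoothP => k; exact: CkD. Qed.

Lemma smoothM f g : smooth f -> smooth g -> smooth (fun x => f x * g x).
Proof. by move=> /smoothP sf /smoothP sg; apply/smoothP => k; exact: CkM. Qed.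

Lemma smoothB f g : smooth f -> smooth g -> smooth (fun x => f x - g x).
Proof.
move=> sf sg; rewrite (_ : (fun x => _) = (fun x => f x + -1 * g x)).
  by apply: smoothD => //; apply: smoothM => //; exact: smooth_cst.
by apply/funext => x; rewrite mulN1r.
Qed.

Lemma smoothX f m : smooth f -> smooth (fun x => f x ^+ m).
Proof.
move=> sf; elim: m => [|m IH]; first exact: smooth_cst.
by under eq_fun do rewrite exprS; exact: smoothM.
Qed.

Lemma smooth_sum I (s : seq I) (F : I -> V -> R) :
  (forall i, smooth (F i)) -> smooth (fun x => \sum_(i <- s) F i x).
Proof.
move=> sF; elim: s => [|i s IH].
  by under eq_fun do rewrite big_nil; exact: smooth_cst.
by under eq_fun do rewrite big_cons; exact: smoothD.
Qed.

Lemma smooth_prod I (s : seq I) (F : I -> V -> R) :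
  (forall i, smooth (F i)) -> smooth (fun x => \prod_(i <- s) F i x).
Proof.
move=> sF; elim: s => [|i s IH].
  by under eq_fun do rewrite big_nil; exact: smooth_cst.
by under eq_fun do rewrite big_cons; exact: smoothM.
Qed.

Lemma smooth_flat_exp (p : {poly R}) (s c : R) i :
  smooth (fun x : V => flat_exp p (s * x ord0 i + c)).
Proof.
apply/smoothP => k; elim: k p => [|k IH] p.
all: pose h (x : V) : R := s * x ord0 i + c.
all: have dh x : differentiable h x
  by apply: differentiableD => //; apply: differentiableM => //; exact: differentiable_coord.
all: have dp (y : R) : differentiable (flat_exp p) y
  by apply/derivable1_diffP; case: (is_derive_flat_exp p y).
all: have dc x : differentiable (fun x : V => flat_exp p (s * x ord0 i + c)) x
  by exact: (@differentiable_comp _ _ _ _ h (flat_exp p)).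
all: split => //= j.
rewrite (_ : (fun x => _) = cst (s * ('e_j : V) ord0 i) *
   (fun x : V => flat_exp ('X^2 * (p - p^`())) (s * x ord0 i + c))).
  by apply: CkM; [exact: Ck_cst|exact: IH].
apply/funext => x.
have Dh : 'D_('e_j) h x = s * ('e_j : V) ord0 i.
  apply: cvg_lim => //; apply: cvg_near_cst; near=> t.
  have t0 : t != 0 by near: t; exact: nbhs_dnbhs_neq.
  have e : (t *: 'e_j + x) ord0 i = t * ('e_j : V) ord0 i + x ord0 i by rewrite !mxE.
  transitivity (t^-1 * (s * (t * ('e_j : V) ord0 i + x ord0 i) + c - (s * x ord0 i + c))).
    by rewrite -e.
  by field.
have -> : 'D_('e_j) (fun x : V => flat_exp p (s * x ord0 i + c)) x =
    'd (flat_exp p) (h x) ('d h x ('e_j : V)).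
  by rewrite deriveE// (@diff_comp _ _ _ _ h (flat_exp p)).
rewrite -(deriveE ('e_j : V) (dh x)) Dh diff1E//= derive1E.
by rewrite (@derive_val _ _ _ _ _ _ _ (is_derive_flat_exp p (h x))).
Unshelve. all: by end_near.
Qed.

End smooth_functions.

Section test_functions.
Context {R : realType} {n : nat}.
Local Notation V := 'rV[R]_n.
Implicit Types (f g phi : V -> R) (W K : set V).

Lemma test_functionI W K phi : smooth phi -> compact K -> K `<=` W ->
  (forall x, ~ K x -> phi x = 0) -> test_function W phi.
Proof.
move=> sphi cK KW phi0.
have suppK : closure [set x | phi x != 0] `<=` K.
  rewrite [X in _ `<=` X](closure_id _).1; last exact: compact_closed_rV.
  by apply: closureS => x /= /eqP p0; apply: contrapT => /phi0.
split => //; last exact: subset_trans KW.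
by apply: subclosed_compact suppK => //; exact: closed_closure.
Qed.

Lemma test_functionS W W' phi : W `<=` W' -> test_function W phi -> test_function W' phi.
Proof. by move=> WW' [s c h]; split => //; exact: subset_trans WW'. Qed.

Lemma test_function0 W phi x : test_function W phi -> ~ W x -> phi x = 0.
Proof.
move=> [_ _ h] nW; apply: contrapT => /eqP p0; apply: nW; apply: h.
exact: subset_closure.
Qed.

Lemma test_functionMr W f phi : smooth f -> test_function W phi ->
  test_function W (fun x => f x * phi x).
Proof.
move=> sf [sphi cK KW]; apply: test_functionI cK KW _; first exact: smoothM.
move=> x nK; rewrite (_ : phi x = 0) ?mulr0//.
by apply: contrapT => /eqP p0; apply: nK; exact: subset_closure.
Qed.

Lemma test_functionD W f g : test_function W f -> test_function W g ->
  test_function W (fun x => f x + g x).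
Proof.
move=> [sf cf fW] [sg cg gW].
apply: (@test_functionI _ (closure [set x | f x != 0] `|` closure [set x | g x != 0])).
- exact: smoothD.
- apply: bounded_closed_compact; last by apply: closedU; exact: closed_closure.
  move: (compact_bounded cf) (compact_bounded cg) => [M [_ HM]] [N [_ HN]].
  exists (Num.max M N); split; first exact: num_real.
  by move=> r; rewrite gt_max => /andP[Mr Nr] x [/HM|/HN]; exact.
- by move=> x [/fW|/gW].
- move=> x /not_orP[h1 h2].
  have -> : f x = 0 by apply: contrapT => /eqP p0; apply: h1; exact: subset_closure.
  by rewrite add0r; apply: contrapT => /eqP p0; apply: h2; exact: subset_closure.
Qed.

Lemma test_functionB W f g : test_function W f -> test_function W g ->
  test_function W (fun x => f x - g x).
Proof.
move=> tf tg; under eq_fun do rewrite -mulN1r.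
by apply: test_functionD => //; apply: test_functionMr => //; exact: smooth_cst.
Qed.

Lemma test_function_cst0 W : test_function W (cst 0).
Proof.
apply: (@test_functionI _ set0) => //; first exact: smooth_cst.
exact: compact0.
Qed.

Lemma test_function_derive W phi i : test_function W phi ->
  test_function W (fun x => 'D_('e_i) phi x).
Proof.
move=> [sphi cK KW]; apply: test_functionI cK KW _; first exact: smooth_derive.
move=> x nK; rewrite (@near_eq_derive _ _ _ _ (cst 0)) ?derive_cst//.
have : nbhs x (~` closure [set x | phi x != 0]).
  by apply: open_nbhs_nbhs; split => //; exact/closed_openC/closed_closure.
apply: filterS => y nKy /=.
by apply: contrapT => /eqP p0; apply: nKy; exact: subset_closure.
Qed.

Lemma smooth_continuous phi : smooth phi -> continuous phi.
Proof. by move=> sphi x; apply: differentiable_continuous; exact: (sphi [::] x). Qed.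

Lemma test_function_continuous W phi : test_function W phi -> continuous phi.
Proof. by case=> /smooth_continuous. Qed.

Lemma compact_support_bounded K phi : compact K -> continuous phi ->
  (forall x, ~ K x -> phi x = 0) -> exists2 M, 0 <= M & forall x, `|phi x| <= M.
Proof.
move=> cK cphi phi0.
have : compact (phi @` K).
  by apply: continuous_compact => //; exact: continuous_subspaceT.
move=> /compact_bounded[M [_ HM]]; exists (`|M| + 1) => [|x]; first exact: addr_ge0.
have [Kx|nKx] := pselect (K x); last by rewrite phi0// normr0 addr_ge0.
by apply: HM; [rewrite ltr_pwDr// ler_norm|exists x].
Qed.

Lemma test_function_bounded W phi : test_function W phi ->
  exists2 M, 0 <= M & forall x, `|phi x| <= M.
Proof.
move=> [sphi cK KW]; apply: (compact_support_bounded cK).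
  exact: smooth_continuous.
move=> x nK; apply: contrapT => /eqP p0; apply: nK; exact: subset_closure.
Qed.

Definition bump (c : V) (r : R) (x : V) : R :=
  \prod_(i < n) (flat_exp 1 (x ord0 i - (c ord0 i - r)) *
                 flat_exp 1 (c ord0 i + r - x ord0 i)).

Lemma smooth_bump c r : smooth (bump c r).
Proof.
apply: smooth_prod => i; apply: smoothM.
  under eq_fun do rewrite -[X in X - _]mul1r.
  exact: smooth_flat_exp.
under eq_fun do rewrite addrC -mulN1r.
exact: smooth_flat_exp.
Qed.

Lemma bump_ge0 c r x : 0 <= bump c r x.
Proof. by apply: prodr_ge0 => i _; rewrite mulr_ge0// flat_exp1_ge0. Qed.

Lemma bump_le1 c r x : bump c r x <= 1.
Proof.
by apply: prodr_ile1 => i _; rewrite mulr_ge0 ?flat_exp1_ge0//= mulr_ile1 ?flat_exp1_ge0 ?flat_exp1_le1.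
Qed.

Lemma bump_gt0 c r x : 0 < r -> (0 < bump c r x) = (`|c - x| < r).
Proof.
move=> r0; apply/idP/idP => [b0|cx].
  have : ball c r x.
    split => // i j; rewrite (ord1 i).
    have : bump c r x != 0 by rewrite gt_eqF.
    move=> /prodf_neq0/(_ j isT); rewrite mulf_eq0 negb_or => /andP[h1 h2].
    have : 0 < x ord0 j - (c ord0 j - r) by rewrite -flat_exp1_gt0 lt_neqAle eq_sym h1 flat_exp1_ge0.
    have : 0 < c ord0 j + r - x ord0 j by rewrite -flat_exp1_gt0 lt_neqAle eq_sym h2 flat_exp1_ge0.
    by rewrite /ball/= ltr_norml => ? ?; apply/andP; split; lra.
  by rewrite mx_norm_ball.
apply: prodr_gt0 => i _.
have : `|(c - x) ord0 i| < r by apply: le_lt_trans cx; exact: coord_le_norm.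
by rewrite !mxE ltr_norml => /andP[h1 h2]; rewrite mulr_gt0 ?flat_exp1_gt0//; lra.
Qed.

Lemma closed_cball (c : V) (r : R) : closed [set y | `|c - y| <= r].
Proof.
apply: (@closed_comp _ _ (fun x : V => `|c - x|) [set s | s <= r]).
  move=> x _; have h : {for x, continuous (fun x : V => c - x)}.
    by apply: continuousB; [exact: cst_continuous|exact: cvg_id].
  by apply: (continuous_comp h); exact: norm_continuous.
exact: closed_le.
Qed.

(* [phi = 1 - (1 - beta / M) ^ N] where [beta] is a finite sum of bumps. *)
Lemma smooth_urysohn K W (e : R) : compact K -> open W -> K `<=` W -> 0 < e ->
  exists phi, [/\ test_function W phi, forall x, 0 <= phi x <= 1 &
    forall x, K x -> 1 - e <= phi x].
Proof.
move=> cK oW KW e0.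
have [->|K0] := eqVneq K set0.
  exists (cst 0); split => //; first exact: test_function_cst0.
  by move=> x; rewrite lexx ler01.
have /choice[r Hr] x : exists r : R, 0 < r /\ (K x -> forall y, `|x - y| <= r -> W y).
  have [Kx|nK] := pselect (K x); last by exists 1.
  have := open_nbhs_nbhs (conj oW (KW _ Kx)) => /nbhs_ballP[s /= s0 sW].
  exists (s / 2); split; first by rewrite divr_gt0.
  move=> _ y xy; apply: sW; rewrite mx_norm_ball /ball_/=.
  by apply: le_lt_trans xy _; rewrite ltr_pdivrMr// ltr_pMr// ltr1n.
have [D DK cov] : finite_subset_cover K (fun x => ball x (r x)) K.
  move: cK; rewrite compact_cover; apply.
    by move=> x Kx; exact: ball_open.
  by move=> x Kx; exists x => //; apply: ballxx; case: (Hr x).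
pose s : seq V := finmap.enum_fset D.
pose beta x := \sum_(c <- s) bump c (r c) x.
have beta0 x : 0 <= beta x by apply: sumr_ge0 => c _; exact: bump_ge0.
have betaM x : beta x <= (size s)%:R.
  rewrite /beta -sum1_size natr_sum; apply: ler_sum => c _; exact: bump_le1.
have sbeta : smooth beta by apply: smooth_sum => c; exact: smooth_bump.
have betaK x : K x -> 0 < beta x.
  move=> /cov[c Dc cx]; rewrite lt_neqAle beta0 andbT eq_sym psumr_neq0; last first.
    by move=> y _; exact: bump_ge0.
  apply/hasP; exists c => //=; rewrite bump_gt0; last by case: (Hr c).
  by move: cx; rewrite mx_norm_ball.
have [c cKc cmin] : exists2 c, c \in K & forall t, t \in K -> beta c <= beta t.
  apply: compact_EVT_min => //; first exact/set0P.
  exact/continuous_subspaceT/smooth_continuous.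
have bc : 0 < beta c by apply: betaK; exact: set_mem.
have M0 : (0 : R) < (size s)%:R by apply: lt_le_trans bc _.
pose q x := 1 - beta x / (size s)%:R.
have q01 x : 0 <= q x <= 1.
  by rewrite subr_ge0 ler_pdivrMr// mul1r betaM/= lerBlDr lerDl divr_ge0// ltW.
(* By compactness [beta] has a positive minimum on [K], attained at [c]. Hence [q <= q c < 1] on all
   of [K] and a single power [N] is good for every point. *)
have [N HN] : exists N : nat, q c ^+ N < e.
  have : q c ^+ k @[k --> \oo] --> 0.
    apply: cvg_expr; have /andP[q0 _] := q01 c.
    by rewrite ger0_norm// ltrBlDr ltrDl divr_gt0.
  move=> /cvgrPdist_lt/(_ _ e0)[N _ H]; exists N.
  have := H N (leqnn N); rewrite sub0r normrN ger0_norm//.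
  by rewrite exprn_ge0//; case/andP: (q01 c).
exists (fun x => 1 - q x ^+ N); split.
- have cC : compact (\big[setU/set0]_(c <- s) [set y | `|c - y| <= r c]).
    apply: bounded_closed_compact; last first.
      by apply: closed_bigsetU => y _; exact: closed_cball.
    exists (\sum_(y <- s) (`|y| + `|r y|)); split; first exact: num_real.
    move=> M HM x; rewrite -bigcup_seq => -[d /= ds dx].
    apply: le_trans (ltW HM); rewrite (big_rem d)//=.
    apply: (@le_trans _ _ (`|d| + `|r d|)); last first.
      by rewrite lerDl sumr_ge0// => i _; rewrite addr_ge0.
    rewrite -[x](subKr d); apply: le_trans (ler_normB _ _) _.
    by rewrite lerD2l; apply: le_trans dx _; exact: ler_norm.
  apply: (@test_functionI _ _ _ _ cC).
  + apply: smoothB; first exact: smooth_cst.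
    apply: smoothX; apply: smoothB; first exact: smooth_cst.
    by apply: smoothM => //; exact: smooth_cst.
  + move=> y; rewrite -bigcup_seq => -[d /= ds dy].
    have Kd : K d by have := DK _ ds; rewrite inE.
    by case: (Hr d) => _; apply; last exact: dy.
  + move=> y; rewrite -bigcup_seq => ny.
    have b0 : beta y = 0.
      rewrite /beta big_seq big1// => d ds; apply/eqP; rewrite eq_le bump_ge0 andbT.
      rewrite leNgt bump_gt0; last by case: (Hr d).
      by apply/negP => /ltW h; apply: ny; exists d.
    by rewrite /q b0 mul0r subr0 expr1n subrr.
- move=> x; have /andP[q0 q1] := q01 x.
  by rewrite subr_ge0 exprn_ile1//= lerBlDr lerDl exprn_ge0.
- move=> x Kx; rewrite lerD2l lerN2; apply/ltW; apply: le_lt_trans HN.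
  have /andP[q0 _] := q01 x; apply: lerXn2r; rewrite ?nnegrE//.
    by case/andP: (q01 c).
  by rewrite lerD2l lerN2 ler_pM2r ?invr_gt0//; apply: cmin; exact: mem_set.
Qed.

End test_functions.

(** * Integrals against test functions *)

Section real_integrable.
Context d (T : measurableType d) (R : realType) (mu : {measure set T -> \bar R}).
Variable D : set T.
Hypothesis mD : measurable D.
Implicit Types f g h : T -> R.
Local Notation integ f := (mu.-integrable D (EFin \o f)).

Lemma integ_measurable f : integ f -> measurable_fun D f.
Proof. by move=> /measurable_int/measurable_EFinP. Qed.

Lemma measurable_norm f : measurable_fun D f -> measurable_fun D (fun x => `|f x|).
Proof. by move=> mf; exact: measurableT_comp. Qed.

Lemma integD f g : integ f -> integ g -> integ (fun x => f x + g x).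
Proof.
move=> fi gi; rewrite (_ : _ \o _ = (EFin \o f) \+ (EFin \o g))%E//.
exact: integrableD.
Qed.

Lemma integB f g : integ f -> integ g -> integ (fun x => f x - g x).
Proof.
move=> fi gi; rewrite (_ : _ \o _ = (EFin \o f) \- (EFin \o g))%E//.
exact: integrableB.
Qed.

Lemma integZ c f : integ f -> integ (fun x => c * f x).
Proof.
move=> fi; rewrite (_ : _ \o _ = (fun x => c%:E * (EFin \o f) x)%E)//.
exact: integrableZl.
Qed.

Lemma integ_le f g : measurable_fun D f -> (forall x, D x -> `|f x| <= g x) ->
  integ g -> integ f.
Proof.
move=> mf fg gi; apply: (le_integrable mD _ _ gi); first exact/measurable_EFinP.
move=> x Dx /=; rewrite lee_fin; apply: le_trans (fg x Dx) _; exact: ler_norm.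
Qed.

Lemma integ_norm f : integ f -> integ (fun x => `|f x|).
Proof. by move=> /integrable_norm. Qed.

Lemma integMb f h (M : R) : measurable_fun D h -> (forall x, D x -> `|h x| <= M) ->
  integ f -> integ (fun x => h x * f x).
Proof.
move=> mh hM fi; apply: (@integ_le _ (fun x => M * `|f x|)).
- by apply: measurable_funM => //; exact: integ_measurable.
- by move=> x Dx; rewrite normrM ler_wpM2r// hM.
- exact/integZ/integ_norm.
Qed.

Lemma integ0 : integ (cst 0).
Proof. exact: integrable0. Qed.

Lemma integ_bounded f (M : R) : (mu D < +oo)%E -> measurable_fun D f ->
  (forall x, D x -> `|f x| <= M) -> integ f.
Proof.
move=> fD mf fM; apply: measurable_bounded_integrable => //.
exists M; split; first exact: num_real.
by move=> r Mr x Dx; apply: le_trans (fM x Dx) (ltW Mr).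
Qed.

Lemma Rintegral_dominated_cvg (f_ : (T -> R)^nat) f g :
  (forall k, measurable_fun D (f_ k)) -> measurable_fun D f ->
  {ae mu, forall x, D x -> f_ k x @[k --> \oo] --> f x} ->
  integ g -> (forall k x, D x -> `|f_ k x| <= g x) ->
  \int[mu]_(x in D) f_ k x @[k --> \oo] --> \int[mu]_(x in D) f x.
Proof.
move=> mf_ mf f_f gi f_g.
have mf_' k : measurable_fun D (EFin \o f_ k) by exact/measurable_EFinP.
have mf' : measurable_fun D (EFin \o f) by exact/measurable_EFinP.
have f_f' : {ae mu, forall x, D x -> (EFin \o f_ k) x @[k --> \oo] --> (EFin \o f) x}.
  apply: filterS f_f => x h /h {}h; apply: (@cvg_comp _ _ _ _ EFin _ _ _ h).
  exact: cvg_refl.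
have f_g' : {ae mu, forall x k, D x -> (`|(EFin \o f_ k) x| <= (EFin \o g) x)%E}.
  by apply: aeW => x k Dx; rewrite lee_fin f_g.
have [fi _ h] := dominated_convergence mD mf_' mf' f_f' gi f_g'.
apply: fine_cvg; rewrite fineK//.
exact: integrable_fin_num.
Qed.

Lemma ler_norm_Rintegral f g : integ f -> integ g ->
  (forall x, D x -> `|f x| <= g x) ->
  `|\int[mu]_(x in D) f x| <= \int[mu]_(x in D) g x.
Proof.
move=> fi gi fg; apply: le_trans (le_normr_Rintegral mD fi) _.
by apply: le_Rintegral => //; exact: integ_norm.
Qed.

End real_integrable.

Section restrict.
Context d (T : measurableType d) (R : realType) (mu : {measure set T -> \bar R}).
Implicit Types f : T -> R.

Lemma integ_patch D f : measurable D ->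
  mu.-integrable D (EFin \o f) <-> mu.-integrable setT (EFin \o (f \_ D)).
Proof.
by move=> mD; rewrite (integrable_mkcond _ mD) restrict_EFin.
Qed.

Lemma integ_subset D E f : measurable D -> measurable E -> D `<=` E ->
  mu.-integrable E (EFin \o f) -> mu.-integrable D (EFin \o f).
Proof. by move=> mD mE DE; exact: integrableS. Qed.

End restrict.

(** * Density of test functions and pointwise consequences of weak convergence *)

Section density.
Context {R : realType} {n : nat}.
Local Notation V := 'rV[R]_n.
Local Notation mu := (@lebesgue_rV R n).

Lemma continuous_measurable_rV (D : set V) (f : V -> R) : measurable D ->
  continuous f -> measurable_fun D f.
Proof.
move=> mD cf; apply: (measurability _ (RGenOpens.measurableE R)).
move=> _ [_ [a [b ->] <-]]; apply: measurableI => //.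
apply: open_measurable_rV; apply: open_comp; last exact: interval_open.
by move=> x _; exact: cf.
Qed.

Lemma test_function_measurable (D W : set V) phi : measurable D ->
  test_function W phi -> measurable_fun D phi.
Proof. by move=> mD /test_function_continuous; exact: continuous_measurable_rV. Qed.

Variable W : set V.
Hypotheses (oW : open W) (bW : bounded_set W).

Let mW : measurable W. Proof. exact: open_measurable_rV. Qed.
Let fW : (mu W < +oo)%E. Proof. exact: bounded_lebesgue_fin. Qed.

(** The set where [phi k] differs from the indicator by more than [k.+1%:R^-1] lies in a set of
    measure below [2 ^- k.+1]. These measures are summable, so by the Borel-Cantelli lemma almost
    every point lies in finitely many of the sets. *)
Lemma test_function_approx_indic (A : set V) : measurable A ->
  exists phi : (V -> R)^nat, [/\ forall k, test_function W (phi k),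
    forall k x, 0 <= phi k x <= 1 &
    {ae mu, forall x, W x -> phi k x @[k --> \oo] --> (\1_A x : R)}].
Proof.
move=> mA.
have H k : exists phi : V -> R, [/\ test_function W phi, forall x, 0 <= phi x <= 1 &
    exists E, [/\ measurable E, (mu E < (1 / (2 ^ k.+1)%:R)%:E)%E &
    forall x, W x -> ~ E x -> `|\1_A x - phi x| <= k.+1%:R^-1]].
  have e0 : (0 : R) < 1 / (2 ^ k.+1)%:R by rewrite divr_gt0// ltr0n expn_gt0.
  have [K [K' [cK cK' KA K'A HE]]] := inner_regular_measurable oW bW mA e0.
  have oWK : open (W `\` K').
    by apply: openI => //; apply: closed_openC; exact: compact_closed_rV.
  have KW : K `<=` W `\` K'.
    by move=> x /KA[Ax Wx]; split => // /K'A[].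
  have k0 : (0 : R) < k.+1%:R^-1 by rewrite invr_gt0.
  have [phi [tphi phi01 phiK]] := smooth_urysohn cK oWK KW k0.
  exists phi; split => //; first by apply: test_functionS tphi; exact: subDsetl.
  exists (W `\` (K `|` K')); split => //.
    by apply: measurableD => //; apply: measurableU; exact: compact_measurable_rV.
  move=> x Wx nE; have [Kx|K'x] : (K `|` K') x by apply: contrapT => h; apply: nE.
    have [Ax _] := KA _ Kx; rewrite indicE mem_set// ger0_norm.
      by rewrite lerBlDr -lerBlDl; exact: phiK.
    by rewrite subr_ge0; case/andP: (phi01 x).
  have [_ nAx] := K'A _ K'x; rewrite indicE memNset//.
  rewrite (test_function0 tphi) ?subrr ?normr0 ?invr_ge0//.
  by case.
have /choice[phi Hphi] := H.
exists phi; split => [k|k x|]; try by case: (Hphi k).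
have /choice[E HE] k : exists E, [/\ measurable E, (mu E < (1 / (2 ^ k.+1)%:R)%:E)%E &
    forall x, W x -> ~ E x -> `|\1_A x - phi k x| <= k.+1%:R^-1] by case: (Hphi k).
exists (lim_sup_set E); split.
- apply: bigcapT_measurable => k; apply: bigcup_measurable => j _.
  by case: (HE j).
- apply: lim_sup_set_cvg0; first by move=> k; case: (HE k).
  apply: (@le_lt_trans _ _ 1%:E); last by rewrite ltry.
  apply: le_trans (epsilon_trick0 xpredT _); last exact: ler01.
  by apply: lee_nneseries => [k _ _|k _]; [exact: measure_ge0|case: (HE k) => _ /ltW].
move=> x /= /not_implyP[Wx nc] N _; apply: contrapT => nE; apply: nc.
apply/cvgrPdist_le => e e0.
have [M _ HM] := near_infty_natSinv_lt (PosNum e0).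
exists (maxn N M) => // k /=; rewrite geq_max => /andP[Nk Mk].
have [_ _ h] := HE k.
apply: le_trans (h x Wx _) _; first by move=> Ex; apply: nE; exists k.
by apply/ltW; exact: HM.
Qed.

(** Duality between L^1 and bounded functions: the norm is the integral of [q] against its sign
    [\1_A - \1_B], which is a bounded almost everywhere limit of test functions. Both approximations
    take values in [[0, 1]], so their difference is an allowed [phi]. *)
Lemma Rintegral_norm_le_test (q : V -> R) (c : R) : mu.-integrable W (EFin \o q) ->
  (forall phi, test_function W phi -> (forall x, `|phi x| <= 1) ->
    `|\int[mu]_(x in W) (phi x * q x)| <= c) ->
  \int[mu]_(x in W) `|q x| <= c.
Proof.
move=> qi Hq; have mq := integ_measurable qi.
pose A := W `&` [set x | 0 < q x]; pose B := W `&` [set x | q x < 0].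
have mA : measurable A.
  rewrite (_ : A = W `&` q @^-1` `]0, +oo[); first exact: mq.
  by apply/seteqP; split => x /=; rewrite in_itv/= andbT.
have mB : measurable B.
  rewrite (_ : B = W `&` q @^-1` `]-oo, 0[); first exact: mq.
  by apply/seteqP; split => x /=; rewrite in_itv/=.
have [phi [tphi phi01 phiA]] := test_function_approx_indic mA.
have [psi [tpsi psi01 psiB]] := test_function_approx_indic mB.
have H : \int[mu]_(x in W) ((phi k x - psi k x) * q x) @[k --> \oo] -->
    \int[mu]_(x in W) `|q x|.
  apply: (@Rintegral_dominated_cvg _ _ _ _ _ mW _ _ (fun x => `|q x|)).
  - move=> k; apply: measurable_funM; last exact: mq.
    apply: measurable_funB.
      exact: (test_function_measurable mW (tphi k)).
    exact: (test_function_measurable mW (tpsi k)).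
  - exact: measurable_norm.
  - apply: filterS2 phiA psiB => x hA hB Wx.
    have -> : `|q x| = (\1_A x - \1_B x) * q x.
      rewrite !indicE; have [q0|q0|q0] := ltgtP (q x) 0.
      + rewrite memNset ?mem_set; last 2 first.
        * by split.
        * by move=> [_ /=]; rewrite ltNge ltW.
        by rewrite /= sub0r mulN1r ltr0_norm.
      + rewrite mem_set ?memNset; last 2 first.
        * by move=> [_ /=]; rewrite ltNge ltW.
        * by split.
        by rewrite /= subr0 mul1r gtr0_norm.
      + by rewrite q0 normr0 mulr0.
    by apply: cvgM; [apply: cvgB; [exact: hA|exact: hB]|exact: cvg_cst].
  - exact: integ_norm.
  - move=> k x _; rewrite normrM -[leRHS]mul1r ler_wpM2r//.
    have := phi01 k x; have := psi01 k x => /andP[? ?] /andP[? ?].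
    by rewrite ler_norml; apply/andP; split; lra.
rewrite -(cvg_lim _ H)//; apply: limr_le; first by apply/cvg_ex; eexists; exact: H.
apply: nearW => k; apply: le_trans (ler_norm _) _; apply: Hq.
  exact: test_functionB.
move=> x; have := phi01 k x; have := psi01 k x => /andP[? ?] /andP[? ?].
by rewrite ler_norml; apply/andP; split; lra.
Qed.

(** The common bound [Q] makes the replacement of the indicator by a test function uniform in [k]:
    its cost is the integral of [|phi N - \1_A| * Q]. *)
Lemma weak_cvg0_indic (q : (V -> R)^nat) (Q : V -> R) :
  (forall k, measurable_fun W (q k)) ->
  mu.-integrable W (EFin \o Q) -> (forall k x, W x -> `|q k x| <= Q x) ->
  (forall phi, test_function W phi ->
    \int[mu]_(x in W) (phi x * q k x) @[k --> \oo] --> (0 : R)) ->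
  forall A, measurable A ->
    \int[mu]_(x in W) (\1_A x * q k x) @[k --> \oo] --> (0 : R).
Proof.
move=> mq Qi qQ Hq A mA.
have qi k : mu.-integrable W (EFin \o q k) by apply: integ_le Qi => //; exact: qQ.
have [phi [tphi phi01 phiA]] := test_function_approx_indic mA.
have mI : measurable_fun W (\1_A : V -> R) by exact: measurable_indic.
have I1 x : `|(\1_A x : R)| <= 1 by rewrite indicE; case: (_ \in _); rewrite ?normr1 ?normr0.
have p1 k x : `|phi k x| <= 1 by have /andP[p0 ?] := phi01 k x; rewrite ger0_norm.
have d2 k x : `|phi k x - \1_A x| <= 2.
  by apply: le_trans (ler_normB _ _) _; have := p1 k x; have := I1 x; lra.
have mp k : measurable_fun W (phi k) by exact: (test_function_measurable mW (tphi k)).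
have H : \int[mu]_(x in W) (`|phi k x - \1_A x| * Q x) @[k --> \oo] -->
    \int[mu]_(x in W) (0 : R).
  apply: (@Rintegral_dominated_cvg _ _ _ _ _ mW _ _ (fun x => 2 * `|Q x|)).
  - move=> k; apply: measurable_funM; last exact: integ_measurable Qi.
    exact/measurable_norm/(measurable_funB (mp k) mI).
  - exact: measurable_cst.
  - apply: filterS phiA => x hA Wx.
    rewrite [X in _ --> X](_ : _ = `|\1_A x - \1_A x| * Q x); last by rewrite subrr normr0 mul0r.
    apply: cvgM; last exact: cvg_cst.
    by apply: cvg_norm; apply: cvgB; [exact: hA|exact: cvg_cst].
  - exact/integZ/integ_norm.
  - by move=> k x _; rewrite normrM normr_id ler_wpM2r.
rewrite Rintegral_cst//= mul0r in H.
apply/cvgrPdist_le => e e0.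
have e20 : 0 < e / 2 by rewrite divr_gt0.
move/cvgrPdist_le : H => /(_ _ e20)[N _ /(_ N (leqnn N))]; rewrite sub0r normrN => HN.
move/cvgrPdist_le : (Hq _ (tphi N)) => /(_ _ e20); apply: filterS => k.
rewrite !sub0r !normrN => Hk.
have i1 : mu.-integrable W (EFin \o (fun x => phi N x * q k x)).
  exact: (integMb mW (mp N) (fun x _ => p1 N x)).
have i2 : mu.-integrable W (EFin \o (fun x => \1_A x * q k x)).
  exact: (integMb mW mI (fun x _ => I1 x)).
have -> : \int[mu]_(x in W) (\1_A x * q k x) = \int[mu]_(x in W) (phi N x * q k x) -
   \int[mu]_(x in W) (phi N x * q k x - \1_A x * q k x).
  by rewrite [X in _ = _ - X]RintegralB// subKr.
apply: le_trans (ler_normB _ _) _; rewrite [e]splitr lerD//.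
apply: le_trans HN; apply: le_trans _ (ler_norm _).
apply: (ler_norm_Rintegral mW).
- exact: (integB mW i1 i2).
- have mB := measurable_norm (measurable_funB (mp N) mI).
  apply: (integMb mW mB _ Qi) => x _; rewrite normr_id; exact: d2.
- by move=> x Wx; rewrite -mulrBl normrM ler_wpM2l// qQ.
Qed.

(** At a point where [q k x] has a positive limit, [q k x >= m.+1%:R^-1] for some [m] and all [k]
    from some rank [N] on. Tested against the indicator of the set [A m N] of such points, [q k] has
    an integral of at least [m.+1%:R^-1] times the measure of the set, and this integral tends to 0.
    The limit [l] is quantified inside, so nothing is asked at points without a limit. *)
Lemma weak_cvg0_le0 (q : (V -> R)^nat) (Q : V -> R) :
  (forall k, measurable_fun W (q k)) ->
  mu.-integrable W (EFin \o Q) -> (forall k x, W x -> `|q k x| <= Q x) ->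
  (forall phi, test_function W phi ->
    \int[mu]_(x in W) (phi x * q k x) @[k --> \oo] --> (0 : R)) ->
  {ae mu, forall x, W x -> forall l, q k x @[k --> \oo] --> l -> l <= 0}.
Proof.
move=> mq Qi qQ Hq.
have qi k : mu.-integrable W (EFin \o q k) by apply: integ_le Qi => //; exact: qQ.
pose A m N : set V := \bigcap_(k in [set k | (N <= k)%N]) (W `&` [set x | m.+1%:R^-1 <= q k x]).
have mA m N : measurable (A m N).
  apply: bigcap_measurable => [|k _]; first by exists N => /=.
  rewrite (_ : _ `&` _ = W `&` q k @^-1` `[m.+1%:R^-1, +oo[); first exact: mq.
  by apply/seteqP; split => x /=; rewrite in_itv/= andbT.
have A0 m N : mu (A m N) = 0%E.
  have h := weak_cvg0_indic mq Qi qQ Hq (mA m N).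
  have AW : A m N `<=` W by move=> x /(_ N (leqnn N))[].
  have fA : (mu (A m N) < +oo)%E by apply: le_lt_trans fW; exact: lebesgue_rV_le.
  have ge k : (N <= k)%N -> m.+1%:R^-1 * fine (mu (A m N)) <=
      \int[mu]_(x in W) (\1_(A m N) x * q k x).
    move=> Nk; rewrite -(Rintegral_cst mu (mA m N)).
    have mI : measurable_fun W (\1_(A m N) : V -> R) by exact: measurable_indic.
    have I1 x : `|(\1_(A m N) x : R)| <= 1.
      by rewrite indicE; case: (_ \in _); rewrite ?normr1 ?normr0.
    have -> : \int[mu]_(x in A m N) m.+1%:R^-1 =
        \int[mu]_(x in W) (\1_(A m N) x * m.+1%:R^-1).
      rewrite [LHS]Rintegral_mkcond [RHS]Rintegral_mkcond; apply: eq_Rintegral => x _.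
      rewrite !patchE indicE; case: ifPn => [xA|_].
        by rewrite ifT ?mul1r//; apply/mem_set/AW/set_mem.
      by case: ifP => // _; rewrite mul0r.
    have ci : mu.-integrable W (EFin \o (fun x : V => m.+1%:R^-1 : R)).
      apply: (integ_bounded mW fW (measurable_cst _)) => x _; rewrite ger0_norm; [exact: lexx|by rewrite invr_ge0].
    apply: (le_Rintegral mW).
    - exact: (integMb mW mI (fun x _ => I1 x) ci).
    - exact: (integMb mW mI (fun x _ => I1 x) (qi k)).
    - move=> x Wx; rewrite indicE; case: (boolP (x \in A m N)) => xA; last by rewrite !mul0r.
      by have [_ /=] := set_mem xA k Nk; rewrite !mul1r.
  have h2 : m.+1%:R^-1 * fine (mu (A m N)) <= 0.
    rewrite -(cvg_lim _ h)//; apply: limr_ge; first by apply/cvg_ex; eexists; exact: h.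
    by exists N => // k; exact: ge.
  have h3 : fine (mu (A m N)) <= 0 by rewrite -(pmulr_rle0 _ (x := m.+1%:R^-1)) // invr_gt0.
  have f0 : mu (A m N) \is a fin_num by rewrite ge0_fin_numE// measure_ge0.
  apply/eqP; rewrite eq_le measure_ge0 andbT -(fineK f0) lee_fin; exact: h3.
exists (\bigcup_m \bigcup_N A m N); split.
- by apply: bigcupT_measurable => m; apply: bigcupT_measurable => N; exact: mA.
- apply/negligible_rVP; apply: negligible_bigcup => m; apply: negligible_bigcup => N.
  by apply/negligible_rVP; exact: A0.
- move=> x /= /not_implyP[Wx /existsNP[l /not_implyP[ql /negP]]]; rewrite -ltNge => l0.
  have l20 : 0 < l / 2 by rewrite divr_gt0.
  have [m _ /(_ m (leqnn m)) /= Hm] := near_infty_natSinv_lt (PosNum l20).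
  move/cvgrPdist_lt : ql => /(_ _ l20)[N _ HN].
  exists m => //; exists N => // k /= Nk; split => //=.
  have := HN k Nk; rewrite /= ltr_norml => /andP[_ h].
  apply: le_trans (ltW Hm) _; lra.
Qed.

Lemma weak_cvg0_ae (q : (V -> R)^nat) (Q : V -> R) :
  (forall k, measurable_fun W (q k)) ->
  mu.-integrable W (EFin \o Q) -> (forall k x, W x -> `|q k x| <= Q x) ->
  (forall phi, test_function W phi ->
    \int[mu]_(x in W) (phi x * q k x) @[k --> \oo] --> (0 : R)) ->
  {ae mu, forall x, W x -> forall l, q k x @[k --> \oo] --> l -> l = 0}.
Proof.
move=> mq Qi qQ Hq.
have h1 := weak_cvg0_le0 mq Qi qQ Hq.
have h2 : {ae mu, forall x, W x -> forall l, - q k x @[k --> \oo] --> l -> l <= 0}.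
  apply: (@weak_cvg0_le0 (fun k x => - q k x) Q).
  - by move=> k; apply: measurable_funN; exact: mq.
  - exact: Qi.
  - by move=> k x Wx; rewrite normrN qQ.
  - move=> phi tphi; rewrite (_ : (fun k => _) =
      (fun k => - \int[mu]_(x in W) (phi x * q k x))).
      by rewrite -oppr0; apply: cvgN; exact: Hq.
    apply/funext => k; rewrite -mulN1r -RintegralZl.
    + by apply: eq_Rintegral => x _; rewrite mulN1r mulrN.
    + exact: mW.
    + have [M M0 HM] := test_function_bounded tphi.
      have qi : mu.-integrable W (EFin \o q k) by exact: (integ_le mW (mq k) (qQ k) Qi).
      exact: (integMb mW (test_function_measurable mW tphi) (fun x _ => HM x) qi).
apply: filterS2 h1 h2 => x h1 h2 Wx l ql; apply/eqP; rewrite eq_le (h1 Wx _ ql)/=.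
by rewrite -oppr_le0; apply: (h2 Wx); apply: cvgN.
Qed.

End density.

Section simple_function_induction.
Context {R : realType}.
Import HBNNSimple.

(** It is the identity of [R] that is approximated by simple functions. With [P k] a statement about
    [k \o g], this becomes an induction for [g] in which only preimages of Borel sets under [g]
    appear; the bound by [|t|] provides the domination. *)
Lemma simple_fun_ind (P : (R -> R) -> Prop) :
  P (cst 0) ->
  (forall c (B : set R) k, measurable B -> P k -> P (fun t => c * \1_B t + k t)) ->
  (forall k : (R -> R)^nat, (forall m, P (k m)) ->
     (forall m, measurable_fun setT (k m)) ->
     (forall m t, `|k m t| <= `|t|) ->
     (forall t, k m t @[m --> \oo] --> t) -> P id) ->
  P id.
Proof.
move=> P0 Plin Plim.
have approx (f : R -> R) : measurable_fun setT f -> (forall t, 0 <= f t) ->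
    exists s : (R -> R)^nat, [/\ forall m c h, P h -> P (fun t => c * s m t + h t),
      forall m, measurable_fun setT (s m), forall m t, 0 <= s m t <= f t &
      forall t, s m t @[m --> \oo] --> f t].
  move=> mf f0.
  have mf' : measurable_fun setT (EFin \o f) by exact/measurable_EFinP.
  have f0' t : setT t -> (0 <= (EFin \o f) t)%E by move=> _; rewrite lee_fin.
  pose s m := nnsfun_approx measurableT mf' m.
  have s_cvg t : s m t @[m --> \oo] --> f t.
    have := @cvg_nnsfun_approx _ _ _ _ measurableT _ mf' f0' t I.
    by move=> /fine_cvg.
  exists s; split.
  - move=> m c h Ph.
    pose r := finmap.enum_fset (fset_set (range (s m))).
    have -> : (fun t => c * s m t + h t) =
        (fun t => (\sum_(y <- r) c * y * \1_(s m @^-1` [set y]) t) + h t).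
      apply/funext => t; rewrite (fimfunE (s m)) fsbig_finite//= mulr_sumr.
      by congr (_ + _); apply: eq_bigr => y _; rewrite mulrA.
    elim: r => [|y r IH].
      rewrite (_ : (fun t => _) = h)//.
      by apply/funext => t; rewrite big_nil add0r.
    under eq_fun do rewrite big_cons -addrA.
    by apply: Plin => //; exact: measurable_funPTI.
  - by move=> m; exact: measurable_funP.
  - move=> m t; rewrite fun_ge0/= -(cvg_lim _ (s_cvg t))//.
    apply: nondecreasing_cvgn_le; last by apply/cvg_ex; eexists; exact: s_cvg.
    move=> i j ij; have /lefP h := @nd_nnsfun_approx _ _ _ _ measurableT _ mf' _ _ ij.
    exact: (h t).
  - exact: s_cvg.
have mid : measurable_fun setT (@id R) by exact: measurable_id.
have [|t|s [Ps ms s01 scvg]] := approx (fun t => Num.max t 0).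
- by apply: measurable_maxr.
- by rewrite le_max lexx orbT.
have [|t|r [Pr mr r01 rcvg]] := approx (fun t => Num.max (- t) 0).
- by apply: measurable_maxr => //; exact: measurable_funN.
- by rewrite le_max lexx orbT.
apply: (Plim (fun m t => 1 * s m t + (-1 * r m t + cst 0 t))).
- by move=> m; apply: (Ps m 1); apply: (Pr m (-1)).
- move=> m; apply: measurable_funD; first exact: measurable_funM.
  by apply: measurable_funD => //; exact: measurable_funM.
- move=> m t; rewrite mul1r mulN1r addr0.
  have /andP[a0 a1] := s01 m t; have /andP[b0 b1] := r01 m t.
  have [t0|t0] := leP 0 t.
    have r0 : r m t = 0.
      by apply/eqP; rewrite eq_le b0 andbT; apply: le_trans b1 _; rewrite ge_max oppr_le0 t0 lexx.
    rewrite r0 subr0 !ger0_norm//; apply: le_trans a1 _.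
    by rewrite ge_max lexx.
  have s0 : s m t = 0.
    by apply/eqP; rewrite eq_le a0 andbT; apply: le_trans a1 _; rewrite ge_max (ltW t0) lexx.
  rewrite s0 sub0r normrN (ger0_norm b0) ltr0_norm//; apply: le_trans b1 _.
  by rewrite ge_max lexx oppr_ge0 ltW.
- move=> t.
  have e : t = 1 * Num.max t 0 + (-1 * Num.max (- t) 0 + 0).
    rewrite mul1r mulN1r addr0; have [t0|t0] := leP 0 t.
      by rewrite max_r ?subr0// oppr_le0.
    by rewrite max_l ?sub0r ?opprK// oppr_ge0 ltW.
  rewrite [X in _ --> X]e; apply: cvgD.
    by apply: cvgM; [exact: cvg_cst|exact: scvg].
  by apply: cvgD; [apply: cvgM; [exact: cvg_cst|exact: rcvg]|exact: cvg_cst].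
Qed.
End simple_function_induction.

(** * Continuity of translations in the mean *)

Section translation.
Context {R : realType} {n : nat}.
Local Notation V := 'rV[R]_n.
Local Notation mu := (@lebesgue_rV R n).
Local Notation integ f := (mu.-integrable setT (EFin \o f)).
Implicit Types (f g h : V -> R).

Lemma integ_shift c f : integ f -> integ (fun x => f (x + c)).
Proof. by move=> fi; exact: (integrable_shift c fi). Qed.

Lemma Rintegral_shift c f : integ f -> \int[mu]_x f (x + c) = \int[mu]_x f x.
Proof. by move=> fi; congr fine; exact: (integral_shift c fi). Qed.

Definition translation_continuous f := forall e : R, 0 < e ->
  exists2 d : R, 0 < d & forall c : V, `|c| < d ->
    \int[mu]_x `|f (x + c) - f x| <= e.

Lemma translation_continuous_lin a f g : integ f -> integ g ->
  translation_continuous f -> translation_continuous g ->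
  translation_continuous (fun x => a * f x + g x).
Proof.
move=> fi gi Tf Tg e e0.
have ea : 0 < e / 2 / (`|a| + 1) by rewrite !divr_gt0// ltr_wpDl.
have e2 : 0 < e / 2 by rewrite divr_gt0.
have [d1 d10 H1] := Tf _ ea; have [d2 d20 H2] := Tg _ e2.
exists (Num.min d1 d2); first by rewrite lt_min d10.
move=> c; rewrite lt_min => /andP[c1 c2].
have if' := integ_norm (integB measurableT (integ_shift c fi) fi).
have ig' := integ_norm (integB measurableT (integ_shift c gi) gi).
have haf := integZ measurableT a fi.
have ih := integD measurableT haf gi.
have hc := integ_norm (integB measurableT (integ_shift c ih) ih).
apply: (@le_trans _ _ (\int[mu]_x (`|a| * `|f (x + c) - f x| + `|g (x + c) - g x|))).
  apply: (le_Rintegral measurableT hc).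
    exact: (integD measurableT (integZ measurableT `|a| if') ig').
  move=> x _; apply: le_trans _ (_ : `|a * (f (x + c) - f x) + (g (x + c) - g x)| <= _).
    by rewrite le_eqVlt; apply/orP; left; apply/eqP; congr (`| _ |); ring.
  by apply: le_trans (ler_normD _ _) _; rewrite normrM.
rewrite RintegralD//; last exact: (integZ measurableT `|a| if').
rewrite RintegralZl// [e]splitr lerD//; last exact: H2.
apply: (@le_trans _ _ (`|a| * (e / 2 / (`|a| + 1)))); first by rewrite ler_wpM2l// H1.
rewrite mulrA ler_pdivrMr ?ltr_wpDl// [leLHS]mulrC.
by apply: ler_wpM2l; [exact: ltW|rewrite lerDl].
Qed.

Lemma translation_continuous_lim f : integ f ->
  (forall e : R, 0 < e -> exists g, [/\ integ g, translation_continuous g &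
    \int[mu]_x `|f x - g x| <= e]) -> translation_continuous f.
Proof.
move=> fi H e e0; have e3 : 0 < e / 3 by rewrite divr_gt0.
have [g [gi Tg fg]] := H _ e3; have [d d0 Hd] := Tg _ e3.
exists d => // c cd.
have ifc := integ_norm (integB measurableT (integ_shift c fi) fi).
have igc := integ_norm (integB measurableT (integ_shift c gi) gi).
have ifg := integ_norm (integB measurableT fi gi).
have ifgc := integ_shift c ifg.
apply: (@le_trans _ _ (\int[mu]_x (`|f (x + c) - g (x + c)| + `|f x - g x| + `|g (x + c) - g x|))).
  apply: (le_Rintegral measurableT ifc).
    exact: (integD measurableT (integD measurableT ifgc ifg) igc).
  move=> x _.
  rewrite (_ : f (x + c) - f x = (f (x + c) - g (x + c)) - (f x - g x) + (g (x + c) - g x)); last by ring.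
  by apply: le_trans (ler_normD _ _) _; rewrite lerD2r ler_normB.
rewrite RintegralD//; last exact: (integD measurableT ifgc ifg).
rewrite RintegralD//.
rewrite (Rintegral_shift c ifg).
have := Hd c cd; lra.
Qed.

Lemma translation_continuous_test W phi : bounded_set W -> test_function W phi ->
  translation_continuous phi.
Proof.
move=> bW tphi; apply: contrapT => /existsNP[e /not_implyP[e0 /forall2NP H]].
(* Dominated convergence is sequential: failure of the claim yields translations shorter than
   [k.+1%:R^-1] that all move [phi] by more than [e]. *)
have /choice[c Hc] k : exists c : V, `|c| < k.+1%:R^-1 /\
    e < \int[mu]_x `|phi (x + c) - phi x|.
  case: (H k.+1%:R^-1) => [|/existsNP[c /not_implyP[ck /negP]]].
    by rewrite invr_gt0.
  by rewrite -ltNge; exists c.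
have [M M0 HM] := test_function_bounded tphi.
have [N [_ HN]] := bW.
(* [W] lies within radius [N + 1], and the translations are shorter than 1, so all translates of
   [phi] live in [B]. *)
pose B : set V := [set x | `|0 - x| <= N + 2].
have mB : measurable B by apply: closed_measurable_rV; exact: closed_cball.
have bB : bounded_set B.
  exists (N + 2); split; first exact: num_real.
  by move=> r Nr x; rewrite /B/= sub0r normrN => /le_trans; apply; exact: ltW.
have phi0 x : ~ B x -> forall y, `|y| < 1 -> phi (x + y) = 0.
  move=> nB y y1; apply: (test_function0 tphi) => Wxy; apply: nB.
  rewrite /B/= sub0r normrN -[x](addrK y).
  apply: le_trans (ler_normB _ _) _; rewrite (_ : N + 2 = N + 1 + 1); last by ring.
  by rewrite lerD ?(ltW y1)//; apply: HN => //; rewrite ltrDl.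
have cphi := test_function_continuous tphi.
have : \int[mu]_x `|phi (x + c k) - phi x| @[k --> \oo] --> \int[mu]_x (0 : R).
  apply: (@Rintegral_dominated_cvg _ _ _ _ _ measurableT _ _ (fun x => 2 * M * \1_B x)).
  - move=> k; apply: measurable_norm; apply: measurable_funB.
      apply: (continuous_measurable_rV measurableT) => x.
      have h : {for x, continuous (fun x : V => x + c k)}.
        by apply: continuousD; [exact: cvg_id|exact: cst_continuous].
      by apply: (continuous_comp h); exact: cphi.
    exact: (continuous_measurable_rV measurableT cphi).
  - exact: measurable_cst.
  - apply: aeW => x _; rewrite -[X in _ --> X](normr0 R) -(subrr (phi x)).
    apply: cvg_norm; apply: cvgB; last exact: cvg_cst.
    have cc : x + c k @[k --> \oo] --> x.
      apply/cvgrPdist_lt => s s0.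
      have [K _ HK] := near_infty_natSinv_lt (PosNum s0).
      exists K => // k Kk /=; rewrite opprD addNKr normrN.
      by apply: lt_trans (HK k Kk); case: (Hc k).
    apply: (@continuous_cvg _ _ _ _ _ (fun k => x + c k) phi x); [exact: cphi|exact: cc].
  - apply: integZ => //; apply/integrableP; split.
      by apply/measurable_EFinP; exact: measurable_indic.
    under eq_integral do rewrite /= ger0_norm//.
    rewrite integral_indic// setIT; exact: bounded_lebesgue_fin.
  - move=> k x _; rewrite normr_id indicE.
    have [xB|nxB] := boolP (x \in B).
      by rewrite mulr1 mulr_natl mulr2n; apply: le_trans (ler_normB _ _) _; rewrite lerD.
    have nB : ~ B x by move=> Bx; move/negP : nxB; apply; exact/mem_set.
    rewrite phi0//; last first.
      by case: (Hc k) => h _; apply: lt_le_trans h _; rewrite invf_le1// ler1n.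
    by rewrite -[x in phi x]addr0 phi0 ?normr0 ?subrr ?normr0 ?mulr0.
rewrite Rintegral_cst// mul0r => /cvgrPdist_lt/(_ _ e0)[k _ /(_ k (leqnn k))].
rewrite sub0r normrN; apply/negP; rewrite -leNgt; apply: le_trans (ler_norm _).
by apply/ltW; case: (Hc k).
Qed.

End translation.

Section support.
Context d (T : measurableType d) (R : realType) (mu : {measure set T -> \bar R}).
Implicit Types (f : T -> R) (W : set T).

Lemma patch_supp W f : (forall x, ~ W x -> f x = 0) -> f \_ W = f.
Proof.
move=> f0; apply/funext => x; rewrite patchE; case: ifPn => // xW.
by rewrite f0// => Wx; move/negP : xW; apply; exact/mem_set.
Qed.

Lemma Rintegral_supp W f : (forall x, ~ W x -> f x = 0) ->
  \int[mu]_(x in W) f x = \int[mu]_x f x.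
Proof. by move=> f0; rewrite Rintegral_mkcond patch_supp. Qed.

Lemma integ_supp W f : measurable W -> (forall x, ~ W x -> f x = 0) ->
  mu.-integrable W (EFin \o f) <-> mu.-integrable setT (EFin \o f).
Proof. by move=> mW f0; rewrite (integ_patch _ _ mW) patch_supp. Qed.

End support.

Section translation_integrable.
Context {R : realType} {n : nat}.
Local Notation V := 'rV[R]_n.
Local Notation mu := (@lebesgue_rV R n).
Local Notation integ f := (mu.-integrable setT (EFin \o f)).
Variable W : set V.
Hypotheses (oW : open W) (bW : bounded_set W).

Let mW : measurable W. Proof. exact: open_measurable_rV. Qed.
Let fW : (mu W < +oo)%E. Proof. exact: bounded_lebesgue_fin. Qed.

Lemma test_function_integrable phi : test_function W phi -> integ phi.
Proof.
move=> tphi; have [M M0 HM] := test_function_bounded tphi.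
apply/(integ_supp mu mW); first by move=> x; exact: test_function0 tphi.
exact: (integ_bounded mW fW (test_function_measurable mW tphi) (fun x _ => HM x)).
Qed.

Lemma indic_sub_integrable (A : set V) : measurable A -> A `<=` W ->
  integ (\1_A : V -> R).
Proof.
move=> mA AW; apply/(integ_supp mu mW).
  by move=> x nW; rewrite indicE memNset// => /AW.
apply: (@integ_bounded _ _ _ mu W mW _ 1 fW); first exact: measurable_indic.
by move=> x _; rewrite indicE ger0_norm// lern1 leq_b1.
Qed.

Lemma translation_continuous_indic (A : set V) : measurable A -> A `<=` W ->
  translation_continuous (\1_A : V -> R).
Proof.
move=> mA AW; have iA := indic_sub_integrable mA AW.
apply: (translation_continuous_lim iA) => e e0.
have [phi [tphi phi01 phiA]] := test_function_approx_indic oW bW mA.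
have mI : measurable_fun W (\1_A : V -> R) by exact: measurable_indic.
have mp k := test_function_measurable mW (tphi k).
have H : \int[mu]_(x in W) `|\1_A x - phi k x| @[k --> \oo] --> \int[mu]_(x in W) (0 : R).
  apply: (@Rintegral_dominated_cvg _ _ _ _ _ mW _ _ (cst 1)).
  - by move=> k; exact: (measurable_norm (measurable_funB mI (mp k))).
  - exact: measurable_cst.
  - apply: filterS phiA => x hx Wx; rewrite -[X in _ --> X](normr0 R) -(subrr (\1_A x)).
    by apply: cvg_norm; apply: cvgB; [exact: cvg_cst|exact: hx].
  - by apply: (@integ_bounded _ _ _ _ _ mW _ 1 fW (measurable_cst _)) => x _; rewrite normr1.
  - move=> k x _; rewrite normr_id /= indicE; have := phi01 k x => /andP[p0 p1].
    by rewrite ler_norml; case: (_ \in _) => /=; apply/andP; split; lra.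
rewrite Rintegral_cst// mul0r in H.
move/cvgrPdist_le : H => /(_ _ e0)[N _ /(_ N (leqnn N))]; rewrite sub0r normrN => HN.
exists (phi N); split.
- exact: test_function_integrable.
- exact: translation_continuous_test bW (tphi N).
- rewrite -(@Rintegral_supp _ _ _ mu W); first exact: le_trans (ler_norm _) HN.
  move=> x nW; rewrite (test_function0 (tphi N))// indicE memNset ?subrr ?normr0//.
  by move=> /AW.
Qed.

(** The class of functions with mean-continuous translations is stable under linear combinations and
    L^1 limits; it contains the indicators of measurable subsets of [W], which are limits of test
    functions. *)
Lemma translation_continuous_integrable g : integ g ->
  (forall x, ~ W x -> g x = 0) -> translation_continuous g.
Proof.
move=> gi g0; have mg := integ_measurable gi.
(* The profile [k] may be nonzero at 0, and then [k \o g] would not vanish outside [W]; the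
   indicator restores this. *)
pose h (k : R -> R) (x : V) : R := \1_W x * k (g x).
have hE k x : ~ W x -> h k x = 0 by move=> nW; rewrite /h indicE memNset// mul0r.
have hid : h id = g.
  apply/funext => x; rewrite /h indicE; have [xW|xW] := boolP (x \in W).
    by rewrite mul1r.
  by rewrite mul0r g0// => Wx; move/negP : xW; apply; exact/mem_set.
suff : integ (h id) /\ translation_continuous (h id) by rewrite hid => -[].
apply: (@simple_fun_ind _ (fun k => integ (h k) /\ translation_continuous (h k))).
- have -> : h (cst 0) = cst 0 by apply/funext => x; rewrite /h mulr0.
  split; first exact: integ0.
  move=> e e0; exists 1 => // c _; under eq_Rintegral do rewrite subrr normr0.
  by rewrite /Rintegral integral0 ltW.
- move=> c B k mB [ik Tk].
  pose A := W `&` g @^-1` B.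
  have mA : measurable A.
    have mgB := mg measurableT B mB; rewrite setTI in mgB.
    exact: (measurableI _ _ mW mgB).
  have AW : A `<=` W by exact: subIsetl.
  have -> : h (fun t => c * \1_B t + k t) = (fun x => c * \1_A x + h k x).
    apply/funext => x; rewrite /h mulrDr; congr (_ + _).
    by rewrite !indicE /A in_setI mulrCA -natrM mulnb (_ : (g x \in B) = (x \in g @^-1` B)) ?inE.
  have iA := indic_sub_integrable mA AW.
  split; first exact: (integD measurableT (integZ measurableT c iA) ik).
  have TA := translation_continuous_indic mA AW.
  exact: translation_continuous_lin.
- move=> k Pk mk kle kcvg; rewrite hid; split => //.
  apply: (translation_continuous_lim gi) => e e0.
  have mhk m := integ_measurable (proj1 (Pk m)).
  have H : \int[mu]_x `|g x - h (k m) x| @[m --> \oo] --> \int[mu]_x (0 : R).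
    apply: (@Rintegral_dominated_cvg _ _ _ _ _ measurableT _ _ (fun x => 2 * `|g x|)).
    - by move=> m; exact: (measurable_norm (measurable_funB mg (mhk m))).
    - exact: measurable_cst.
    - apply: aeW => x _; rewrite -[X in _ --> X](normr0 R) -(subrr (g x)).
      apply: cvg_norm; apply: cvgB; first exact: cvg_cst.
      rewrite [X in _ --> X](_ : g x = h id x); last by rewrite hid.
      apply: cvgM; first exact: cvg_cst.
      exact: kcvg.
    - exact: (integZ measurableT 2 (integ_norm gi)).
    - move=> m x _; rewrite normr_id mulr_natl mulr2n; apply: le_trans (ler_normB _ _) _.
      rewrite lerD2l /h normrM indicE; case: (_ \in _); rewrite ?normr1 ?mul1r ?normr0 ?mul0r//.
  rewrite Rintegral_cst// mul0r in H.
  move/cvgrPdist_le : H => /(_ _ e0)[N _ /(_ N (leqnn N))]; rewrite sub0r normrN => HN.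
  exists (h (k N)); case: (Pk N) => ? ?; split => //.
  exact: le_trans (ler_norm _) HN.
Qed.

End translation_integrable.

(** * Weak derivatives and difference quotients *)

Section derive_line.
Context {R : realType} {V : normedModType R}.
Implicit Types (f : V -> R) (x v : V).

Lemma derivable_line f x v s : derivable f (x + s *: v) v ->
  derivable (fun t : R => f (x + t *: v)) s 1.
Proof.
rewrite /derivable (_ : (fun h => _) = (fun h => h^-1 *: (f (x + (h *: 1 + s) *: v) - f (x + s *: v)))).
  by [].
apply/funext => h; congr (_ *: (f _ - _)).
by rewrite [h *: 1]mulr1 scalerDl addrCA.
Qed.

Lemma derive_line f x v s :
  'D_1 (fun t : R => f (x + t *: v)) s = 'D_v f (x + s *: v).
Proof.
rewrite /derive [X in lim (X @ _) = _](_ : _ =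
  (fun h => h^-1 *: (f (h *: v + (x + s *: v)) - f (x + s *: v))))//.
apply/funext => h; congr (_ *: (f _ - _)).
by rewrite [h *: 1]mulr1 scalerDl addrCA.
Qed.

Lemma derive_shift_arg f c x v : 'D_v (fun y => f (y + c)) x = 'D_v f (x + c).
Proof.
rewrite /derive [X in lim (X @ _) = _](_ : _ =
  (fun h => h^-1 *: (f (h *: v + (x + c)) - f (x + c))))//.
by apply/funext => h; rewrite addrA.
Qed.

Lemma differentiable_shift_arg f c x : differentiable f (x + c) ->
  differentiable (fun y => f (y + c)) x.
Proof.
move=> df; apply: (@differentiable_comp _ _ _ _ (fun y => y + c) f) => //.
Qed.

Lemma deriveNdir f x v : differentiable f x -> 'D_(- v) f x = - 'D_v f x.
Proof. by move=> df; rewrite !deriveE// linearN. Qed.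

End derive_line.

Section collar.
Context {R : realType} {n : nat}.
Local Notation V := 'rV[R]_n.
Implicit Types (U W K : set V) (f phi : V -> R).

Lemma smooth_shift phi c : smooth phi -> smooth (fun x => phi (x + c)).
Proof.
move=> sphi; apply/smoothP => k; move/smoothP : sphi => /(_ k).
elim: k phi => [|k IH] phi [dphi Dphi]; split => //; try by
  move=> x; exact: differentiable_shift_arg.
move=> i; rewrite (_ : (fun x => _) = (fun x => 'D_('e_i) phi (x + c))).
  by apply: (IH (fun x => 'D_('e_i) phi x)); exact: Dphi.
by apply/funext => x; rewrite derive_shift_arg.
Qed.

Lemma test_function_shift U W c phi : test_function U phi ->
  (forall x, U x -> W (x + c)) -> test_function W (fun x => phi (x - c)).
Proof.
move=> [sphi cK KU] UW.
pose K := closure [set x | phi x != 0].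
have ccont : continuous (fun x : V => x + c).
  by move=> x; apply: continuousD; [exact: cvg_id|exact: cst_continuous].
apply: (@test_functionI _ _ _ ((fun x => x + c) @` K)).
- exact: smooth_shift.
- by apply: continuous_compact => //; exact: continuous_subspaceT.
- by move=> _ [x Kx <-]; apply/UW/KU.
- move=> x nK; apply: contrapT => /eqP p0; apply: nK; exists (x - c); last by rewrite subrK.
  exact: subset_closure.
Qed.

Definition collar U W (d : R) := forall x c, U x -> `|c| < d -> W (x + c).

(** A Lebesgue number argument: [K] is covered by finitely many balls of half the admissible radius,
    and the least of these radii (capped by 1) is the width of the collar. *)
Lemma compact_collar K W : compact K -> open W -> K `<=` W ->
  exists U d, [/\ open U, K `<=` U, 0 < d & collar U W d].
Proof.
move=> cK oW KW.
have /choice[r Hr] x : exists r : R, 0 < r /\ (K x -> ball x (r + r) `<=` W).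
  have [Kx|nK] := pselect (K x); last by exists 1.
  have := open_nbhs_nbhs (conj oW (KW _ Kx)) => /nbhs_ballP[s /= s0 sW].
  by exists (s / 2); rewrite divr_gt0//; split => // _; rewrite -splitr.
have [D DK cov] : finite_subset_cover K (fun x => ball x (r x)) K.
  move: cK; rewrite compact_cover; apply.
    by move=> x Kx; exact: ball_open.
  by move=> x Kx; exists x => //; apply: ballxx; case: (Hr x).
pose s : seq V := finmap.enum_fset D.
pose d := \big[Num.min/1]_(x <- s) r x.
exists (\bigcup_(x in [set x | x \in s]) ball x (r x)), d; split.
- by apply: bigcup_open => x _; exact: ball_open.
- exact: cov.
- by rewrite /d; elim/big_ind : _ => // [x y x0 y0|x _]; [rewrite lt_min x0|case: (Hr x)].
- move=> y c [x xD xy] cd.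
  have Kx : K x by have := DK _ xD; rewrite inE.
  case: (Hr x) => _ /(_ Kx); apply; apply: ball_triangle xy _.
  rewrite mx_norm_ball /ball_/= opprD addNKr normrN.
  by apply: lt_le_trans cd _; by apply: (@bigmin_inf_seq _ _ _ _ _ x).
Qed.

Lemma collar_sub U W d : 0 < d -> collar U W d -> U `<=` W.
Proof. by move=> d0 UW x Ux; rewrite -[x]addr0; apply: UW; rewrite ?normr0. Qed.

Lemma norm_delta_le1 i : `|'e_i : V| <= 1.
Proof.
rewrite [leLHS]/Num.norm /= mx_normrE; apply/bigmax_leP; split => // -[a j] _ /=.
by rewrite mxE; case: (_ && _); rewrite ?normr1 ?normr0.
Qed.

Lemma norm_scale_delta (s : R) i : `|s *: 'e_i : V| <= `|s|.
Proof. by rewrite normrZ ler_piMr// norm_delta_le1. Qed.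

End collar.

Section difference_quotient.
Context {R : realType} {n : nat}.
Local Notation V := 'rV[R]_n.
Local Notation mu := (@lebesgue_rV R n).
Local Notation integ f := (mu.-integrable setT (EFin \o f)).
Implicit Types (U W : set V) (f g u phi : V -> R).

Definition weak_derivative W i u g := forall phi, test_function W phi ->
  \int[mu]_x (u x * 'D_('e_i) phi x) = - \int[mu]_x (g x * phi x).

Definition dquot (h : R) i f (x : V) : R := (f (x + h *: 'e_i) - f x) / h.

Lemma integM_test W u phi : integ u -> test_function W phi -> integ (fun x => u x * phi x).
Proof.
move=> ui tphi; have [M M0 HM] := test_function_bounded tphi.
have mphi := test_function_measurable measurableT tphi.
rewrite (_ : (fun x => _) = (fun x => phi x * u x)).
  exact: (integMb measurableT mphi (fun x _ => HM x) ui).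
by apply/funext => x; rewrite mulrC.
Qed.

Lemma integ_dquot h i u : integ u -> integ (dquot h i u).
Proof.
move=> ui; rewrite (_ : dquot h i u = (fun x => h^-1 * (u (x + h *: 'e_i) - u x))).
  exact: (integZ measurableT _ (integB measurableT (integ_shift _ ui) ui)).
by apply/funext => x; rewrite mulrC.
Qed.

Section shift_derivative.
Variables (W U : set V) (d : R) (i : 'I_n) (u g phi : V -> R).
Hypotheses (ui : integ u) (UW : collar U W d) (tphi : test_function U phi).

(** By translation invariance, shifting [u] against [phi] amounts to shifting [phi] the other way.
    [F] is therefore differentiable although [u] is only integrable. *)
Let F (s : R) := \int[mu]_x (u x * phi (x - s *: 'e_i)).

Let test_s s : `|s| < d -> test_function W (fun x => phi (x - s *: 'e_i)).
Proof.
move=> sd; apply: (test_function_shift tphi) => x Ux; apply: UW => //.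
exact: le_lt_trans (norm_scale_delta _ _) sd.
Qed.

Let shiftE f (r : R) : integ f -> `|r| < d ->
  \int[mu]_x (f (x + r *: 'e_i) * phi x) = \int[mu]_x (f x * phi (x - r *: 'e_i)).
Proof.
move=> fi rd; rewrite -(Rintegral_shift (r *: 'e_i) (integM_test fi (test_s rd))).
by apply: eq_Rintegral => x _; rewrite addrK.
Qed.

Lemma Rintegral_dquotE h : h != 0 -> `|h| < d ->
  \int[mu]_x (dquot h i u x * phi x) = h^-1 * (F h - F 0).
Proof.
move=> h0 hd; have d0 : `|(0 : R)| < d by rewrite normr0; exact: le_lt_trans hd.
have i1 : integ (fun x => u (x + h *: 'e_i) * phi x).
  exact: (integM_test (integ_shift _ ui) tphi).
have i2 := integM_test ui tphi.
rewrite /F -shiftE// -(shiftE ui d0).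
under [X in _ = _ * (_ - X)]eq_Rintegral do rewrite scale0r addr0.
rewrite -RintegralB// -RintegralZl//; last exact: (integB measurableT i1 i2).
by apply: eq_Rintegral => x _; rewrite /dquot; field.
Qed.

Lemma is_derive_shift_integral (s : R) : `|s| < d ->
  is_derive s 1 F (- \int[mu]_x (u x * 'D_('e_i) (fun y => phi (y - s *: 'e_i)) x)).
Proof.
move=> sd.
pose f (t : R) (x : V) : R := u x * phi (x - t *: 'e_i).
have dphi x : differentiable phi x by case: tphi => sphi _ _; exact: (sphi [::] x).
have dline (x : V) (t : R) : is_derive t 1 (fun t : R => phi (x - t *: 'e_i))
    (- 'D_('e_i) phi (x - t *: 'e_i)).
  rewrite (_ : (fun t : R => _) = (fun t : R => phi (x + t *: (- 'e_i)))); last first.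
    by apply/funext => r; rewrite scalerN.
  apply: DeriveDef.
    by apply: derivable_line; apply: diff_derivable; exact: dphi.
  by rewrite derive_line deriveNdir; [rewrite scalerN|exact: dphi].
have df (x : V) (t : R) : is_derive t 1 (f ^~ x) (- (u x * 'D_('e_i) phi (x - t *: 'e_i))).
  apply: is_derive_eq.
  by rewrite /GRing.scale/= mulrN.
have [M M0 HM] := test_function_bounded (test_function_derive i tphi).
have Is : `](- d), d[%classic s by rewrite /= in_itv/= -ltr_norml.
have intf t : `](- d), d[%classic t -> mu.-integrable setT (EFin \o f t).
  by rewrite /= in_itv/= -ltr_norml => td; exact: (integM_test ui (test_s td)).
have derf t x : `](- d), d[%classic t -> setT x -> derivable (f ^~ x) t 1.
  by move=> _ _; case: (df x t).
have d1E t x : partial1of2 f t x = - (u x * 'D_('e_i) phi (x - t *: 'e_i)).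
  by rewrite partial1of2E; case: (df x t).
have G0 x : 0 <= M * `|u x| by rewrite mulr_ge0.
have iG : integ (fun x => M * `|u x|) by exact: (integZ measurableT M (integ_norm ui)).
have Gub t x : `](- d), d[%classic t -> setT x -> `|partial1of2 f t x| <= M * `|u x|.
  by move=> _ _; rewrite d1E normrN normrM mulrC ler_wpM2r.
have D1 := derivable_under_integral measurableT Is intf derf G0 iG Gub.
have D2 := differentiation_under_integral measurableT Is intf derf G0 iG Gub.
apply: DeriveDef; first exact: D1.
rewrite -derive1E [LHS]D2.
have idp := integM_test ui (test_function_derive i (test_s sd)).
have E : (fun x : V => u x * 'D_('e_i) phi (x - s *: 'e_i)) =
    (fun x => u x * 'D_('e_i) (fun y => phi (y - s *: 'e_i)) x).
  by apply/funext => x; rewrite derive_shift_arg.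
rewrite -E in idp *; rewrite -mulN1r -(RintegralZl _ measurableT idp).
by apply: eq_Rintegral => x _; rewrite d1E mulN1r.
Qed.

(** Stated before any weak derivative of [u] is given, since it serves to compute one: it is applied
    to [|u|] and to the indicator of the domain. *)
Lemma Rintegral_dquot_cvg (h : R^nat) : (forall k, h k != 0) ->
  (forall k, `|h k| < d) -> h k @[k --> \oo] --> 0 ->
  \int[mu]_x (dquot (h k) i u x * phi x) @[k --> \oo] -->
    - \int[mu]_x (u x * 'D_('e_i) phi x).
Proof.
move=> h0 hd hcvg.
have d0 : `|(0 : R)| < d by rewrite normr0; exact: le_lt_trans (hd 0%N).
have [dF F'] := is_derive_shift_integral d0.
have Fl : (fun t : R => t^-1 *: (F (t *: 1 + 0) - F 0)) @ 0^' --> 'D_1 F 0.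
  by have /cvg_ex[l Hl] := dF; rewrite /derive (cvg_lim (@Rhausdorff R) Hl).
have <- : 'D_1 F 0 = - \int[mu]_x (u x * 'D_('e_i) phi x).
  rewrite [LHS]F'; apply: (congr1 (fun r : R => - r)).
  by apply: eq_Rintegral => x _; rewrite derive_shift_arg scale0r subr0.
move/cvgr_dnbhsP : Fl => /(_ h (conj h0 hcvg)); apply: cvg_trans.
apply: near_eq_cvg; apply: nearW => k.
by rewrite (Rintegral_dquotE (h0 k) (hd k)) addr0 [_ *: 1]mulr1.
Qed.

Hypotheses (gi : integ g) (wug : weak_derivative W i u g).

Lemma is_derive_shift_integral_weak (s : R) : `|s| < d ->
  is_derive s 1 F (\int[mu]_x (g x * phi (x - s *: 'e_i))).
Proof.
move=> sd; apply: is_derive_eq; first exact: is_derive_shift_integral.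
by rewrite (wug (test_s sd)) opprK.
Qed.

(** The mean value theorem is applied to the integral [F], not to [u]. The intermediate shift [s]
    depends on [phi], which is harmless because the continuity of translations is uniform over small
    shifts. *)
Lemma Rintegral_dquot h : 0 < h -> h < d -> exists2 s, 0 < s < h &
  \int[mu]_x (dquot h i u x * phi x) = \int[mu]_x (g (x + s *: 'e_i) * phi x).
Proof.
move=> h0 hd.
have h_d s : s \in `[0, h] -> `|s| < d.
  by rewrite in_itv/= => /andP[s0 sh]; rewrite ger0_norm//; exact: le_lt_trans sh hd.
have [||s sh Fs] := @MVT _ F (fun s => \int[mu]_x (g x * phi (x - s *: 'e_i))) _ _ h0.
- by move=> s /subset_itv_oo_cc/h_d; exact: is_derive_shift_integral_weak.
- apply: derivable_within_continuous => s /h_d/is_derive_shift_integral[]//.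
exists s; first by rewrite in_itv in sh.
have sd : `|s| < d by apply: h_d; exact: subset_itv_oo_cc.
rewrite shiftE//.
have hdn : `|h| < d by rewrite gtr0_norm.
rewrite Rintegral_dquotE//; last by rewrite gt_eqF.
rewrite Fs subr0; field; by rewrite gt_eqF.
Qed.

End shift_derivative.

(** Against a test function bounded by 1, the error is the integral of
    [(g (x + s *: 'e_i) - g x) * phi x] for some [s < h], hence at most the L^1 distance between [g]
    and a small translate. Duality turns this into a bound on the L^1 norm over [U]. *)
Lemma dquot_cvg W U d i u g : open W -> bounded_set W -> open U ->
  integ u -> integ g -> (forall x, ~ W x -> g x = 0) ->
  weak_derivative W i u g -> 0 < d -> collar U W d ->
  forall e, 0 < e -> exists2 r : R, 0 < r & forall h, 0 < h < r ->
    \int[mu]_(x in U) `|dquot h i u x - g x| <= e.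
Proof.
move=> oW bW oU ui gi g0 wug d0 UW e e0.
have bU : bounded_set U by apply: bounded_setS bW; exact: collar_sub UW.
have [r r0 Hr] := translation_continuous_integrable oW bW gi g0 e0.
exists (Num.min r d); first by rewrite lt_min r0.
move=> h /andP[h0]; rewrite lt_min => /andP[hr hd].
have mU := open_measurable_rV oU.
have iq := integB measurableT (integ_dquot h i ui) gi.
apply: (Rintegral_norm_le_test oU bU).
  exact: (integ_subset mU measurableT (@subsetT _ U) iq).
move=> phi tphi phi1.
have [s /andP[s0 sh] Hs] := Rintegral_dquot ui UW tphi gi wug h0 hd.
rewrite (@Rintegral_supp _ _ _ mu U); last first.
  by move=> x nU; rewrite (test_function0 tphi nU) mul0r.
have i1 := integM_test (integ_dquot h i ui) tphi.
have i2 := integM_test gi tphi.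
have i3 := integM_test (integ_shift (s *: 'e_i) gi) tphi.
have -> : \int[mu]_x (phi x * (dquot h i u x - g x)) =
    \int[mu]_x (g (x + s *: 'e_i) * phi x - g x * phi x).
  under eq_Rintegral do rewrite mulrC mulrBl.
  by rewrite RintegralB// Hs -RintegralB.
have i4 := integ_norm (integB measurableT (integ_shift (s *: 'e_i) gi) gi).
apply: le_trans (ler_norm_Rintegral measurableT (integB measurableT i3 i2) i4 _) _.
  by move=> x _; rewrite -mulrBl normrM ler_piMr.
apply: Hr; apply: le_lt_trans (norm_scale_delta _ _) _.
by rewrite gtr0_norm//; exact: lt_trans hr.
Qed.

End difference_quotient.

Section fast_convergence.
Context d (T : measurableType d) (R : realType) (mu : {measure set T -> \bar R}).
Variable D : set T.
Hypothesis mD : measurable D.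

(** By Markov's inequality the set where [|f k|] is at least [k.+1%:R^-1] has measure at most
    [2 ^- k.+1]; the Borel-Cantelli lemma concludes. *)
Lemma fast_L1_cvg0_ae (f : (T -> R)^nat) :
  (forall k, mu.-integrable D (EFin \o f k)) ->
  (forall k, \int[mu]_(x in D) `|f k x| <= (2 ^ k.+1)%:R^-1 * k.+1%:R^-1) ->
  {ae mu, forall x, D x -> f k x @[k --> \oo] --> (0 : R)}.
Proof.
move=> fi fle.
pose E k := D `&` [set x | (k.+1%:R^-1%:E <= `|(EFin \o f k) x|)%E].
have mf k : measurable_fun D (EFin \o f k) by apply: measurable_int; exact: fi.
have mE k : measurable (E k).
  have := integ_measurable (integ_norm (fi k)) mD (measurable_itv `[k.+1%:R^-1, +oo[).
  congr (measurable _); apply/seteqP; split => x [Dx] /=; rewrite ?in_itv/= ?andbT.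
    by move=> h; split => //=; rewrite lee_fin.
  by rewrite /E/= lee_fin => h; split => //=; rewrite in_itv/= h.
have E2 k : (mu (E k) <= (1 / (2 ^ k.+1)%:R)%:E)%E.
  have k0 : (0 : R) < k.+1%:R^-1 by rewrite invr_gt0.
  have h := @le_integral_abse _ _ _ mu _ mD _ _ (mf k) k0.
  have e : (\int[mu]_(x in D) `|(EFin \o f k) x| = (\int[mu]_(x in D) `|f k x|)%:E)%E.
    by rewrite fineK//; apply: integrable_fin_num => //; exact: (integ_norm (fi k)).
  rewrite e in h; rewrite mul1r.
  rewrite -(@lee_pmul2l _ k.+1%:R^-1%:E)//.
  by apply: le_trans h _; rewrite -EFinM lee_fin mulrC.
exists (lim_sup_set E); split.
- by apply: bigcapT_measurable => k; apply: bigcup_measurable => j _; exact: mE.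
- apply: lim_sup_set_cvg0; first exact: mE.
  apply: (@le_lt_trans _ _ 1%:E); last by rewrite ltry.
  apply: le_trans (epsilon_trick0 xpredT _); last exact: ler01.
  by apply: lee_nneseries => [k _ _|k _]; [exact: measure_ge0|exact: E2].
move=> x /= /not_implyP[Dx nc] N _; apply: contrapT => nE; apply: nc.
apply/cvgrPdist_le => e e0.
have [M _ HM] := near_infty_natSinv_lt (PosNum e0).
exists (maxn N M) => // k /=; rewrite geq_max => /andP[Nk Mk].
rewrite sub0r normrN; apply: le_trans (ltW (HM k Mk)) => /=.
rewrite leNgt; apply/negP => h; apply: nE; exists k => //; split => //=.
by rewrite lee_fin ltW.
Qed.

End fast_convergence.

(** * The weak derivative of an absolute value *)

Section weak_abs.
Context {R : realType} {n : nat}.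
Local Notation V := 'rV[R]_n.
Local Notation mu := (@lebesgue_rV R n).
Local Notation integ f := (mu.-integrable setT (EFin \o f)).
Implicit Types (U W : set V) (f g u phi : V -> R).

(** At a zero of [u] the value [|g x|] is the limit of the quotients of [|u|] for positive steps.
    With this choice the limit is right at every point where the quotients of [u] converge to [g],
    and the size of the derivative is preserved everywhere. *)
Definition abs_derivative u g (x : V) : R :=
  if u x == 0 then `|g x| else if 0 < u x then g x else - g x.

Lemma norm_abs_derivative u g x : `|abs_derivative u g x| = `|g x|.
Proof.
by rewrite /abs_derivative; case: ifP => _; [rewrite normr_id|case: ifP => _; rewrite ?normrN].
Qed.

Lemma dquot_abs_cvg i u g x (h : R^nat) : (forall k, 0 < h k) ->
  h k @[k --> \oo] --> 0 -> dquot (h k) i u x @[k --> \oo] --> g x ->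
  dquot (h k) i (fun y => `|u y|) x @[k --> \oo] --> abs_derivative u g x.
Proof.
move=> h0 hcvg dcvg.
have ucvg : u (x + h k *: 'e_i) @[k --> \oo] --> u x.
  rewrite (_ : (fun k => _) = (fun k => u x + h k * dquot (h k) i u x)); last first.
    by apply/funext => k; rewrite /dquot; field; rewrite gt_eqF.
  rewrite -[X in _ --> X]addr0 -[X in _ --> _ + X](mul0r (g x)).
  by apply: cvgD; [exact: cvg_cst|exact: cvgM].
rewrite /abs_derivative; case: eqP => [u0|/eqP un0].
  rewrite (_ : (fun k => _) = (fun k => `|dquot (h k) i u x|)); first exact: cvg_norm.
  by apply/funext => k; rewrite /dquot u0 normr0 !subr0 normrM normfV (gtr0_norm (h0 k)).
case: ltP => u0.
  apply: cvg_trans dcvg; apply: near_eq_cvg.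
  move/(cvgr_gt (u x)) : ucvg => /(_ _ u0); apply: filterS => k uk.
  by rewrite /dquot !gtr0_norm.
have {un0}u0 : u x < 0 by rewrite lt_neqAle un0.
rewrite -[X in _ --> - X]/(g x).
apply: cvg_trans (cvgN dcvg); apply: near_eq_cvg.
move/(cvgr_lt (u x)) : ucvg => /(_ _ u0); apply: filterS => k uk.
rewrite /dquot/= !ltr0_norm//.
transitivity (- ((u (x + h k *: 'e_i) - u x) / h k)); first by [].
by field; rewrite gt_eqF.
Qed.

Lemma measurable_abs_derivative u g :
  measurable_fun setT u -> measurable_fun setT g ->
  measurable_fun setT (abs_derivative u g).
Proof.
move=> mu' mg; apply: measurable_fun_ifT.
- apply: measurable_fun_eqr; [exact: mu'|exact: measurable_cst].
- exact: measurable_norm.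
- apply: measurable_fun_ifT.
  + apply: measurable_fun_ltr; [exact: measurable_cst|exact: mu'].
  + exact: mg.
  + exact: measurable_funN.
Qed.

(* Along a fast sequence of steps the difference quotients of [u] converge almost
   everywhere, and they dominate those of [|u|]. *)
Lemma weak_derivative_abs W i u g : open W -> bounded_set W ->
  integ u -> integ g -> (forall x, ~ W x -> g x = 0) -> weak_derivative W i u g ->
  weak_derivative W i (fun x => `|u x|) (abs_derivative u g).
Proof.
move=> oW bW ui gi g0 wug phi tphi.
have [sphi cK KW] := tphi.
have [U [d [oU KU d0 UW]]] := compact_collar cK oW KW.
have tU : test_function U phi by [].
have mU := open_measurable_rV oU.
have dc := dquot_cvg oW bW oU ui gi g0 wug d0 UW.
have /choice[h Hh] k : exists h : R, [/\ 0 < h, h < d, h < k.+1%:R^-1 &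
    \int[mu]_(x in U) `|dquot h i u x - g x| <= (2 ^ k.+1)%:R^-1 * k.+1%:R^-1].
  have k0 : (0 : R) < k.+1%:R^-1 by rewrite invr_gt0.
  have p0 : (0 : R) < (2 ^ k.+1)%:R^-1 by rewrite invr_gt0 ltr0n expn_gt0.
  have [r r0 Hr] := dc _ (mulr_gt0 p0 k0).
  pose m := Num.min (Num.min d r) k.+1%:R^-1.
  have m0 : 0 < m by rewrite !lt_min d0 r0.
  have m2 : m / 2 < m by rewrite ltr_pdivrMr// ltr_pMr// ltr1n.
  have := m2; rewrite {2}/m !lt_min => /andP[/andP[md mr] mk].
  by exists (m / 2); split => //; [rewrite divr_gt0|apply: Hr; rewrite mr divr_gt0].
have h0 k : 0 < h k by case: (Hh k).
have hcvg : h k @[k --> \oo] --> 0.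
  apply/cvgrPdist_lt => e e0; have [M _ HM] := near_infty_natSinv_lt (PosNum e0).
  exists M => // k Mk; rewrite /= sub0r normrN gtr0_norm//.
  by apply: lt_trans (HM k Mk); case: (Hh k).
have dgi k := integB measurableT (integ_dquot (h k) i ui) gi.
have dgU k := integ_subset mU measurableT (@subsetT _ U) (dgi k).
have aecvg : {ae mu, forall x, U x -> dquot (h k) i u x @[k --> \oo] --> g x}.
  have := fast_L1_cvg0_ae mU dgU (fun k => let: And4 _ _ _ p := Hh k in p).
  apply: filterS => x H Ux; have := H Ux; rewrite -[X in _ -> _ --> X]add0r => H'.
  rewrite (_ : (fun k => _) = (fun k => (dquot (h k) i u x - g x) + g x)).
    by apply: cvgD; [exact: H'|exact: cvg_cst].
  by apply/funext => k; rewrite subrK.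
set G := abs_derivative u g.
have mG : measurable_fun setT G.
  by apply: measurable_abs_derivative; apply: integ_measurable; [exact: ui|exact: gi].
have Gi : integ G.
  apply: (integ_le measurableT mG _ (integ_norm gi)) => x _.
  by rewrite norm_abs_derivative.
have ai : integ (fun x => `|u x|) := integ_norm ui.
pose q k := dquot (h k) i (fun x => `|u x|).
have qi k : integ (q k) := integ_dquot (h k) i ai.
have qG k := integ_subset mU measurableT (@subsetT _ U) (integ_norm (integB measurableT (qi k) Gi)).
have dgU' k := integ_norm (dgU k).
have gU := integ_subset mU measurableT (@subsetT _ U) (integ_norm gi).
(* The quotients [q k] have no common integrable bound; they are only dominated by those of [u],
   which converge in L^1. Once the known error is subtracted, what remains is at most [2 * |g x|]
   and dominated convergence applies to it. *)
pose m k x := Num.max (`|q k x - G x| - `|dquot (h k) i u x - g x|) 0.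
have mle k x : `|m k x| <= 2 * `|g x|.
  rewrite ger0_norm; last by rewrite le_max lexx orbT.
  rewrite ge_max mulr_ge0// andbT lerBlDr.
  apply: le_trans (ler_normB _ _) _; rewrite norm_abs_derivative.
  have : `|q k x| <= `|dquot (h k) i u x|.
    by rewrite /q /dquot !normrM ler_wpM2r// ler_dist_dist.
  have : `|dquot (h k) i u x| <= `|dquot (h k) i u x - g x| + `|g x|.
    by rewrite -[X in `|X| <= _](subrK (g x)); exact: ler_normD.
  by move=> *; lra.
have mm k : measurable_fun U (m k).
  apply: measurable_maxr; last exact: measurable_cst.
  by apply: measurable_funB; apply: (@integ_measurable _ _ _ mu); [exact: qG|exact: dgU'].
have mi k : mu.-integrable U (EFin \o m k).
  apply: (integ_le mU (mm k) _ (integZ mU 2 gU)) => x _; exact: mle.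
have mcvg : \int[mu]_(x in U) m k x @[k --> \oo] --> \int[mu]_(x in U) (0 : R).
  apply: (@Rintegral_dominated_cvg _ _ _ mu _ mU _ _ (fun x => 2 * `|g x|)).
  - exact: mm.
  - exact: measurable_cst.
  - apply: filterS aecvg => x H Ux; have {}H := H Ux.
    have H2 := dquot_abs_cvg h0 hcvg H.
    have H3 : `|q k x - G x| - `|dquot (h k) i u x - g x| @[k --> \oo] --> (0 : R).
      rewrite [X in _ --> X](_ : _ = `|G x - G x| - `|g x - g x|); last by rewrite !subrr.
      by apply: cvgB; apply: cvg_norm; apply: cvgB; [exact: H2|exact: cvg_cst|exact: H|exact: cvg_cst].
    apply/cvgrPdist_le => e e0; move/cvgrPdist_le : H3 => /(_ _ e0).
    apply: filterS => k; rewrite !sub0r !normrN; apply: le_trans.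
    rewrite ger0_norm; last by rewrite le_max lexx orbT.
    by rewrite ge_max ler_norm normr_ge0.
  - exact: (integZ mU 2 gU).
  - by move=> k x _; exact: mle.
rewrite Rintegral_cst// mul0r in mcvg.
have hd k : `|h k| < d by rewrite gtr0_norm//; case: (Hh k).
have hn k : h k != 0 by rewrite gt_eqF.
have H1 := Rintegral_dquot_cvg (i:=i) ai UW tU hn hd hcvg.
have [M M0 HM] := test_function_bounded tphi.
suff H2 : \int[mu]_x (dquot (h k) i (fun x => `|u x|) x * phi x) @[k --> \oo] -->
    \int[mu]_x (G x * phi x).
  by rewrite -(cvg_lim _ H2)// (cvg_lim _ H1)// opprK.
have bound k : `|\int[mu]_x (G x * phi x) - \int[mu]_x (q k x * phi x)| <=
    M * (k.+1%:R^-1 + \int[mu]_(x in U) m k x).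
  have i1 := integM_test Gi tphi; have i2 := integM_test (qi k) tphi.
  rewrite -RintegralB// -(@Rintegral_supp _ _ _ mu U); last first.
    by move=> x nU; rewrite (test_function0 tU nU) !mulr0 subrr.
  have i3 := integZ mU M (integD mU (dgU' k) (mi k)).
  apply: le_trans (ler_norm_Rintegral mU _ i3 _) _.
  - exact: (integ_subset mU measurableT (@subsetT _ U) (integB measurableT i1 i2)).
  - move=> x _; rewrite -mulrBl normrM mulrC ler_pM// distrC.
    by rewrite -lerBlDl le_max lexx.
  rewrite RintegralZl//; last exact: (integD mU (dgU' k) (mi k)).
  rewrite ler_wpM2l// RintegralD// lerD2r.
  case: (Hh k) => _ _ _ /le_trans; apply.
  by rewrite ler_piMl ?invr_ge0// invf_le1 ?ler1n ?ltr0n ?expn_gt0.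
apply/cvgrPdist_le => e e0.
have Mcvg : M * (k.+1%:R^-1 + \int[mu]_(x in U) m k x) @[k --> \oo] --> (0 : R).
  rewrite -[X in _ --> X](mulr0 M); apply: cvgM; first exact: cvg_cst.
  by rewrite -[X in _ --> X]addr0; apply: cvgD; [exact: cvg_harmonic|exact: mcvg].
move/cvgrPdist_le : Mcvg => /(_ _ e0); apply: filterS => k.
rewrite sub0r normrN => Hk; apply: le_trans (bound k) _.
exact: le_trans (ler_norm _) Hk.
Qed.

End weak_abs.

(** * Gradients of compositions with a Lipschitz function *)

Section composition_approximation.
Context {R : realType} {n : nat}.
Local Notation V := 'rV[R]_n.
Local Notation mu := (@lebesgue_rV R n).
Variable W : set V.
Hypotheses (oW : open W) (bW : bounded_set W).
Variable theta : V -> R.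
Hypothesis ctheta : forall x, W x -> {for x, continuous theta}.

Let mW : measurable W. Proof. exact: open_measurable_rV. Qed.
Let fW : (mu W < +oo)%E. Proof. exact: bounded_lebesgue_fin. Qed.

Lemma open_continuous_measurable_rV (f : V -> R) :
  (forall x, W x -> {for x, continuous f}) -> measurable_fun W f.
Proof.
move=> cf; apply: (measurability _ (RGenOpens.measurableE R)).
move=> _ [_ [a [b ->] <-]]; apply: open_measurable_rV.
rewrite openE => x [Wx fx]; apply: filterI; first exact: open_nbhs_nbhs.
by apply: (cf x Wx); apply: open_nbhs_nbhs; split => //; exact: interval_open.
Qed.

Lemma continuous_comp_measurable_rV (k : R -> R) : continuous k ->
  measurable_fun W (k \o theta).
Proof.
move=> ck; apply: open_continuous_measurable_rV => x Wx.
by apply: continuous_comp; [exact: ctheta|exact: ck].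
Qed.

Lemma urysohn_R (A B : set R) : closed A -> closed B -> A `&` B = set0 ->
  exists k : R -> R, [/\ continuous k, forall t, 0 <= k t <= 1,
    forall t, A t -> k t = 0 & forall t, B t -> k t = 1].
Proof.
move=> cA cB AB; have := @pseudometric_normal R R.
move=> /(@normal_separatorP R)/(_ _ _ cA cB AB)/(@uniform_separatorP _ R).
move=> [k [ck k01 kA kB]]; exists k; split => //.
- by move=> t; have /= := k01 (k t) (ex_intro2 _ _ t I erefl); rewrite in_itv.
- by move=> t At; apply: (kA (k t)); exists t.
- by move=> t Bt; apply: (kB (k t)); exists t.
Qed.

(** Continuity of [k] provides a primitive, and boundedness makes [k \o theta] integrable on the
    bounded set [W]. *)
Definition approx_by_comp (f : V -> R) := forall e : R, 0 < e -> exists k : R -> R,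
  [/\ continuous k, (exists C, forall t, `|k t| <= C) &
      \int[mu]_(x in W) `|f x - k (theta x)| <= e].

Lemma integ_comp_bounded (k : R -> R) : continuous k -> (exists C, forall t, `|k t| <= C) ->
  mu.-integrable W (EFin \o (fun x => k (theta x))).
Proof.
move=> ck [C kC].
by apply: (integ_bounded mW fW (continuous_comp_measurable_rV ck)) => x _; exact: kC.
Qed.

Lemma approx_by_comp_lin a f g : mu.-integrable W (EFin \o f) ->
  mu.-integrable W (EFin \o g) -> approx_by_comp f -> approx_by_comp g ->
  approx_by_comp (fun x => a * f x + g x).
Proof.
move=> fi gi af ag e e0.
have ea : 0 < e / 2 / (`|a| + 1) by rewrite !divr_gt0// ltr_wpDl.
have e2 : 0 < e / 2 by rewrite divr_gt0.
have [k [ck [C kC] Hk]] := af _ ea; have [l [cl [D lD] Hl]] := ag _ e2.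
exists (fun t => a * k t + l t); split.
- move=> t; apply: cvgD; last exact: cl.
  by apply: cvgM; [exact: cvg_cst|exact: ck].
- exists (`|a| * C + D) => t; apply: le_trans (ler_normD _ _) _.
  by rewrite lerD// normrM ler_wpM2l.
- have ki := integ_comp_bounded ck (ex_intro _ C kC).
  have li := integ_comp_bounded cl (ex_intro _ D lD).
  have i1 := integ_norm (integB mW fi ki); have i2 := integ_norm (integB mW gi li).
  have i3 := integZ mW a fi; have i4 := integZ mW a ki.
  apply: (@le_trans _ _ (\int[mu]_(x in W) (`|a| * `|f x - k (theta x)| + `|g x - l (theta x)|))).
    apply: (le_Rintegral mW).
    + exact: (integ_norm (integB mW (integD mW i3 gi) (integD mW i4 li))).
    + exact: (integD mW (integZ mW `|a| i1) i2).
    + move=> x _; rewrite -normrM; apply: le_trans _ (ler_normD _ _).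
      by rewrite le_eqVlt; apply/orP; left; apply/eqP; congr (`| _ |); ring.
  rewrite RintegralD//; last exact: (integZ mW `|a| i1).
  rewrite RintegralZl// [e]splitr lerD//.
  apply: (@le_trans _ _ (`|a| * (e / 2 / (`|a| + 1)))); first by rewrite ler_wpM2l.
  rewrite mulrA ler_pdivrMr ?ltr_wpDl// [leLHS]mulrC.
  by apply: ler_wpM2l; [exact: ltW|rewrite lerDl].
Qed.

Lemma approx_by_comp_lim f : mu.-integrable W (EFin \o f) ->
  (forall e : R, 0 < e -> exists g, [/\ mu.-integrable W (EFin \o g), approx_by_comp g &
    \int[mu]_(x in W) `|f x - g x| <= e]) -> approx_by_comp f.
Proof.
move=> fi H e e0; have e2 : 0 < e / 2 by rewrite divr_gt0.
have [g [gi ag fg]] := H _ e2; have [k [ck bk Hk]] := ag _ e2.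
exists k; split => //.
have ki := integ_comp_bounded ck bk.
have i1 := integ_norm (integB mW fi gi); have i2 := integ_norm (integB mW gi ki).
apply: (@le_trans _ _ (\int[mu]_(x in W) (`|f x - g x| + `|g x - k (theta x)|))).
  apply: (le_Rintegral mW (integ_norm (integB mW fi ki)) (integD mW i1 i2)).
  by move=> x _; exact: ler_distD.
by rewrite RintegralD// [e]splitr lerD.
Qed.

(* [A] is saturated for [theta], so compact inner approximations of [A] and of
   its complement have disjoint compact images. *)
Lemma approx_by_comp_indic (A : set V) : measurable A ->
  (forall x y, W x -> W y -> theta x = theta y -> A x -> A y) ->
  approx_by_comp (\1_A).
Proof.
move=> mA sat e e0.
have [K [K' [cK cK' KA K'A KK']]] := inner_regular_measurable oW bW mA e0.
have img (C : set V) : compact C -> C `<=` W -> closed (theta @` C).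
  move=> cC CW; apply: compact_closed; first exact: Rhausdorff.
  apply: continuous_compact => //; apply: continuous_in_subspaceT => x.
  by rewrite inE => /CW; exact: ctheta.
have cB := img K cK (subset_trans KA (@subIsetr _ _ _)).
have cA := img K' cK' (subset_trans K'A (@subDsetl _ _ _)).
have dAB : theta @` K' `&` theta @` K = set0.
  rewrite -subset0 => t [[x K'x <-] [y Ky yx]].
  have [Ay Wy] := KA _ Ky; have [Wx nAx] := K'A _ K'x.
  exact: (nAx (sat _ _ Wy Wx yx Ay)).
have [k [ck k01 kA kB]] := urysohn_R cA cB dAB.
have k1 t : `|k t| <= 1 by have /andP[? ?] := k01 t; rewrite ger0_norm.
exists k; split => //; first by exists 1.
pose E := W `\` (K `|` K').
have mE : measurable E.
  by apply: measurableD => //; apply: measurableU; exact: compact_measurable_rV.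
have mI : measurable_fun W (\1_A : V -> R) by exact: measurable_indic.
have mIE : measurable_fun W (\1_E : V -> R) by exact: measurable_indic.
have iE : mu.-integrable W (EFin \o (\1_E : V -> R)).
  apply: (@integ_bounded _ _ _ mu W mW _ 1 fW) => // x _.
  by rewrite indicE ger0_norm// lern1 leq_b1.
have iA : mu.-integrable W (EFin \o (\1_A : V -> R)).
  apply: (@integ_bounded _ _ _ mu W mW _ 1 fW) => // x _.
  by rewrite indicE ger0_norm// lern1 leq_b1.
have ki := integ_comp_bounded ck (ex_intro _ 1 k1).
apply: (@le_trans _ _ (\int[mu]_(x in W) (\1_E x : R))).
  apply: (le_Rintegral mW (integ_norm (integB mW iA ki)) iE) => x Wx.
  have [xE|nE] := pselect (E x).
    have -> : \1_E x = 1 :> R by rewrite indicE mem_set.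
    rewrite indicE; have /andP[? ?] := k01 (theta x).
    by rewrite ler_norml; case: (_ \in _) => /=; apply/andP; split; lra.
  have [Kx|K'x] : (K `|` K') x by apply: contrapT => h; apply: nE.
    have [Ax _] := KA _ Kx.
    by rewrite indicE mem_set//= kB ?subrr ?normr0//; exists x.
  have [_ nAx] := K'A _ K'x.
  by rewrite indicE memNset//= kA ?subrr ?normr0//; exists x.
have -> : \int[mu]_(x in W) (\1_E x : R) = fine (mu E).
  rewrite /Rintegral integral_indic// setIidl//; exact: subDsetl.
have fE : mu E \is a fin_num.
  by rewrite ge0_fin_numE//; apply: le_lt_trans fW; apply: lebesgue_rV_le; exact: subDsetl.
by rewrite -lee_fin fineK// ltW.
Qed.

Lemma approx_by_comp_profile (v : R -> R) (f : V -> R) :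
  mu.-integrable W (EFin \o f) -> (forall x, W x -> f x = v (theta x)) ->
  approx_by_comp f.
Proof.
move=> fi fv; have mf := integ_measurable fi.
suff : mu.-integrable W (EFin \o (id \o f)) /\ approx_by_comp (id \o f) by case.
apply: (@simple_fun_ind _ (fun k => mu.-integrable W (EFin \o (k \o f)) /\
   approx_by_comp (k \o f))).
- split; first exact: integ0.
  move=> e e0; exists (cst 0); split.
  + exact: cst_continuous.
  + by exists 0 => t; rewrite normr0.
  + under eq_Rintegral do rewrite /= subrr normr0.
    by rewrite Rintegral_cst// mul0r ltW.
- move=> c B k mB [ik ak].
  pose A := W `&` f @^-1` B.
  have mA : measurable A by exact: mf.
  have mI : measurable_fun W (\1_A : V -> R) by exact: measurable_indic.
  have iA : mu.-integrable W (EFin \o (\1_A : V -> R)).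
    apply: (@integ_bounded _ _ _ mu W mW _ 1 fW) => // x _.
    by rewrite indicE ger0_norm// lern1 leq_b1.
  have aA : approx_by_comp \1_A.
    apply: approx_by_comp_indic => // x y Wx Wy xy [_ Bx]; split => //=.
    by rewrite fv// -xy -fv.
  have E x : W x -> ((fun t => c * \1_B t + k t) \o f) x = c * \1_A x + (k \o f) x.
    move=> Wx /=; congr (c * _ + _); rewrite !indicE.
    rewrite (_ : (f x \in B) = (x \in A))//.
    by apply/idP/idP => /set_mem h; apply/mem_set; [split|case: h].
  split.
    apply: (eq_integrable mW (EFin \o (fun x => c * \1_A x + (k \o f) x))).
      by move=> x /set_mem Wx /=; rewrite -E.
    exact: (integD mW (integZ mW c iA) ik).
  move=> e e0; have [l [cl bl Hl]] := approx_by_comp_lin c iA ik aA ak e0.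
  exists l; split => //; apply: le_trans Hl.
  rewrite le_eqVlt; apply/orP; left; apply/eqP; apply: eq_Rintegral => x /set_mem Wx.
  by rewrite E.
- move=> k Pk mk kle kcvg; split => //; apply: (approx_by_comp_lim fi) => e e0.
  have mkf m : measurable_fun W (k m \o f) := integ_measurable (proj1 (Pk m)).
  have H : \int[mu]_(x in W) `|f x - k m (f x)| @[m --> \oo] --> \int[mu]_(x in W) (0 : R).
    apply: (@Rintegral_dominated_cvg _ _ _ mu _ mW _ _ (fun x => 2 * `|f x|)).
    - by move=> m; exact: (measurable_norm (measurable_funB mf (mkf m))).
    - exact: measurable_cst.
    - apply: aeW => x _; rewrite -[X in _ --> X](normr0 R) -(subrr (f x)).
      by apply: cvg_norm; apply: cvgB; [exact: cvg_cst|exact: kcvg].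
    - exact: (integZ mW 2 (integ_norm fi)).
    - move=> m x _; rewrite normr_id mulr_natl mulr2n; apply: le_trans (ler_normB _ _) _.
      by rewrite lerD2l.
  rewrite Rintegral_cst// mul0r in H.
  move/cvgrPdist_le : H => /(_ _ e0)[N _ /(_ N (leqnn N))]; rewrite sub0r normrN => HN.
  exists (k N \o f); case: (Pk N) => ? ?; split => //.
  exact: le_trans (ler_norm _) HN.
Qed.

End composition_approximation.

(** * Summation by parts for difference quotients *)

Section summation_by_parts.
Context {R : realType} {n : nat}.
Local Notation V := 'rV[R]_n.
Local Notation mu := (@lebesgue_rV R n).
Local Notation integ f := (mu.-integrable setT (EFin \o f)).
Implicit Types (f g u phi psi a : V -> R).

Lemma primitive (k : R -> R) (a b : R) : continuous k -> a < b ->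
  exists K : R -> R, forall t, a < t < b -> is_derive t 1 K (k t).
Proof.
move=> ck ab.
exists (fun t => \int[lebesgue_measure]_(s in `[a, t]) k s) => t /andP[at' tb].
have ki : (@lebesgue_measure R).-integrable `[a, b] (EFin \o k).
  apply: continuous_compact_integrable; first exact: segment_compact.
  exact: continuous_subspaceT.
have [h1 h2] := continuous_FTC1_closed tb ki at' (ck t).
by apply: DeriveDef; [exact: h1|rewrite -derive1E; exact: h2].
Qed.

Lemma measurable_shift_fun (c : V) f : measurable_fun setT f ->
  measurable_fun setT (fun x : V => f (x + c)).
Proof. by move=> mf; apply: (measurable_comp measurableT _ mf (measurable_shift_rV c)). Qed.

Lemma measurable_dquot h i f : measurable_fun setT f -> measurable_fun setT (dquot h i f).
Proof.
move=> mf; apply: measurable_funM; last exact: measurable_cst.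
exact: (measurable_funB (measurable_shift_fun _ mf) mf).
Qed.

Lemma bounded_dquot h i f (C : R) : (forall x, `|f x| <= C) ->
  forall x, `|dquot h i f x| <= (C + C) * `|h|^-1.
Proof.
move=> fC x; rewrite /dquot normrM normfV ler_wpM2r ?invr_ge0//.
by apply: le_trans (ler_normB _ _) _; rewrite lerD.
Qed.

Lemma integMbd f a (C : R) : integ f -> measurable_fun setT a -> (forall x, `|a x| <= C) ->
  integ (fun x => f x * a x).
Proof.
move=> fi ma aC; rewrite (_ : (fun x => _) = (fun x => a x * f x)).
  exact: (integMb measurableT ma (fun x _ => aC x) fi).
by apply/funext => x; rewrite mulrC.
Qed.

Lemma Rintegral_dquot_parts h i f psi (C : R) : integ f -> measurable_fun setT psi ->
  (forall x, `|psi x| <= C) -> h != 0 ->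
  \int[mu]_x (psi x * dquot h i f x) = - \int[mu]_x (f x * dquot (- h) i psi x).
Proof.
move=> fi mpsi psiC h0.
have mpsi' := measurable_shift_fun (- (h *: 'e_i)) mpsi.
have i1 := integMbd fi mpsi' (fun x => psiC _).
have i2 := integMbd fi mpsi psiC.
have i3 : integ (fun x => f (x + h *: 'e_i) * psi x).
  exact: (integMbd (integ_shift _ fi) mpsi psiC).
transitivity (h^-1 * (\int[mu]_x (f (x + h *: 'e_i) * psi x) - \int[mu]_x (f x * psi x))).
  rewrite -RintegralB// -RintegralZl//; last exact: (integB measurableT i3 i2).
  by apply: eq_Rintegral => x _; rewrite /dquot; ring.
have -> : \int[mu]_x (f (x + h *: 'e_i) * psi x) = \int[mu]_x (f x * psi (x - h *: 'e_i)).
  by rewrite -(Rintegral_shift (h *: 'e_i) i1); apply: eq_Rintegral => x _; rewrite addrK.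
rewrite -RintegralB// -RintegralZl//; last exact: (integB measurableT i1 i2).
rewrite -mulN1r -RintegralZl//; last first.
  exact: (integMbd fi (measurable_dquot _ _ mpsi) (bounded_dquot (- h) i psiC)).
by apply: eq_Rintegral => x _; rewrite /dquot scaleNr; field.
Qed.

(* What remains of [dquot h i f * dquot (- h) j a - dquot h j f * dquot (- h) i a],
   tested against [phi], once the difference quotients are moved off [f]. *)
Definition cross_dquot h i j phi a (x : V) : R :=
  dquot (- h) i phi x * dquot (- h) j a (x - h *: 'e_i) -
  dquot (- h) j phi x * dquot (- h) i a (x - h *: 'e_j).

(* The second differences of [a] cancel because difference quotients commute. *)
Lemma Rintegral_cross_dquot h i j f phi a (C D : R) : integ f ->
  measurable_fun setT phi -> (forall x, `|phi x| <= C) ->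
  measurable_fun setT a -> (forall x, `|a x| <= D) -> h != 0 ->
  \int[mu]_x (phi x * (dquot h i f x * dquot (- h) j a x -
                       dquot h j f x * dquot (- h) i a x)) =
  - \int[mu]_x (f x * cross_dquot h i j phi a x).
Proof.
move=> fi mphi phiC ma aD h0.
have mpsi l : measurable_fun setT (fun x => phi x * dquot (- h) l a x).
  exact: (measurable_funM mphi (measurable_dquot _ _ ma)).
have psib l x : `|phi x * dquot (- h) l a x| <= C * ((D + D) * `|- h|^-1).
  by rewrite normrM ler_pM// bounded_dquot.
have P k l := Rintegral_dquot_parts k fi (mpsi l) (psib l) h0.
have ipsi k l : integ (fun x => (phi x * dquot (- h) l a x) * dquot h k f x).
  by exact: (integMb measurableT (mpsi l) (fun x _ => psib l x) (integ_dquot h k fi)).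
have idq k l : integ (fun x => f x * dquot (- h) k (fun x => phi x * dquot (- h) l a x) x).
  exact: (integMbd fi (measurable_dquot _ _ (mpsi l)) (bounded_dquot _ _ (psib l))).
transitivity (\int[mu]_x ((phi x * dquot (- h) j a x) * dquot h i f x -
   (phi x * dquot (- h) i a x) * dquot h j f x)).
  by apply: eq_Rintegral => x _; ring.
rewrite RintegralB// !P.
rewrite [X in _ = - X](_ : _ = \int[mu]_x
  (f x * dquot (- h) i (fun x => phi x * dquot (- h) j a x) x -
   f x * dquot (- h) j (fun x => phi x * dquot (- h) i a x) x)).
  by rewrite (RintegralB measurableT (idq i j) (idq j i)) opprK opprB addrC.
apply: eq_Rintegral => x _.
rewrite /cross_dquot /dquot !scaleNr [x - h *: 'e_j - h *: 'e_i]addrAC.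
by field.
Qed.

End summation_by_parts.

(** * Uniform bounds for the cross differences *)

Section parallel_gradients.
Context {R : realType} {n : nat}.
Local Notation V := 'rV[R]_n.
Local Notation mu := (@lebesgue_rV R n).
Local Notation integ f := (mu.-integrable setT (EFin \o f)).

Lemma test_function_dquot_bounded W (phi : V -> R) i : test_function W phi ->
  exists2 M, 0 <= M & forall h x, `|dquot h i phi x| <= M.
Proof.
move=> tphi; have [M M0 HM] := test_function_bounded (test_function_derive i tphi).
have dphi x : differentiable phi x by case: tphi => sphi _ _; exact: (sphi [::] x).
pose F (x : V) (t : R) := phi (x + t *: 'e_i).
have dF (x : V) (t : R) : is_derive t 1 (F x) ('D_('e_i) phi (x + t *: 'e_i)).
  apply: DeriveDef; first by apply: derivable_line; exact: diff_derivable.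
  by rewrite /F derive_line.
have H (x : V) (t : R) : 0 < t -> `|F x t - F x 0| <= M * t.
  move=> t0; have [|s _ ->] := @MVT _ (F x) (fun t => 'D_('e_i) phi (x + t *: 'e_i)) _ _ t0.
  - by apply: derivable_within_continuous => s _; case: (dF x s).
  - by rewrite subr0 normrM (gtr0_norm t0) ler_wpM2r// ltW.
exists M => // h x; rewrite /dquot.
(* For [h = 0] the quotient is 0, the inverse of 0 being 0, so the bound holds for all steps. *)
have [h0|h0|->] := ltgtP h 0; last by rewrite invr0 mulr0 normr0.
- rewrite normrM normfV (ltr0_norm h0) ler_pdivrMr ?oppr_gt0//.
  have := H (x + h *: 'e_i) (- h); rewrite oppr_gt0 => /(_ h0).
  by rewrite /F -addrA -scalerDl subrr !scale0r !addr0 distrC.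
- rewrite normrM normfV (gtr0_norm h0) ler_pdivrMr//.
  by have := H x h h0; rewrite /F scale0r addr0.
Qed.

Variables (W : set V) (theta : V -> R) (L : R).
Hypotheses (oW : open W) (bW : bounded_set W) (L0 : 0 <= L).
Hypothesis Ltheta : forall x y, W x -> W y -> `|theta x - theta y| <= L * `|x - y|.

Let mW : measurable W. Proof. exact: open_measurable_rV. Qed.
Let fW : (mu W < +oo)%E. Proof. exact: bounded_lebesgue_fin. Qed.

Lemma lipschitz_continuous_on x : W x -> {for x, continuous theta}.
Proof.
move=> Wx; apply/(@cvgrPdist_le _ _ _ (nbhs x) (nbhs_filter x)) => e e0.
have eL : 0 < e / (L + 1) by rewrite divr_gt0// ltr_wpDl.
have n1 : nbhs x W by exact: open_nbhs_nbhs.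
have n2 : nbhs x (ball x (e / (L + 1))) by exact: nbhsx_ballx.
apply: filterS2 n1 n2 => y Wy; rewrite mx_norm_ball => xy.
apply: le_trans (Ltheta Wx Wy) _.
apply: (@le_trans _ _ (L * (e / (L + 1)))); first by rewrite ler_wpM2l// ltW.
rewrite mulrA ler_pdivrMr ?ltr_wpDl// [leLHS]mulrC.
by apply: ler_wpM2l; [exact: ltW|rewrite lerDl].
Qed.

(** Extending by zero makes translations meaningful everywhere, at the price of a jump at the
    boundary of [W]. The Lipschitz estimate is therefore used only between points that the collar
    keeps in [W]. *)
Let th := theta \_ W.

Let thE x : W x -> th x = theta x.
Proof. by move=> Wx; rewrite /th patchE mem_set. Qed.

Lemma measurable_patch_comp (K : R -> R) : (forall x, W x -> {for theta x, continuous K}) ->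
  measurable_fun setT ((K \o theta) \_ W).
Proof.
move=> cK; apply/(measurable_restrictT _ mW).
apply: (open_continuous_measurable_rV oW) => x Wx.
by apply: continuous_comp; [exact: lipschitz_continuous_on|exact: cK].
Qed.

Lemma lipschitz_bounded_on : exists2 B, 0 < B & forall x, W x -> `|theta x| < B.
Proof.
have [W0|/set0P[x0 Wx0]] := eqVneq W set0.
  by exists 1 => // x; rewrite W0.
have [N [_ HN]] := bW.
exists (`|theta x0| + L * (2 * (`|N| + 1)) + 1).
  by rewrite ltr_wpDl// addr_ge0// !mulr_ge0// addr_ge0.
move=> x Wx; apply: (@le_lt_trans _ _ (`|theta x0| + L * (2 * (`|N| + 1)))); last first.
  by rewrite ltrDl.
rewrite -[theta x](subrK (theta x0)) addrC.
apply: le_trans (ler_normD _ _) _; rewrite lerD2l.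
apply: le_trans (Ltheta Wx Wx0) _; rewrite ler_wpM2l//.
apply: le_trans (ler_normB _ _) _; rewrite mulr_natl mulr2n.
by rewrite lerD//; apply: HN => //; rewrite ltr_pwDr// ler_norm.
Qed.

Variables (U : set V) (d : R).
Hypotheses (oU : open U) (d0 : 0 < d) (UW : collar U W d).

Let UsubW : U `<=` W. Proof. exact: collar_sub UW. Qed.

Section fixed_test.
Variables (phi : V -> R) (i j : 'I_n) (M : R).
Hypotheses (tphi : test_function U phi) (M0 : 0 <= M).
Hypothesis HM : forall l h x, l = i \/ l = j -> `|dquot h l phi x| <= M.

(** Steps below [d / 4] leave room in the collar for two successive shifts, one from the quotient of
    [phi] and one from the quotient of [theta]. *)
Let shift2 h l m x : 0 < h < d / 4 -> U x -> W (x - h *: 'e_l - h *: 'e_m).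
Proof.
move=> /andP[h0 hd] Ux; rewrite -addrA; apply: UW => //.
rewrite -opprD normrN; apply: le_lt_trans (ler_normD _ _) _.
have := norm_scale_delta h l; have := norm_scale_delta h m.
by rewrite gtr0_norm//; lra.
Qed.

Lemma collar_shift h l x : 0 < h < d / 4 -> U x ->
  W (x - h *: 'e_l) /\ W (x + h *: 'e_l).
Proof.
move=> /andP[h0 hd] Ux; have := norm_scale_delta h l; rewrite gtr0_norm// => hl.
by split; apply: UW => //; rewrite ?normrN; apply: le_lt_trans hl _; lra.
Qed.

(** A nonzero quotient of [phi] forces [x] or [x - h *: 'e_l] into [U]; in both cases all points
    entering the cross difference lie in [W]. *)
Let dquot_supp h l x : 0 < h < d / 4 -> dquot (- h) l phi x != 0 ->
  forall m, [/\ W x, W (x - h *: 'e_l) & W (x - h *: 'e_l - h *: 'e_m)].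
Proof.
move=> hd; rewrite /dquot scaleNr => q0 m.
have [Ux|nUx] := pselect (U x).
  by split; [exact: UsubW|case: (collar_shift l hd Ux)|exact: shift2].
have [Ux|nUx'] := pselect (U (x - h *: 'e_l)).
  split; last 2 first.
  - exact: UsubW.
  - by case: (collar_shift m hd Ux).
  - by case: (collar_shift l hd Ux) => _; rewrite subrK.
by move: q0; rewrite !(test_function0 tphi)// subrr mul0r eqxx.
Qed.

Lemma dquot_patch_le h m y : 0 < h -> W y -> W (y - h *: 'e_m) ->
  `|dquot (- h) m (theta \_ W) y| <= L.
Proof.
move=> h0 Wy Wy'; rewrite -/th /dquot scaleNr !thE// normrM normfV normrN (gtr0_norm h0).
rewrite ler_pdivrMr//; apply: le_trans (Ltheta Wy' Wy) _; rewrite ler_wpM2l//.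
rewrite addrAC subrr sub0r normrN.
by apply: le_trans (norm_scale_delta _ _) _; rewrite gtr0_norm.
Qed.

(** The bound is independent of [h], which is what allows [f] to be replaced by an L^1 approximation
    uniformly along the sequence of steps. *)
Lemma cross_dquot_bound h x : 0 < h < d / 4 ->
  `|cross_dquot h i j phi (theta \_ W) x| <= 2 * (M * L).
Proof.
move=> hd; have h0 : 0 < h by case/andP: hd.
have T l m : l = i \/ l = j ->
    `|dquot (- h) l phi x * dquot (- h) m th (x - h *: 'e_l)| <= M * L.
  move=> lij; have [->|q0] := eqVneq (dquot (- h) l phi x) 0.
    by rewrite mul0r normr0 mulr_ge0.
  have [_ W1 W2] := dquot_supp hd q0 m.
  by rewrite normrM ler_pM//; [exact: HM|exact: dquot_patch_le].
rewrite mulr_natl mulr2n; apply: le_trans (ler_normB _ _) _.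
by apply: lerD; apply: T; [left|right].
Qed.

Section continuous_profile.
Variables (k K : R -> R) (B : R).
Hypotheses (B0 : 0 < B) (thB : forall x, W x -> `|theta x| < B).
Hypothesis dK : forall t, - B < t < B -> is_derive t 1 K (k t).

Let Kth := (K \o theta) \_ W.

(** An increment of [K] equals [k s] times the increment of [theta], with [s] between the two values
    of [theta]. Since [y] is within [h] of [x] and the other point within [2 * h], [s] is within
    [2 * L * h] of [theta x]. *)
Let bracket h m x y eta : 0 < h -> 0 <= eta -> W x -> W y -> W (y - h *: 'e_m) ->
  `|x - y| <= h -> (forall s, `|s - theta x| <= 2 * L * h -> `|k (theta x) - k s| <= eta) ->
  `|k (theta x) * dquot (- h) m th y - dquot (- h) m Kth y| <= eta * L.
Proof.
move=> h0 eta0 Wx Wy Wy' xy Hk.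
have hn : `|h *: 'e_m : V| <= h.
  by apply: le_trans (norm_scale_delta _ _) _; rewrite gtr0_norm.
have q := dquot_patch_le h0 Wy Wy'.
have Ly : `|theta y - theta x| <= L * h.
  by rewrite distrC; apply: le_trans (Ltheta Wx Wy) _; rewrite ler_wpM2l.
have Ly' : `|theta (y - h *: 'e_m) - theta x| <= 2 * L * h.
  rewrite distrC; apply: le_trans (Ltheta Wx Wy') _.
  rewrite -mulrA [leRHS]mulrCA ler_wpM2l// opprB addrCA addrC mulr_natl mulr2n.
  by apply: le_trans (ler_normD _ _) _; rewrite lerD.
have KE z : W z -> Kth z = K (theta z) by move=> Wz; rewrite /Kth patchE mem_set.
pose a := theta y; pose b := theta (y - h *: 'e_m).
have aB : - B < a < B by rewrite -ltr_norml; exact: thB.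
have bB : - B < b < B by rewrite -ltr_norml; exact: thB.
have [s sab Ks] : exists2 s, Num.min a b <= s <= Num.max a b & K b - K a = k s * (b - a).
  have mvt (u v : R) : - B < u < B -> - B < v < B -> u < v ->
      exists2 s, u <= s <= v & K v - K u = k s * (v - u).
    move=> /andP[u1 u2] /andP[v1 v2] uv.
    have dK' t : t \in `[u, v] -> is_derive t 1 K (k t).
      rewrite in_itv/= => /andP[ut tv]; apply: dK.
      by rewrite (lt_le_trans u1 ut) (le_lt_trans tv v2).
    have c : {within `[u, v], continuous K}.
      by apply: derivable_within_continuous => t /dK'[].
    have [s sab Ks] := MVT uv (fun t ht => dK' t (subset_itv_oo_cc ht)) c.
    by exists s => //; have := subset_itv_oo_cc sab; rewrite in_itv.
  have [ab|ba|->] := ltgtP a b.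
  - exact: mvt.
  - have [s sb Ks] := mvt _ _ bB aB ba; exists s => //.
    by rewrite -(opprB (K a)) Ks -mulrN opprB.
  - by exists b; rewrite ?lexx// !subrr mulr0.
have sx : `|s - theta x| <= 2 * L * h.
  have Lh : 0 <= L * h by rewrite mulr_ge0// ltW.
  move: Ly Ly' sab; rewrite -/a -/b !ler_norml ge_min le_max.
  by move=> /andP[? ?] /andP[? ?] /andP[/orP[] ? /orP[] ?]; apply/andP; split; lra.
rewrite (_ : _ - _ = (k (theta x) - k s) * dquot (- h) m th y).
  by rewrite normrM ler_pM// Hk.
rewrite /dquot scaleNr !KE// !thE// -/a -/b Ks; ring.
Qed.

(** The oscillation [eta] of [k] is a parameter because the bound serves twice: with [eta] twice the
    supremum of [k] it gives the domination, with [eta] small it gives the pointwise limit. *)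
Lemma cross_dquot_chain_bound h x eta : 0 < h < d / 4 -> 0 <= eta -> W x ->
  (forall s, `|s - theta x| <= 2 * L * h -> `|k (theta x) - k s| <= eta) ->
  `|k (theta x) * cross_dquot h i j phi (theta \_ W) x -
    cross_dquot h i j phi ((K \o theta) \_ W) x| <= 2 * (M * (eta * L)).
Proof.
rewrite -/th -/Kth => hd eta0 Wx Hk; have h0 : 0 < h by case/andP: hd.
have T l m : l = i \/ l = j ->
    `|dquot (- h) l phi x * (k (theta x) * dquot (- h) m th (x - h *: 'e_l) -
       dquot (- h) m Kth (x - h *: 'e_l))| <= M * (eta * L).
  move=> lij; have [->|q0] := eqVneq (dquot (- h) l phi x) 0.
    by rewrite mul0r normr0 !mulr_ge0.
  have [_ W1 W2] := dquot_supp hd q0 m.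
  rewrite normrM ler_pM//; [exact: HM|apply: bracket => //].
  rewrite subKr; apply: le_trans (norm_scale_delta _ _) _; by rewrite gtr0_norm.
rewrite mulr_natl mulr2n.
rewrite (_ : _ - _ = dquot (- h) i phi x * (k (theta x) * dquot (- h) j th (x - h *: 'e_i) -
       dquot (- h) j Kth (x - h *: 'e_i)) -
   dquot (- h) j phi x * (k (theta x) * dquot (- h) i th (x - h *: 'e_j) -
       dquot (- h) i Kth (x - h *: 'e_j))); last by rewrite /cross_dquot; ring.
by apply: le_trans (ler_normB _ _) _; apply: lerD; apply: T; [left|right].
Qed.

End continuous_profile.
End fixed_test.
End parallel_gradients.

Section parallel_cvg.
Context {R : realType} {n : nat}.
Local Notation V := 'rV[R]_n.
Local Notation mu := (@lebesgue_rV R n).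
Local Notation integ f := (mu.-integrable setT (EFin \o f)).

Lemma measurable_cross_dquot h i j (phi a : V -> R) : measurable_fun setT phi ->
  measurable_fun setT a -> measurable_fun setT (cross_dquot h i j phi a).
Proof.
move=> mphi ma; have mT l m : measurable_fun setT (fun x =>
    dquot (- h) l phi x * dquot (- h) m a (x - h *: 'e_l)).
  apply: measurable_funM; first exact: measurable_dquot.
  exact: (measurable_shift_fun _ (measurable_dquot (- h) m ma)).
exact: (measurable_funB (mT i j) (mT j i)).
Qed.

Variables (W : set V) (theta : V -> R) (L : R).
Hypotheses (oW : open W) (bW : bounded_set W) (L0 : 0 <= L).
Hypothesis Ltheta : forall x y, W x -> W y -> `|theta x - theta y| <= L * `|x - y|.
Variables (U : set V) (d : R).
Hypotheses (oU : open U) (d0 : 0 < d) (UW : collar U W d).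
Variables (phi : V -> R) (i j : 'I_n) (M : R).
Hypotheses (tphi : test_function U phi) (M0 : 0 <= M).
Hypothesis HM : forall l h x, l = i \/ l = j -> `|dquot h l phi x| <= M.
Variable h : R^nat.
Hypotheses (hd : forall k, 0 < h k < d / 4) (hcvg : h k @[k --> \oo] --> 0).

Let mW : measurable W. Proof. exact: open_measurable_rV. Qed.
Let fW : (mu W < +oo)%E. Proof. exact: bounded_lebesgue_fin. Qed.
Let h0 k : h k != 0. Proof. by rewrite gt_eqF//; case/andP: (hd k). Qed.
Let mphi : measurable_fun setT phi.
Proof. exact: (test_function_measurable measurableT tphi). Qed.
Let th := theta \_ W.
Let mth : measurable_fun setT th.
Proof.
exact: (@measurable_patch_comp _ _ W theta L oW L0 Ltheta id (fun x _ => @cvg_id _ _)).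
Qed.
Let ctheta x : W x -> {for x, continuous theta}.
Proof. exact: (lipschitz_continuous_on oW L0 Ltheta). Qed.

Let mcr k : measurable_fun W (cross_dquot (h k) i j phi th).
Proof. exact: measurable_funTS (measurable_cross_dquot _ _ _ mphi mth). Qed.

Let bcr k x : `|cross_dquot (h k) i j phi th x| <= 2 * (M * L).
Proof. exact: (cross_dquot_bound L0 Ltheta d0 UW tphi M0 HM x (hd k)). Qed.

(** Summation by parts with the indicator of [W] in the place of [f]: its difference quotients
    vanish on the collar, hence on the support of [phi], and the other side is the integral of the
    cross difference over [W]. *)
Lemma Rintegral_cross_dquot_cst k (a : V -> R) D : measurable_fun setT a ->
  (forall x, `|a x| <= D) ->
  \int[mu]_(x in W) cross_dquot (h k) i j phi a x = 0.
Proof.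
move=> ma aD.
have [C C0 HC] := test_function_bounded tphi.
have i1 : integ (\1_W : V -> R) by exact: (indic_sub_integrable oW bW mW).
have := @Rintegral_cross_dquot _ _ (h k) i j _ _ _ _ _ i1 mphi HC ma aD (h0 k).
rewrite (_ : \int[mu]_x (phi x * _) = \int[mu]_x (0 : R)); last first.
  apply: eq_Rintegral => x _.
  have [Ux|nUx] := pselect (U x); last by rewrite (test_function0 tphi nUx) mul0r.
  have q0 l : dquot (h k) l (\1_W : V -> R) x = 0.
    rewrite /dquot !indicE !mem_set ?subrr ?mul0r//; first exact: (collar_sub d0 UW Ux).
    by case: (collar_shift UW l (hd k) Ux).
  by rewrite !q0 !mul0r subrr mulr0.
rewrite Rintegral_cst// mul0r => /eqP; rewrite eq_sym oppr_eq0 => /eqP <-.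
rewrite -[in RHS](@Rintegral_supp _ _ _ mu W); last first.
  by move=> x nW; rewrite indicE memNset// mul0r.
by apply: eq_Rintegral => x; rewrite inE => Wx; rewrite indicE mem_set// mul1r.
Qed.

(** With [K] a primitive of [kap], the integrand is the cross difference of [K \o theta], whose
    integral is zero, up to an error [r] that tends to 0 pointwise and boundedly. *)
Lemma cross_dquot_comp_cvg0 (kap : R -> R) (C : R) : continuous kap ->
  (forall t, `|kap t| <= C) ->
  \int[mu]_(x in W) (kap (theta x) * cross_dquot (h k) i j phi th x)
    @[k --> \oo] --> (0 : R).
Proof.
move=> ck kC; have C0 : 0 <= C by exact: le_trans (kC 0).
have [B B0 HB] := lipschitz_bounded_on bW L0 Ltheta.
(* The primitive is taken on a larger interval so that [K] is continuous, hence bounded, on the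
   closed interval between [- B] and [B]. *)
have BB : - (B + 1) < B + 1 by lra.
have [K dK'] := primitive ck BB.
have dK t : - B < t < B -> is_derive t 1 K (kap t).
  by move=> /andP[? ?]; apply: dK'; apply/andP; split; lra.
have cK : {within `[- B, B], continuous K}.
  apply: derivable_within_continuous => t; rewrite in_itv/= => /andP[? ?].
  by have [] : is_derive t 1 K (kap t) by apply: dK'; apply/andP; split; lra.
have leB : - B <= B by lra.
have [D KD] : exists D, forall t, - B <= t <= B -> `|K t| <= D.
  have [c _ Hc] := EVT_max leB cK; have [c' _ Hc'] := EVT_min leB cK.
  exists (`|K c| + `|K c'|) => t tB; rewrite ler_norml; apply/andP; split.
    rewrite lerNl; apply: (@le_trans _ _ (- K c')); last first.
      by apply: le_trans (ler_norm _) _; rewrite normrN lerDr.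
    by rewrite lerN2; apply: Hc'; rewrite in_itv.
  apply: (@le_trans _ _ (K c)); first by apply: Hc; rewrite in_itv.
  by apply: le_trans (ler_norm _) _; rewrite lerDl.
pose Kth := (K \o theta) \_ W.
have mK : measurable_fun setT Kth.
  apply: (measurable_patch_comp oW L0 Ltheta) => x Wx.
  have [] : is_derive (theta x) 1 K (kap (theta x)).
    by apply: dK; rewrite -ltr_norml; exact: HB.
  by move=> dd _; apply: differentiable_continuous; exact/derivable1_diffP.
have bK x : `|Kth x| <= `|D|.
  rewrite /Kth patchE; case: ifPn => [|_]; last by rewrite normr0.
  rewrite inE => Wx; apply: le_trans (ler_norm D); apply: KD.
  by rewrite -ler_norml ltW// HB.
pose r k x := kap (theta x) * cross_dquot (h k) i j phi th x -
  cross_dquot (h k) i j phi Kth x.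
have mkap : measurable_fun W (fun x => kap (theta x)).
  exact: (continuous_comp_measurable_rV oW ctheta ck).
have mKc k : measurable_fun W (cross_dquot (h k) i j phi Kth).
  exact: measurable_funTS (measurable_cross_dquot _ _ _ mphi mK).
have mr k : measurable_fun W (r k).
  exact: (measurable_funB (measurable_funM mkap (mcr k)) (mKc k)).
have rb k x : W x -> `|r k x| <= 2 * (M * ((C + C) * L)).
  move=> Wx; apply: (cross_dquot_chain_bound L0 Ltheta d0 UW tphi M0 HM HB dK (hd k)) => //.
    exact: addr_ge0.
  by move=> s _; apply: le_trans (ler_normB _ _) _; exact: lerD.
have ri k : mu.-integrable W (EFin \o r k) := integ_bounded mW fW (mr k) (rb k).
have pi k : mu.-integrable W (EFin \o (fun x => kap (theta x) * cross_dquot (h k) i j phi th x)).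
  apply: (@integ_bounded _ _ _ mu W mW _ (C * (2 * (M * L))) fW).
    exact: (measurable_funM mkap (mcr k)).
  by move=> x _; rewrite normrM ler_pM.
have E k : \int[mu]_(x in W) (kap (theta x) * cross_dquot (h k) i j phi th x) =
    \int[mu]_(x in W) r k x.
  have KI : mu.-integrable W (EFin \o cross_dquot (h k) i j phi Kth).
    have := integB mW (pi k) (ri k); congr (integrable _ _ _).
    by apply/funext => x /=; congr EFin; rewrite /r opprB addrC subrK.
  by rewrite /r RintegralB// (Rintegral_cross_dquot_cst k mK bK) subr0.
suff H : \int[mu]_(x in W) r k x @[k --> \oo] --> \int[mu]_(x in W) (0 : R).
  rewrite Rintegral_cst// mul0r in H.
  by apply: cvg_trans H; apply: near_eq_cvg; apply: nearW => k; rewrite E.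
apply: (@Rintegral_dominated_cvg _ _ _ mu _ mW _ _ (fun=> 2 * (M * ((C + C) * L)))).
- exact: mr.
- exact: measurable_cst.
- apply: aeW => x Wx; apply/cvgrPdist_le => e e0.
  pose eta := e / (2 * (M * L) + 1).
  have p1 : 0 < 2 * (M * L) + 1 by rewrite ltr_wpDl// !mulr_ge0.
  have eta0 : 0 < eta by rewrite divr_gt0.
  have := ck (theta x); move/(@cvgrPdist_le _ _ _ (nbhs _) _) => /(_ _ eta0)/nbhs_ballP[s /= s0 Hs].
  have s1 : 0 < s / (2 * L + 1) by rewrite divr_gt0// ltr_wpDl// mulr_ge0.
  move/cvgrPdist_lt : hcvg => /(_ _ s1); apply: filterS => k.
  have hk0 : 0 < h k by case/andP: (hd k).
  rewrite sub0r normrN (gtr0_norm hk0) ltr_pdivlMr ?ltr_wpDl ?mulr_ge0// => hs.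
  rewrite sub0r normrN; apply: (@le_trans _ _ (2 * (M * (eta * L)))).
    apply: (cross_dquot_chain_bound L0 Ltheta d0 UW tphi M0 HM HB dK (hd k) (ltW eta0) Wx).
    move=> t tx; apply: Hs; rewrite /ball/= distrC; apply: le_lt_trans tx _.
    by apply: le_lt_trans hs; rewrite mulrDr mulr1 mulrC lerDl ltW.
  rewrite (_ : 2 * _ = eta * (2 * (M * L))); last by ring.
  rewrite /eta mulrAC ler_pdivrMr// ler_wpM2l// ?lerDl//; exact: ltW.
- by apply: (@integ_bounded _ _ _ mu _ mW _ `|2 * (M * ((C + C) * L))| fW (measurable_cst _)).
- exact: rb.
Qed.

(** Half of [e] pays for replacing [f] by [kap \o theta], through the uniform bound [2 * (M * L)];
    the other half is the convergence already known for a continuous profile. *)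
Lemma cross_dquot_profile_cvg0 (v : R -> R) (f : V -> R) : integ f ->
  (forall x, ~ W x -> f x = 0) -> (forall x, W x -> f x = v (theta x)) ->
  \int[mu]_x (f x * cross_dquot (h k) i j phi th x) @[k --> \oo] --> (0 : R).
Proof.
move=> fi f0 fv; have fiW := integ_subset mW measurableT (@subsetT _ W) fi.
have ap := approx_by_comp_profile oW bW ctheta fiW fv.
have E k := @Rintegral_supp _ _ _ mu W _ (fun x nW =>
  eq_trans (congr1 ( *%R^~ (cross_dquot (h k) i j phi th x)) (f0 x nW)) (mul0r _)).
apply/cvgrPdist_le => e e0.
have p1 : 0 < 2 * (M * L) + 1 by rewrite ltr_wpDl// !mulr_ge0.
have e1 : 0 < e / 2 / (2 * (M * L) + 1) by rewrite !divr_gt0.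
have e2 : 0 < e / 2 by rewrite divr_gt0.
have [kap [ck [C kC] Hk]] := ap _ e1.
have kv := cross_dquot_comp_cvg0 ck kC.
move/cvgrPdist_le : kv => /(_ _ e2); apply: filterS => k.
rewrite !sub0r !normrN -E => Hk2.
have ki := integ_comp_bounded oW bW ctheta ck (ex_intro _ C kC).
have mM g : mu.-integrable W (EFin \o g) ->
    mu.-integrable W (EFin \o (fun x => g x * cross_dquot (h k) i j phi th x)).
  move=> gi; rewrite (_ : (fun x => _) = (fun x => cross_dquot (h k) i j phi th x * g x)).
    exact: (integMb mW (mcr k) (fun x _ => bcr k x) gi).
  by apply/funext => x; rewrite mulrC.
have i1 := mM _ fiW; have i2 := mM _ ki; have i3 := integB mW fiW ki.
rewrite -[X in `|X|](subrK (\int[mu]_(x in W) (kap (theta x) * cross_dquot (h k) i j phi th x))).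
apply: le_trans (ler_normD _ _) _; rewrite [leRHS]splitr lerD//.
rewrite -RintegralB//.
apply: (@le_trans _ _ (\int[mu]_(x in W) (2 * (M * L) * `|f x - kap (theta x)|))).
  apply: (ler_norm_Rintegral mW (integB mW i1 i2) (integZ mW _ (integ_norm i3))) => x _.
  by rewrite -mulrBl normrM mulrC ler_wpM2r.
rewrite RintegralZl//; last exact: (integ_norm i3).
apply: (@le_trans _ _ (2 * (M * L) * (e / 2 / (2 * (M * L) + 1)))).
  by rewrite ler_wpM2l// !mulr_ge0.
rewrite [leLHS]mulrA ler_pdivrMr// mulrC ler_wpM2l ?lerDl//; exact: ltW.
Qed.

End parallel_cvg.

(** * From cross differences to parallel weak gradients *)

Section parallel_weak.
Context {R : realType} {n : nat}.
Local Notation V := 'rV[R]_n.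
Local Notation mu := (@lebesgue_rV R n).
Local Notation integ f := (mu.-integrable setT (EFin \o f)).
Variables (W : set V) (theta : V -> R) (L : R).
Hypotheses (oW : open W) (bW : bounded_set W) (L0 : 0 <= L).
Hypothesis Ltheta : forall x y, W x -> W y -> `|theta x - theta y| <= L * `|x - y|.
Variables (v : R -> R) (f gi gj : V -> R) (i j : 'I_n).
Hypotheses (fi : integ f) (f0 : forall x, ~ W x -> f x = 0)
  (fv : forall x, W x -> f x = v (theta x)).
Hypotheses (gii : integ gi) (gi0 : forall x, ~ W x -> gi x = 0)
  (wgi : weak_derivative W i f gi).
Hypotheses (gji : integ gj) (gj0 : forall x, ~ W x -> gj x = 0)
  (wgj : weak_derivative W j f gj).

Let mW : measurable W. Proof. exact: open_measurable_rV. Qed.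
Let th := theta \_ W.
Let mth : measurable_fun setT th.
Proof.
exact: (@measurable_patch_comp _ _ W theta L oW L0 Ltheta id (fun x _ => @cvg_id _ _)).
Qed.
Let thb : exists B, forall x, `|th x| <= B.
Proof.
have [B B0 HB] := lipschitz_bounded_on bW L0 Ltheta; exists B => x.
rewrite /th patchE; case: ifPn => [|_]; last by rewrite normr0 ltW.
by rewrite inE => Wx; rewrite ltW// HB.
Qed.

Section collar_part.
Variables (U : set V) (d : R).
Hypotheses (oU : open U) (d0 : 0 < d) (UW : collar U W d).
Let mU : measurable U. Proof. exact: open_measurable_rV. Qed.
Let bU : bounded_set U. Proof. by apply: bounded_setS bW; exact: collar_sub UW. Qed.

Section sequence.
Variable h : R^nat.
Hypotheses (hd : forall k, 0 < h k < d / 4) (hcvg : h k @[k --> \oo] --> 0).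
Let h0 k : h k != 0. Proof. by rewrite gt_eqF//; case/andP: (hd k). Qed.

Let thL k l x : U x -> `|dquot (- h k) l th x| <= L.
Proof.
move=> Ux; apply: (dquot_patch_le L0 Ltheta).
- by case/andP: (hd k).
- exact: (collar_sub d0 UW).
- by case: (collar_shift UW l (hd k) Ux).
Qed.

Let mdq k l : measurable_fun U (dquot (- h k) l th).
Proof. exact: measurable_funTS (measurable_dquot _ _ mth). Qed.

Let inU (g : V -> R) : integ g -> mu.-integrable U (EFin \o g).
Proof. exact: (integ_subset mU measurableT (@subsetT _ U)). Qed.

Let mulq (g : V -> R) k l : integ g ->
  mu.-integrable U (EFin \o (fun x => g x * dquot (- h k) l th x)).
Proof.
move=> /inU gI; rewrite (_ : (fun x => _) = (fun x => dquot (- h k) l th x * g x)).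
  exact: (integMb mU (mdq k l) (@thL k l) gI).
by apply/funext => x; rewrite mulrC.
Qed.

Let dq_err l g : integ g -> (forall x, ~ W x -> g x = 0) -> weak_derivative W l f g ->
  \int[mu]_(x in U) `|dquot (h k) l f x - g x| @[k --> \oo] --> (0 : R).
Proof.
move=> gI g0 wg; apply/cvgrPdist_le => e e0.
have [r r0 Hr] := dquot_cvg oW bW oU fi gI g0 wg d0 UW e0.
move/cvgrPdist_lt : hcvg => /(_ _ r0); apply: filterS => k.
have hk0 : 0 < h k by case/andP: (hd k).
rewrite !sub0r !normrN (gtr0_norm hk0) => hr.
by rewrite ger0_norm ?Hr ?hk0//; apply: Rintegral_ge0.
Qed.

Let q k x := gi x * dquot (- h k) j th x - gj x * dquot (- h k) i th x.

Let qi k : mu.-integrable U (EFin \o q k).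
Proof. exact: (integB mU (mulq k j gii) (mulq k i gji)). Qed.

Lemma weak_cross_cvg0 phi : test_function U phi ->
  \int[mu]_(x in U) (phi x * q k x) @[k --> \oo] --> (0 : R).
Proof.
move=> tphi.
have mphi := test_function_measurable measurableT tphi.
have [C C0 HC] := test_function_bounded tphi.
have [Mi Mi0 HMi] := test_function_dquot_bounded i tphi.
have [Mj Mj0 HMj] := test_function_dquot_bounded j tphi.
have M0 : 0 <= Mi + Mj by rewrite addr_ge0.
have HM l s x : l = i \/ l = j -> `|dquot s l phi x| <= Mi + Mj.
  by case=> ->; [rewrite (le_trans (HMi _ _))// lerDl|rewrite (le_trans (HMj _ _))// lerDr].
have [B HB] := thb.
have cv := cross_dquot_profile_cvg0 oW bW L0 Ltheta d0 UW tphi M0 HM hd hcvg fi f0 fv.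
have ei := dq_err gii gi0 wgi; have ej := dq_err gji gj0 wgj.
pose r k x := (dquot (h k) i f x - gi x) * dquot (- h k) j th x -
              (dquot (h k) j f x - gj x) * dquot (- h k) i th x.
have dI l k : integ (dquot (h k) l f) by exact: integ_dquot.
have eiI k := integB measurableT (dI i k) gii.
have ejI k := integB measurableT (dI j k) gji.
have ri k : mu.-integrable U (EFin \o r k).
  exact: (integB mU (mulq k j (eiI k)) (mulq k i (ejI k))).
have phiM g : mu.-integrable U (EFin \o g) -> mu.-integrable U (EFin \o (fun x => phi x * g x)).
  by move=> gI; exact: (integMb mU (measurable_funTS mphi) (fun x _ => HC x) gI).
(* The weak derivatives are exchanged for the difference quotients of [f], to which summation by
   parts applies. The remainder [r] is small in L^1, because the quotients of [theta] are bounded by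
   [L] on [U] and those of [f] converge there in the mean. *)
have E k : \int[mu]_(x in U) (phi x * q k x) =
    - (\int[mu]_x (f x * cross_dquot (h k) i j phi th x)) - \int[mu]_(x in U) (phi x * r k x).
  rewrite -(Rintegral_cross_dquot i j fi mphi HC mth HB (h0 k)).
  rewrite -(@Rintegral_supp _ _ _ mu U); last first.
    by move=> x nU; rewrite (test_function0 tphi nU) mul0r.
  rewrite -RintegralB//; last 2 first.
  - apply: phiM; exact: (integB mU (mulq k j (dI i k)) (mulq k i (dI j k))).
  - exact: phiM.
  by apply: eq_Rintegral => x _; rewrite /q /r; ring.
have rb k : `|\int[mu]_(x in U) (phi x * r k x)| <=
    C * L * (\int[mu]_(x in U) `|dquot (h k) i f x - gi x| +
             \int[mu]_(x in U) `|dquot (h k) j f x - gj x|).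
  have ni := integ_norm (inU (eiI k)); have nj := integ_norm (inU (ejI k)).
  rewrite -RintegralD// -RintegralZl//; last exact: (integD mU ni nj).
  apply: (ler_norm_Rintegral mU (phiM _ (ri k)) (integZ mU _ (integD mU ni nj))) => x Ux.
  rewrite normrM -mulrA; apply: ler_pM => //; apply: le_trans (ler_normB _ _) _.
  by rewrite mulrDr; apply: lerD; rewrite normrM mulrC ler_wpM2r// thL.
have rc : \int[mu]_(x in U) (phi x * r k x) @[k --> \oo] --> (0 : R).
  have H : C * L * (\int[mu]_(x in U) `|dquot (h k) i f x - gi x| +
             \int[mu]_(x in U) `|dquot (h k) j f x - gj x|) @[k --> \oo] --> (0 : R).
    rewrite (_ : (0 : R) = C * L * (0 + 0)); last by rewrite addr0 mulr0.
    by apply: cvgM; [exact: cvg_cst|exact: cvgD].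
  apply/cvgrPdist_le => e e0; move/cvgrPdist_le : H => /(_ _ e0).
  apply: filterS => k; rewrite !sub0r !normrN => H.
  by apply: le_trans (rb k) _; apply: le_trans (ler_norm _) H.
have : - (\int[mu]_x (f x * cross_dquot (h k) i j phi th x)) -
    \int[mu]_(x in U) (phi x * r k x) @[k --> \oo] --> - (0 : R) - 0.
  by apply: cvgB => //; apply: cvgN.
rewrite subr0 oppr0; apply: cvg_trans; apply: near_eq_cvg; apply: nearW => k.
by rewrite E.
Qed.

Lemma weak_cross_ae : {ae mu, forall x, U x -> forall l, q k x @[k --> \oo] --> l -> l = 0}.
Proof.
apply: (@weak_cvg0_ae _ _ U oU bU q (fun x => L * (`|gi x| + `|gj x|))).
- move=> k; exact: integ_measurable (qi k).
- exact: (integZ mU L (integD mU (integ_norm (inU gii)) (integ_norm (inU gji)))).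
- move=> k x Ux; apply: le_trans (ler_normB _ _) _; rewrite mulrDr.
  by apply: lerD; rewrite normrM mulrC ler_wpM2r// thL.
- exact: weak_cross_cvg0.
Qed.

Lemma dquot_derive_cvg l x : U x -> derivable theta x 'e_l ->
  dquot (- h k) l th x @[k --> \oo] --> 'D_('e_l) theta x.
Proof.
move=> Ux dth.
have H : (fun s : R => s^-1 *: (theta (s *: 'e_l + x) - theta x)) @ 0^' --> 'D_('e_l) theta x.
  exact: dth.
have hN : (- h) k @[k --> \oo] --> 0.
  by rewrite -[X in _ --> X]oppr0; apply: cvgN.
have hN0 k : (- h) k != 0 by rewrite oppr_eq0.
move/cvgr_dnbhsP : H => /(_ (- h) (conj hN0 hN)); apply: cvg_trans.
apply: near_eq_cvg; apply: nearW => k /=.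
have [W1 _] := collar_shift UW l (hd k) Ux.
rewrite /dquot /th !patchE !mem_set//; first last.
- by rewrite scaleNr.
- exact: (collar_sub d0 UW).
  by rewrite [- _ *: _ + x]addrC [_ *: (_ - _)]mulrC.
Qed.

End sequence.

Lemma parallel_collar_ae : {ae mu, forall x, U x -> differentiable theta x ->
  gi x * 'D_('e_j) theta x = gj x * 'D_('e_i) theta x}.
Proof.
(* The index [k.+2] keeps the first step strictly below [d / 4]. *)
pose h (k : nat) : R := d / 4 * k.+2%:R^-1.
have d4 : 0 < d / 4 by rewrite divr_gt0.
have hd k : 0 < h k < d / 4.
  by rewrite mulr_gt0 ?invr_gt0//= gtr_pMr// invf_lt1// ltr1n.
have hcvg : h k @[k --> \oo] --> 0.
  rewrite -[X in _ --> X](mulr0 (d / 4)); apply: cvgM; first exact: cvg_cst.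
  by have := @cvg_harmonic R; rewrite -cvg_shiftS; exact.
apply: filterS (weak_cross_ae hd hcvg) => x H Ux dth.
apply/eqP; rewrite -subr_eq0; apply/eqP; apply: (H Ux).
have c l := dquot_derive_cvg hd hcvg Ux (diff_derivable (v := 'e_l) dth).
by apply: cvgB; apply: cvgM; [exact: cvg_cst|exact: c|exact: cvg_cst|exact: c].
Qed.

End collar_part.

Lemma parallel_weak_gradient : {ae mu, forall x, W x -> differentiable theta x ->
  gi x * 'D_('e_j) theta x = gj x * 'D_('e_i) theta x}.
Proof.
have [C [cC _ CW]] := open_compact_exhaustion oW.
have H k : {ae mu, forall x, C k x -> differentiable theta x ->
    gi x * 'D_('e_j) theta x = gj x * 'D_('e_i) theta x}.
  have CkW : C k `<=` W by rewrite -CW => x Cx; exists k.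
  have [U [d [oU KU d0 UW]]] := compact_collar (cC k) oW CkW.
  by apply: filterS (parallel_collar_ae oU d0 UW) => x h /KU; exact: h.
have /ae_foralln := H; apply: filterS => x h; rewrite -CW => -[k _ Ck].
exact: (h k Ck).
Qed.

End parallel_weak.

(** * Sobolev functions and capacity *)

Section L2.
Context {R : realType} {n : nat}.
Local Notation V := 'rV[R]_n.
Local Notation mu := (@lebesgue_rV R n).
Implicit Types (u w : V -> R).
Variable D : set V.
Hypothesis mD : measurable D.
Local Notation integ f := (mu.-integrable D (EFin \o f)).

Lemma measurable_sqr u : measurable_fun D u -> measurable_fun D (fun x => u x ^+ 2).
Proof. by move=> mu'; exact: (measurable_funM mu' mu'). Qed.

Lemma L2_sqr_integrable u : L2 D u -> integ (fun x => u x ^+ 2).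
Proof.
move=> [mu' fu]; apply/integrableP; split.
  by apply/measurable_EFinP; exact: measurable_sqr.
by under eq_integral do rewrite gee0_abs ?lee_fin ?sqr_ge0//.
Qed.

Lemma L2I u : measurable_fun D u -> integ (fun x => u x ^+ 2) -> L2 D u.
Proof.
move=> mu' /integrableP[_ h]; split => //; apply: le_lt_trans h.
by under [leRHS]eq_integral do rewrite gee0_abs ?lee_fin ?sqr_ge0//.
Qed.

Lemma L2M u w : L2 D u -> L2 D w -> integ (fun x => u x * w x).
Proof.
move=> Lu Lw; have [mu' _] := Lu; have [mw _] := Lw.
apply: (integ_le mD (measurable_funM mu' mw) _
  (integD mD (L2_sqr_integrable Lu) (L2_sqr_integrable Lw))) => x _.
have h1 := sqr_ge0 (u x + w x); have h2 := sqr_ge0 (u x - w x).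
have h3 := sqr_ge0 (u x); have h4 := sqr_ge0 (w x).
rewrite sqrrD in h1; rewrite sqrrB in h2.
by rewrite /= ler_norml; apply/andP; split; lra.
Qed.

Lemma L2_lin a b u w : L2 D u -> L2 D w -> L2 D (fun x => a * u x + b * w x).
Proof.
move=> Lu Lw; have [mu' _] := Lu; have [mw _] := Lw.
have mc (c : R) (v : V -> R) : measurable_fun D v -> measurable_fun D (fun x => c * v x).
  by move=> mv; exact: (measurable_funM (measurable_cst _) mv).
apply: L2I; first exact: (measurable_funD (mc a _ mu') (mc b _ mw)).
have i1 := integZ mD (a ^+ 2) (L2_sqr_integrable Lu).
have i2 := integZ mD (2 * (a * b)) (L2M Lu Lw).
have i3 := integZ mD (b ^+ 2) (L2_sqr_integrable Lw).
have := integD mD (integD mD i1 i2) i3; congr (integrable _ _ _).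
by apply/funext => x /=; congr EFin; ring.
Qed.

Lemma L2_le u w : measurable_fun D u -> (forall x, D x -> `|u x| <= `|w x|) ->
  L2 D w -> L2 D u.
Proof.
move=> mu' uw Lw; apply: (L2I mu').
apply: (integ_le mD (measurable_sqr mu') _ (L2_sqr_integrable Lw)) => x Dx.
by rewrite ger0_norm ?sqr_ge0// -[leLHS]real_normK ?num_real// -[leRHS]real_normK ?num_real// lerXn2r ?nnegrE// uw.
Qed.

Lemma L2_norm u : L2 D u -> L2 D (fun x => `|u x|).
Proof.
move=> Lu; apply: L2_le (Lu); first by case: Lu => mu' _; exact: measurable_norm.
by move=> x _; rewrite normr_id.
Qed.

Lemma L2_bounded u M : (mu D < +oo)%E -> measurable_fun D u ->
  (forall x, D x -> `|u x| <= M) -> L2 D u.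
Proof.
move=> fD mu' uM; apply: (L2I mu').
apply: (@integ_bounded _ _ _ mu D mD _ (M ^+ 2) fD (measurable_sqr mu')) => x Dx.
have M0 : 0 <= M by exact: le_trans (uM x Dx).
by rewrite normrX; apply: lerXn2r; rewrite ?nnegrE//; exact: uM.
Qed.

Lemma L2_integrable u : (mu D < +oo)%E -> L2 D u -> integ u.
Proof.
move=> fD Lu; have L1 : L2 D (cst 1).
  by apply: (@L2_bounded _ 1 fD (measurable_cst _)) => x _; rewrite normr1.
have := L2M Lu L1; congr (integrable _ _ _).
by apply/funext => x /=; rewrite mulr1.
Qed.

End L2.

Lemma L2S (R : realType) (n : nat) (D E : set 'rV[R]_n) u : measurable D -> measurable E ->
  D `<=` E -> L2 E u -> L2 D u.
Proof.
move=> mD mE DE Lu; have [mu' _] := Lu.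
apply: (L2I (measurable_funS mE DE mu')).
exact: (integ_subset mD mE DE (L2_sqr_integrable Lu)).
Qed.

Lemma bounded_ball0 (R : realType) (n : nat) (r : R) : bounded_set (ball (0 : 'rV[R]_n) r).
Proof.
exists r; split; first exact: num_real.
by move=> s rs x /=; rewrite mx_norm_ball /ball_/= sub0r normrN => /ltW/le_trans; apply; exact: ltW.
Qed.

Section weak_gradient.
Context {R : realType} {n : nat}.
Local Notation V := 'rV[R]_n.
Local Notation mu := (@lebesgue_rV R n).
Local Notation integ f := (mu.-integrable setT (EFin \o f)).
Variable Omega : set V.
Hypothesis oO : open Omega.
Implicit Types (u w phi : V -> R) (g : V -> V).

Let mO : measurable Omega. Proof. exact: open_measurable_rV. Qed.

(** The capacity involves Sobolev functions on the whole space, where L^2 does not give L^1. Each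
    test function is moved into a bounded open set, on which the integrable theory is available. *)
Lemma test_function_bounded_supp phi : test_function Omega phi ->
  exists W, [/\ open W, bounded_set W, W `<=` Omega & test_function W phi].
Proof.
move=> [sphi cK KO]; have [M [_ HM]] := compact_bounded cK.
exists (Omega `&` ball (0 : V) (`|M| + 2)); split.
- by apply: openI => //; exact: ball_open.
- apply: bounded_setS (@bounded_ball0 _ _ (`|M| + 2)); exact: subIsetr.
- exact: subIsetl.
- split => // x Kx; split; first exact: KO.
  rewrite mx_norm_ball /ball_/= sub0r normrN.
  apply: (@le_lt_trans _ _ (`|M| + 1)); last by rewrite ltrD2l ltr1n.
  by apply: HM => //; rewrite ltr_pwDr// ler_norm.
Qed.

Lemma test_function_L2 phi : test_function Omega phi -> L2 Omega phi.
Proof.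
move=> tphi; have [M M0 HM] := test_function_bounded tphi.
have [W [oW bW WO tW]] := test_function_bounded_supp tphi.
have mphi := test_function_measurable measurableT tphi.
apply: (L2I (measurable_funTS mphi)).
have := test_function_integrable oW bW tW; move=> pI.
have := integMb measurableT mphi (fun x _ => HM x) pI.
exact: (integ_subset mO measurableT (@subsetT _ Omega)).
Qed.

Lemma weak_derivative_supp (f : V -> R) phi : test_function Omega phi ->
  \int[mu]_(x in Omega) (f x * phi x) = \int[mu]_x (f x * phi x).
Proof.
by move=> tphi; apply: Rintegral_supp => x nO; rewrite (test_function0 tphi nO) mulr0.
Qed.

(** The definition compares extended real integrals. For L^2 functions both sides are finite, and
    the identity can be read in [R] over the whole space, since test functions vanish outside
    [Omega]. *)
Lemma is_L2_weak_gradientP u g : L2 Omega u -> is_L2_weak_gradient Omega u g <->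
  (forall i, L2 Omega (fun x => g x ord0 i)) /\
  (forall i, weak_derivative Omega i u (fun x => g x ord0 i)).
Proof.
move=> Lu.
have H i phi : L2 Omega (fun x => g x ord0 i) -> test_function Omega phi ->
    (\int[mu]_(x in Omega) (u x * 'D_('e_i) phi x)%:E =
     - \int[mu]_(x in Omega) (g x ord0 i * phi x)%:E)%E <->
    \int[mu]_x (u x * 'D_('e_i) phi x) = - \int[mu]_x (g x ord0 i * phi x).
  move=> Lg tphi; have tD := test_function_derive i tphi.
  have i1 := L2M mO Lu (test_function_L2 tD).
  have i2 := L2M mO Lg (test_function_L2 tphi).
  rewrite -!weak_derivative_supp// /Rintegral.
  have f1 := integrable_fin_num mO i1; have f2 := integrable_fin_num mO i2.
  have -> : (\int[mu]_(x in Omega) (u x * 'D_('e_i) phi x)%:E =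
    (fine (\int[mu]_(x in Omega) (u x * 'D_('e_i) phi x)%:E))%:E)%E by rewrite fineK.
  have -> : (\int[mu]_(x in Omega) (g x ord0 i * phi x)%:E =
    (fine (\int[mu]_(x in Omega) (g x ord0 i * phi x)%:E))%:E)%E by rewrite fineK.
  by rewrite -EFinN; split => [[]//|/= ->].
split => -[Lg Hg]; split => // i phi tphi; by apply/H => //; exact: Hg.
Qed.

Lemma weak_derivative_lin a b i u w gu gw : L2 Omega u -> L2 Omega w ->
  L2 Omega gu -> L2 Omega gw ->
  weak_derivative Omega i u gu -> weak_derivative Omega i w gw ->
  weak_derivative Omega i (fun x => a * u x + b * w x) (fun x => a * gu x + b * gw x).
Proof.
move=> Lu Lw Lgu Lgw Hu Hw phi tphi; have tD := test_function_derive i tphi.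
have E f f' psi : L2 Omega f -> L2 Omega f' -> test_function Omega psi ->
    \int[mu]_x ((a * f x + b * f' x) * psi x) =
    a * (\int[mu]_x (f x * psi x)) + b * (\int[mu]_x (f' x * psi x)).
  move=> Lf Lf' tpsi; rewrite -!weak_derivative_supp//.
  have i1 := L2M mO Lf (test_function_L2 tpsi).
  have i2 := L2M mO Lf' (test_function_L2 tpsi).
  rewrite -!RintegralZl// -RintegralD//; last 2 first.
  - exact: (integZ mO a i1).
  - exact: (integZ mO b i2).
  by apply: eq_Rintegral => x _; ring.
by rewrite !E// Hu// Hw//; ring.
Qed.

Lemma weak_derivative_abs_L2 i u (g : V -> R) : L2 Omega u -> L2 Omega g ->
  weak_derivative Omega i u g ->
  weak_derivative Omega i (fun x => `|u x|) (abs_derivative u g).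
Proof.
move=> Lu Lg Hu phi tphi.
have [W [oW bW WO tW]] := test_function_bounded_supp tphi.
have mW := open_measurable_rV oW; have fW := bounded_lebesgue_fin bW.
have I f : L2 Omega f -> integ (f \_ W).
  move=> Lf; apply: (proj1 (integ_patch mu f mW)).
  exact: (L2_integrable mW fW (L2S mW mO WO Lf)).
have Hp : weak_derivative W i (u \_ W) (g \_ W).
  move=> psi tpsi; have := Hu psi (test_functionS WO tpsi).
  have tD := test_function_derive i tpsi.
  have P f chi : test_function W chi ->
      \int[mu]_x (f x * chi x) = \int[mu]_x ((f \_ W) x * chi x).
    move=> tchi; apply: eq_Rintegral => x _.
    have [Wx|nW] := pselect (W x); first by rewrite patchE mem_set.
    by rewrite (test_function0 tchi nW) !mulr0.
  by rewrite (P u _ tD) (P g _ tpsi).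
have g0 x : ~ W x -> (g \_ W) x = 0 by move=> nW; rewrite patchE memNset.
have := weak_derivative_abs oW bW (I _ Lu) (I _ Lg) g0 Hp tW.
have tD := test_function_derive i tW.
have P f f' chi : test_function W chi -> (forall x, W x -> f x = f' x) ->
    \int[mu]_x (f x * chi x) = \int[mu]_x (f' x * chi x).
  move=> tchi ff'; apply: eq_Rintegral => x _.
  have [Wx|nW] := pselect (W x); first by rewrite ff'.
  by rewrite (test_function0 tchi nW) !mulr0.
rewrite (P _ (fun x => `|u x|) _ tD); last by move=> x Wx; rewrite patchE mem_set.
rewrite (P _ (abs_derivative u g) _ tW)//.
by move=> x Wx; rewrite /abs_derivative !patchE mem_set.
Qed.

Lemma L2_abs_derivative u (g : V -> R) : L2 Omega u -> L2 Omega g -> L2 Omega (abs_derivative u g).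
Proof.
move=> [mu' _] Lg; have [mg _] := Lg; apply: L2_le (Lg) => //; last first.
  by move=> x _; rewrite norm_abs_derivative.
have := measurable_abs_derivative
  ((measurable_restrictT _ mO).1 mu') ((measurable_restrictT _ mO).1 mg).
move=> /(measurable_funTS (D := Omega)); apply: eq_measurable_fun => x.
by rewrite inE => Ox; rewrite /abs_derivative !patchE mem_set.
Qed.

(** On each bounded piece [W k] the difference of the two derivatives is orthogonal to all test
    functions, so duality bounds its L^1 norm by 0; countably many pieces cover [Omega]. *)
Lemma weak_derivative_uniq i u (g g' : V -> R) : L2 Omega g -> L2 Omega g' ->
  weak_derivative Omega i u g -> weak_derivative Omega i u g' ->
  {ae mu, forall x, Omega x -> g x = g' x}.
Proof.
move=> Lg Lg' Hg Hg'.
pose W k := Omega `&` ball (0 : V) k.+1%:R.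
have H k : {ae mu, forall x, W k x -> g x = g' x}.
  have oW : open (W k) by apply: openI => //; exact: ball_open.
  have bW : bounded_set (W k).
    by apply: bounded_setS (@bounded_ball0 _ _ k.+1%:R); exact: subIsetr.
  have mW := open_measurable_rV oW; have fW := bounded_lebesgue_fin bW.
  have WO : W k `<=` Omega by exact: subIsetl.
  have I f : L2 Omega f -> mu.-integrable (W k) (EFin \o f).
    by move=> Lf; exact: (L2_integrable mW fW (L2S mW mO WO Lf)).
  have qi := integB mW (I _ Lg) (I _ Lg').
  have : \int[mu]_(x in W k) `|g x - g' x| <= 0.
    apply: (Rintegral_norm_le_test oW bW qi) => phi tphi _.
    have tO := test_functionS WO tphi.
    have i1 := L2M mO Lg (test_function_L2 tO).
    have i2 := L2M mO Lg' (test_function_L2 tO).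
    rewrite (@Rintegral_supp _ _ _ mu (W k)); last first.
      by move=> x nW; rewrite (test_function0 tphi nW) mul0r.
    rewrite -(@Rintegral_supp _ _ _ mu Omega); last first.
      by move=> x nW; rewrite (test_function0 tO nW) mul0r.
    under eq_Rintegral do rewrite mulrC mulrBl.
    rewrite RintegralB// !weak_derivative_supp//.
    have := Hg _ tO; rewrite (Hg' _ tO) => /oppr_inj ->.
    by rewrite subrr normr0.
  have nI := integ_norm qi.
  rewrite /Rintegral => le0.
  have i0 : (\int[mu]_(x in W k) `|(g x - g' x)%:E| = 0)%E.
    have fi := integrable_fin_num mW nI.
    rewrite -[LHS](@fineK _ (\int[mu]_(x in W k) (`|g x - g' x|)%:E)%E)//.
    congr EFin; apply: le_anti; rewrite le0/=.
    by apply: fine_ge0; apply: integral_ge0.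
  have mq : measurable_fun (W k) (fun x => (g x - g' x)%:E).
    by apply/measurable_EFinP; exact: integ_measurable qi.
  have /(ae_eq_integral_abs mu mW mq) := i0.
  apply: filterS => x h /h/= [] /eqP; by rewrite subr_eq0 => /eqP.
have /ae_foralln := H; apply: filterS => x h Ox.
apply: (h (Num.truncn `|x|)); split => //.
by rewrite mx_norm_ball /ball_/= sub0r normrN truncnS_gt.
Qed.

End weak_gradient.

Section dot.
Context {R : realType} {n : nat}.
Local Notation V := 'rV[R]_n.
Implicit Types (x y : V).

Lemma dotv_ge0 x : 0 <= dotv x x.
Proof. by apply: sumr_ge0 => i _; rewrite -expr2 sqr_ge0. Qed.

Lemma enorm_sqr x : enorm x ^+ 2 = dotv x x.
Proof. by rewrite sqr_sqrtr// dotv_ge0. Qed.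

Lemma dotvC x y : dotv x y = dotv y x.
Proof. by apply: eq_bigr => i _; rewrite mulrC. Qed.

Lemma dotvDl x y z : dotv (x + y) z = dotv x z + dotv y z.
Proof. by rewrite /dotv -big_split/=; apply: eq_bigr => i _; rewrite mxE mulrDl. Qed.

Lemma dotvZl a x y : dotv (a *: x) y = a * dotv x y.
Proof. by rewrite /dotv mulr_sumr; apply: eq_bigr => i _; rewrite mxE mulrA. Qed.

Lemma dotv_lin a b x y : dotv (a *: x + b *: y) (a *: x + b *: y) =
  a ^+ 2 * dotv x x + 2 * (a * b) * dotv x y + b ^+ 2 * dotv y y.
Proof.
rewrite !(dotvDl, dotvZl) ![dotv _ (_ + _)]dotvC !(dotvDl, dotvZl) [dotv y x]dotvC.
by ring.
Qed.

Lemma dotvB x y : dotv (x - y) (x - y) = dotv x x - 2 * dotv x y + dotv y y.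
Proof.
have := dotv_lin 1 (-1) x y; rewrite scale1r scaleN1r => ->; by ring.
Qed.

Lemma dotv_le x y : (forall i, `|x ord0 i| <= `|y ord0 i|) -> dotv x x <= dotv y y.
Proof.
move=> xy; apply: ler_sum => i _; rewrite -!expr2 -[leLHS]real_normK ?num_real//.
by rewrite -[leRHS]real_normK ?num_real// lerXn2r ?nnegrE.
Qed.

End dot.

Lemma ae_forall_ord d (T : measurableType d) (R : realType) (mu : {measure set T -> \bar R})
  n (P : 'I_n -> T -> Prop) :
  (forall i, {ae mu, forall x, P i x}) -> {ae mu, forall x, forall i, P i x}.
Proof.
move=> HP.
have H k : {ae mu, forall x, forall i : 'I_n, val i = k -> P i x}.
  have [kn|kn] := ltnP k n; last first.
    by apply: aeW => x i ik; move: kn; rewrite -ik leqNgt ltn_ord.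
  apply: filterS (HP (Ordinal kn)) => x Px i ik.
  by rewrite (_ : i = Ordinal kn)//; apply: val_inj.
by have /ae_foralln := H; apply: filterS => x h i; exact: (h (val i)).
Qed.

Section sobolev_space.
Context {R : realType} {n : nat}.
Local Notation V := 'rV[R]_n.
Local Notation mu := (@lebesgue_rV R n).
Variable Omega : set V.
Hypothesis oO : open Omega.
Implicit Types (u w : V -> R) (g h : V -> V).
Local Notation integ f := (mu.-integrable Omega (EFin \o f)).

Let mO : measurable Omega. Proof. exact: open_measurable_rV. Qed.

Definition L2v g := forall i, L2 Omega (fun x => g x ord0 i).

Lemma L2v_lin a b g h : L2v g -> L2v h -> L2v (fun x => a *: g x + b *: h x).
Proof.
move=> Lg Lh i; rewrite (_ : (fun x => _) = (fun x => a * g x ord0 i + b * h x ord0 i)).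
  exact: L2_lin.
by apply/funext => x; rewrite !mxE.
Qed.

Lemma integrable_dotv g h : L2v g -> L2v h -> integ (fun x => dotv (g x) (h x)).
Proof.
move=> Lg Lh.
have H (s : seq 'I_n) : integ (fun x => \sum_(i <- s) g x ord0 i * h x ord0 i).
  elim: s => [|i s IH].
    by rewrite (_ : (fun x => _) = cst 0); [exact: integ0|apply/funext => x; rewrite big_nil].
  rewrite (_ : (fun x => _) =
      (fun x => g x ord0 i * h x ord0 i + \sum_(i <- s) g x ord0 i * h x ord0 i)).
    exact: (integD mO (L2M mO (Lg i) (Lh i)) IH).
  by apply/funext => x; rewrite big_cons.
have := H (index_enum 'I_n); congr (integrable _ _ _).
Qed.

Lemma wgradP u : W12 Omega u -> is_L2_weak_gradient Omega u (wgrad Omega u).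
Proof. by move=> [_ Hg]; exact: getPex. Qed.

Lemma W12_L2v u : W12 Omega u -> L2v (wgrad Omega u).
Proof. by move=> /wgradP[]. Qed.

Lemma wgrad_ae u g : W12 Omega u -> is_L2_weak_gradient Omega u g ->
  {ae mu, forall x, Omega x -> wgrad Omega u x = g x}.
Proof.
move=> Wu Hg; have Lu : L2 Omega u by case: Wu.
have [L1 W1] := (is_L2_weak_gradientP oO _ Lu).1 (wgradP Wu).
have [L2' W2] := (is_L2_weak_gradientP oO _ Lu).1 Hg.
have := ae_forall_ord (fun i => weak_derivative_uniq oO (L1 i) (L2' i) (W1 i) (W2 i)).
apply: filterS => x H Ox; apply/rowP => i; exact: H.
Qed.

Lemma integral_EFin_Rintegral (f : V -> R) : integ f ->
  (\int[mu]_(x in Omega) (f x)%:E = (\int[mu]_(x in Omega) f x)%:E)%E.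
Proof. by move=> fi; rewrite fineK//; exact: integrable_fin_num. Qed.

Lemma dirichlet_energyE u g : W12 Omega u -> is_L2_weak_gradient Omega u g ->
  dirichlet_energy Omega u = (\int[mu]_(x in Omega) dotv (g x) (g x))%:E.
Proof.
move=> Wu Hg; have Lg : L2v g by case: Hg.
have Lw := W12_L2v Wu.
have i1 := integrable_dotv Lw Lw; have i2 := integrable_dotv Lg Lg.
rewrite -integral_EFin_Rintegral// /dirichlet_energy.
under eq_integral do rewrite enorm_sqr.
apply: (ge0_ae_eq_integral mO (measurable_int _ i1) (measurable_int _ i2)).
- by move=> x _; rewrite lee_fin dotv_ge0.
- by move=> x _; rewrite lee_fin dotv_ge0.
- by apply: filterS (wgrad_ae Wu Hg) => x H /H /= ->.
Qed.

Lemma is_L2_weak_gradient_lin a b u w g h : L2 Omega u -> L2 Omega w ->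
  is_L2_weak_gradient Omega u g -> is_L2_weak_gradient Omega w h ->
  is_L2_weak_gradient Omega (fun x => a * u x + b * w x) (fun x => a *: g x + b *: h x).
Proof.
move=> Lu Lw /(is_L2_weak_gradientP oO _ Lu)[Lg Hg] /(is_L2_weak_gradientP oO _ Lw)[Lh Hh].
apply/(is_L2_weak_gradientP oO); first exact: L2_lin.
split; first exact: L2v_lin.
move=> i; rewrite [X in weak_derivative _ _ _ X](_ : _ = (fun x => a * g x ord0 i + b * h x ord0 i)).
  by apply: (weak_derivative_lin oO _ _ Lu Lw (Lg i) (Lh i) (Hg i) (Hh i)).
by apply/funext => x; rewrite !mxE.
Qed.

Lemma is_L2_weak_gradient_abs u g : L2 Omega u -> is_L2_weak_gradient Omega u g ->
  is_L2_weak_gradient Omega (fun x => `|u x|)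
    (fun x => \row_i abs_derivative u (fun y => g y ord0 i) x).
Proof.
move=> Lu /(is_L2_weak_gradientP oO _ Lu)[Lg Hg].
have E i : (fun x => (\row_i0 abs_derivative u (fun y => g y ord0 i0) x : V) ord0 i) =
    abs_derivative u (fun y => g y ord0 i).
  by apply/funext => x; rewrite mxE.
apply/(is_L2_weak_gradientP oO); first exact: L2_norm.
split => i; rewrite E; first exact: L2_abs_derivative.
exact: weak_derivative_abs_L2.
Qed.

Lemma dotv_abs_derivative u g x : dotv (\row_i abs_derivative u (fun y => g y ord0 i) x : V)
  (\row_i abs_derivative u (fun y => g y ord0 i) x) = dotv (g x) (g x).
Proof.
by apply/le_anti/andP; split; apply: dotv_le => i; rewrite mxE norm_abs_derivative.
Qed.

Lemma W12_lin a b u w : W12 Omega u -> W12 Omega w ->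
  W12 Omega (fun x => a * u x + b * w x).
Proof.
move=> [Lu [g Hg]] [Lw [h Hh]]; split; first exact: L2_lin.
by exists (fun x => a *: g x + b *: h x); exact: is_L2_weak_gradient_lin.
Qed.

Lemma W12_abs u : W12 Omega u -> W12 Omega (fun x => `|u x|).
Proof.
move=> [Lu [g Hg]]; split; first exact: L2_norm.
by eexists; exact: is_L2_weak_gradient_abs Hg.
Qed.

Hypothesis bO : bounded_set Omega.

(** The constant is represented by the indicator of [Omega], which is integrable. Its difference
    quotients vanish near the support of [phi], and their integrals against [phi] converge to minus
    the integral of the derivative of [phi], which is therefore zero. *)
Lemma weak_derivative_cst i : weak_derivative Omega i (cst 1) (cst 0).
Proof.
move=> phi tphi; have [_ cK KO] := tphi.
have [U [d [oU KU d0 UO]]] := compact_collar cK oO KO.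
have tU : test_function U phi by case: tphi.
have i1 : mu.-integrable setT (EFin \o (\1_Omega : V -> R)).
  exact: (indic_sub_integrable oO bO mO).
pose h (k : nat) : R := d * k.+2%:R^-1.
have h0 k : 0 < h k by rewrite mulr_gt0 ?invr_gt0.
have hd k : `|h k| < d by rewrite gtr0_norm// gtr_pMr// invf_lt1// ltr1n.
have hn k : h k != 0 by rewrite gt_eqF.
have hcvg : h k @[k --> \oo] --> 0.
  rewrite -[X in _ --> X](mulr0 d); apply: cvgM; first exact: cvg_cst.
  by have := @cvg_harmonic R; rewrite -cvg_shiftS; exact.
have H := Rintegral_dquot_cvg (i:=i) i1 UO tU hn hd hcvg.
have Z : \int[mu]_x (dquot (h k) i (\1_Omega : V -> R) x * phi x) @[k --> \oo] --> (0 : R).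
  rewrite (_ : (fun k => _) = cst (0 : R)); first exact: cvg_cst.
  apply/funext => k /=.
  transitivity (\int[mu]_x (0 : R)); last by rewrite Rintegral_cst// mul0r.
  apply: eq_Rintegral => x _; have [Ux|nU] := pselect (U x); last first.
    by rewrite (test_function0 tU nU) mulr0.
  rewrite /dquot !indicE !mem_set ?subrr ?mul0r//; first exact: (collar_sub d0 UO).
  by apply: UO => //; apply: le_lt_trans (norm_scale_delta _ _) _.
have E : - (\int[mu]_x (\1_Omega x * 'D_('e_i) phi x)) = 0.
  exact: (cvg_unique (@Rhausdorff R) H Z).
have -> : \int[mu]_x (cst 0 x * phi x) = (0 : R).
  transitivity (\int[mu]_x (0 : R)); last by rewrite Rintegral_cst// mul0r.
  by apply: eq_Rintegral => x _; rewrite mul0r.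
move/eqP : E; rewrite oppr_eq0 oppr0 => /eqP <-; apply: eq_Rintegral => x _.
have [Ox|nO] := pselect (Omega x); first by rewrite indicE mem_set.
by rewrite (test_function0 (test_function_derive i tphi) nO) !mulr0.
Qed.

Lemma is_L2_weak_gradient_cst : L2 Omega (cst 1) /\
  is_L2_weak_gradient Omega (cst 1) (cst 0).
Proof.
have fO := bounded_lebesgue_fin bO.
have L c : L2 Omega (cst c).
  by apply: (@L2_bounded _ _ _ mO _ `|c| fO (measurable_cst _)).
have E i : (fun x : V => (cst 0 x : V) ord0 i) = cst 0 by apply/funext => x; rewrite mxE.
split; first exact: L.
apply/(is_L2_weak_gradientP oO); first exact: L.
by split => i; rewrite E; [exact: L|exact: weak_derivative_cst].
Qed.

(* [min (max t 0) 1], in terms of absolute values, whose weak derivative is known. *)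
Definition clamp (t : R) : R := 2^-1 * (`|t| - `|t - 1|) + 2^-1.

Lemma clamp_le0 t : t <= 0 -> clamp t = 0.
Proof. by move=> t0; rewrite /clamp !ler0_norm//; lra. Qed.

Lemma clamp_ge1 t : 1 <= t -> clamp t = 1.
Proof. by move=> t0; rewrite /clamp !ger0_norm//; lra. Qed.

Lemma continuous_clamp : continuous clamp.
Proof.
move=> t; apply: cvgD; last exact: cvg_cst.
apply: cvgM; first exact: cvg_cst.
apply: cvgB; first exact: norm_continuous.
by apply: cvg_norm; apply: cvgB; [exact: cvg_id|exact: cvg_cst].
Qed.

(** The gradients of [|u|] and of [|u - 1|] have components of the same size as those of [u], so
    half of their difference is no larger. No discussion of the level sets of [u] is needed. *)
Lemma clamp_energy u : W12 Omega u -> W12 Omega (clamp \o u) /\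
  (dirichlet_energy Omega (clamp \o u) <= dirichlet_energy Omega u)%E.
Proof.
move=> Wu; have [Lu _] := Wu; have Hg := wgradP Wu; set g := wgrad Omega u in Hg.
have [L1 H1] := is_L2_weak_gradient_cst.
have Hu1 := is_L2_weak_gradient_lin 1 (-1) Lu L1 Hg H1.
have Lu1 := L2_lin mO 1 (-1) Lu L1.
have Ha := is_L2_weak_gradient_abs Lu Hg; have La := L2_norm mO Lu.
have Hb := is_L2_weak_gradient_abs Lu1 Hu1; have Lb := L2_norm mO Lu1.
have Hab := is_L2_weak_gradient_lin 1 (-1) La Lb Ha Hb.
have Lab := L2_lin mO 1 (-1) La Lb.
have Hc := is_L2_weak_gradient_lin 2^-1 2^-1 Lab L1 Hab H1.
have Lc := L2_lin mO 2^-1 2^-1 Lab L1.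
set c := (X in L2 Omega X) in Lc; set gc := (X in is_L2_weak_gradient _ _ X) in Hc.
have cE : clamp \o u = c.
  by apply/funext => x; rewrite /c /clamp/= !mul1r mulN1r !mulr1.
have Wc : W12 Omega (clamp \o u) by rewrite cE; split; [exact: Lc|exists gc; exact: Hc].
split; first exact: Wc.
have {}Hc : is_L2_weak_gradient Omega (clamp \o u) gc by rewrite cE; exact: Hc.
rewrite (dirichlet_energyE Wc Hc) (dirichlet_energyE Wu Hg) lee_fin.
have Lgc : L2v gc by case: Hc. have Lg : L2v g by case: Hg.
apply: le_Rintegral => //; [exact: integrable_dotv|exact: integrable_dotv|].
move=> x _; apply: dotv_le => i.
pose a := abs_derivative u (fun y => g y ord0 i) x.
pose b := abs_derivative (fun y => 1 * u y + -1 * cst 1 y)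
  (fun y => (1 *: g y + -1 *: cst 0 y : V) ord0 i) x.
have -> : gc x ord0 i = 2^-1 * (a - b).
  by rewrite /gc /a /b /= !mxE mulr0 addr0 mul1r !mulN1r.
have na : `|a| = `|g x ord0 i| by exact: norm_abs_derivative.
have nb : `|b| = `|g x ord0 i|.
  by rewrite norm_abs_derivative /= !mxE mulr0 addr0 mul1r.
rewrite normrM ger0_norm ?invr_ge0// ler_pdivrMl//.
by apply: le_trans (ler_normB _ _) _; rewrite na nb mulr_natl mulr2n.
Qed.

End sobolev_space.

(** * Sobolev capacity, quasi-everywhere conditions and the affine class *)

Section capacity.
Context {R : realType} {n : nat}.
Local Notation V := 'rV[R]_n.
Local Notation mu := (@lebesgue_rV R n).
Implicit Types (A B G E F Omega : set V) (u w : V -> R) (P Q : V -> Prop).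

Lemma sobolev_cap_ge0 A : (0 <= sobolev_cap A)%E.
Proof.
apply: le_ereal_inf_tmp => _ [u _ <-]; apply: integral_ge0 => x _.
by rewrite lee_fin addr_ge0 ?sqr_ge0.
Qed.

Lemma le_sobolev_cap A B : A `<=` B -> (sobolev_cap A <= sobolev_cap B)%E.
Proof.
move=> AB; apply: ereal_inf_le_tmp => _ [u [Wu [G [oG BG Gu]]] <-].
by exists u => //; split => //; exists G; split => //; exact: subset_trans BG.
Qed.

Let oT : open [set: V]. Proof. exact: openT. Qed.
Let mT : measurable [set: V]. Proof. exact: measurableT. Qed.
Let energy u := \int[mu]_x (u x ^+ 2 + dotv (wgrad setT u x) (wgrad setT u x)).

Let energy_integrable u : W12 setT u -> mu.-integrable setT
  (EFin \o (fun x => u x ^+ 2 + dotv (wgrad setT u x) (wgrad setT u x))).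
Proof.
move=> Wu; have [Lu _] := Wu; have Lg := W12_L2v Wu.
exact: (integD mT (L2_sqr_integrable Lu) (integrable_dotv oT Lg Lg)).
Qed.

Let energyE u : W12 setT u ->
  (\int[mu]_x (u x ^+ 2 + enorm (wgrad setT u x) ^+ 2)%:E = (energy u)%:E)%E.
Proof.
move=> Wu; under eq_integral do rewrite enorm_sqr.
exact: (integral_EFin_Rintegral oT (energy_integrable Wu)).
Qed.

(** The sum [|u| + |w|] serves as competitor for a union: absolute values prevent cancellation where
    only one function is known to be at least 1. The factor 2 comes from the parallelogram
    inequality, applied to the values and to the gradients. *)
Let energy_abs_add u w : W12 setT u -> W12 setT w ->
  (energy (fun x => 1 * `|u x| + 1 * `|w x|) <= 2 * (energy u + energy w))%R.
Proof.
move=> Wu Ww; have [Lu _] := Wu; have [Lw _] := Ww.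
have Hu := is_L2_weak_gradient_abs oT Lu (wgradP Wu).
have Hw := is_L2_weak_gradient_abs oT Lw (wgradP Ww).
have Hz := is_L2_weak_gradient_lin oT 1 1 (L2_norm mT Lu) (L2_norm mT Lw) Hu Hw.
have Wz := W12_lin oT 1 1 (W12_abs oT Wu) (W12_abs oT Ww).
have iz := energy_integrable Wz; have iu := energy_integrable Wu.
have iw := energy_integrable Ww; have iuw := integZ mT 2 (integD mT iu iw).
have -> : 2 * (energy u + energy w) = \int[mu]_x (2 *
    ((u x ^+ 2 + dotv (wgrad setT u x) (wgrad setT u x)) +
     (w x ^+ 2 + dotv (wgrad setT w x) (wgrad setT w x)))).
  by rewrite /energy -(RintegralD mT iu iw) -(RintegralZl _ mT (integD mT iu iw)).
rewrite -lee_fin -(integral_EFin_Rintegral oT iz) -(integral_EFin_Rintegral oT iuw).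
apply: (ae_ge0_le_integral mT _ (measurable_int _ iz) _ (measurable_int _ iuw)).
- by move=> x _; rewrite lee_fin addr_ge0 ?sqr_ge0 ?dotv_ge0.
- by move=> x _; rewrite lee_fin mulr_ge0// !addr_ge0 ?sqr_ge0 ?dotv_ge0.
apply: filterS (wgrad_ae oT Wz Hz) => x /(_ I) H _; rewrite lee_fin H.
set a := (\row_i _ : V); set b := (\row_i _ : V).
have ea : dotv a a = dotv (wgrad setT u x) (wgrad setT u x) := dotv_abs_derivative u _ x.
have eb : dotv b b = dotv (wgrad setT w x) (wgrad setT w x) := dotv_abs_derivative w _ x.
have := dotv_ge0 (a - b); rewrite dotvB dotv_lin ea eb.
have := sqr_ge0 (`|u x| - `|w x|); rewrite sqrrB sqrrD !mul1r !real_normK ?num_real//.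
rewrite expr1n mulr1; move: (dotv a b) (dotv _ _) (dotv _ _) (u x ^+ 2) (w x ^+ 2)
  (`|u x| * `|w x|) => p r t q z y *; lra.
Qed.

(** Subadditivity up to the factor 2 suffices for its two uses: unions of sets of zero capacity, and
    unions of open sets of arbitrarily small capacity. *)
Lemma sobolev_capU_lt A B (a b : R) : (sobolev_cap A < a%:E)%E -> (sobolev_cap B < b%:E)%E ->
  (sobolev_cap (A `|` B) < (2 * (a + b))%:E)%E.
Proof.
move=> /ereal_inf_lt[_ [u [Wu [G [oG AG Gu]]] <-]]; rewrite energyE// lte_fin => ua.
move=> /ereal_inf_lt[_ [w [Ww [H [oH BH Hw]]] <-]]; rewrite energyE// lte_fin => wb.
have Wz := W12_lin oT 1 1 (W12_abs oT Wu) (W12_abs oT Ww).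
apply: (@le_lt_trans _ _ (energy (fun x => 1 * `|u x| + 1 * `|w x|))%:E); last first.
  rewrite lte_fin; apply: le_lt_trans (energy_abs_add Wu Ww) _.
  by rewrite ltr_pM2l// ltrD.
rewrite -energyE//; apply: ereal_inf_lbound.
exists (fun x => 1 * `|u x| + 1 * `|w x|) => //; split => //.
exists (G `|` H); split; first exact: openU.
  exact: setUSS.
apply: filterS2 Gu Hw => x h1 h2; rewrite !mul1r => -[/h1 h|/h2 h].
- by apply: (le_trans h); apply: (le_trans (ler_norm _)); rewrite lerDl.
- by apply: (le_trans h); apply: (le_trans (ler_norm _)); rewrite lerDr.
Qed.

Lemma sobolev_capU0 A B : sobolev_cap A = 0%E -> sobolev_cap B = 0%E ->
  sobolev_cap (A `|` B) = 0%E.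
Proof.
move=> A0 B0; apply/le_anti; rewrite sobolev_cap_ge0 andbT.
apply/lee_addgt0Pr => e e0; rewrite add0e.
have e4 : (0 < (e / 4)%:E)%E by rewrite lte_fin divr_gt0.
have hA := e4; have hB := e4; rewrite -{1}A0 in hA; rewrite -{1}B0 in hB.
by apply: ltW; apply: lt_le_trans (sobolev_capU_lt hA hB) _; rewrite lee_fin; lra.
Qed.

Lemma qe_sub A P Q : (forall x, A x -> P x -> Q x) -> qe A P -> qe A Q.
Proof.
move=> PQ; rewrite /qe => h; apply/le_anti; rewrite sobolev_cap_ge0 andbT -h.
by apply: le_sobolev_cap => x [Ax nQ]; split => // /(PQ x Ax).
Qed.

Lemma qe_and A P Q : qe A P -> qe A Q -> qe A (fun x => P x /\ Q x).
Proof.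
move=> hP hQ; apply/le_anti; rewrite sobolev_cap_ge0 andbT -(sobolev_capU0 hP hQ).
apply: le_sobolev_cap => x [Ax nPQ]; have [Px|nP] := pselect (P x); last by left.
by right; split => // Qx; apply: nPQ.
Qed.

Lemma quasicontinuous_comp Omega w (c : R -> R) : continuous c ->
  quasicontinuous Omega w -> quasicontinuous Omega (c \o w).
Proof.
move=> cc qw e /qw[G [oG GO Ge cw]]; exists G; split => //.
by apply: within_continuous_comp => // t _; exact: cc.
Qed.

Lemma quasicontinuous_lin Omega (a b : R) w1 w2 : quasicontinuous Omega w1 ->
  quasicontinuous Omega w2 -> quasicontinuous Omega (fun x => a * w1 x + b * w2 x).
Proof.
move=> q1 q2 e e0; have e4 : 0 < e / 4 by rewrite divr_gt0.
have [G [oG GO Ge cw]] := q1 _ e4; have [H [oH HO He cw']] := q2 _ e4.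
exists (G `|` H); split; first exact: openU.
- by rewrite subUset.
- by apply: lt_le_trans (sobolev_capU_lt Ge He) _; rewrite lee_fin; lra.
- have c1 : {within Omega `\` (G `|` H), continuous w1}.
    by apply: continuous_subspaceW cw => x [Ox nGH]; split => // Gx; apply: nGH; left.
  have c2 : {within Omega `\` (G `|` H), continuous w2}.
    by apply: continuous_subspaceW cw' => x [Ox nGH]; split => // Gx; apply: nGH; right.
  move=> x; apply: cvgD; apply: cvgM; [exact: cvg_cst|exact: c1|exact: cvg_cst|exact: c2].
Qed.

(** The coefficients add up to 1, so the value 1 on [F] is kept. The combination of the two
    quasicontinuous representatives represents the combination, and the exceptional sets are
    joined. *)
Lemma Kclass_affine Omega E F (t : R) u1 u2 : open Omega ->
  Kclass Omega E F u1 -> Kclass Omega E F u2 ->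
  Kclass Omega E F (fun x => (1 - t) * u1 x + t * u2 x).
Proof.
move=> oO [W1 [w1 [[q1 a1] E1 F1]]] [W2 [w2 [[q2 a2] E2 F2]]].
split; first exact: W12_lin.
exists (fun x => (1 - t) * w1 x + t * w2 x); split.
- split; first exact: quasicontinuous_lin.
  by apply: filterS2 a1 a2 => x h1 h2 Ox; rewrite h1// h2.
- by apply: qe_sub (qe_and E1 E2) => x _ [-> ->]; rewrite !mulr0 addr0.
- by apply: qe_sub (qe_and F1 F2) => x _ [-> ->]; rewrite !mulr1 subrK.
Qed.

Lemma Kclass_admissible Omega E F u : Kclass Omega E F u -> cap_admissible Omega E F u.
Proof.
move=> [Wu [w [qw Ew Fw]]]; split => //; exists w; split => //.
- by apply: qe_sub Ew => x _ ->.
- by apply: qe_sub Fw => x _ ->.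
Qed.

Lemma admissible_clamp Omega E F u : open Omega -> bounded_set Omega ->
  cap_admissible Omega E F u -> Kclass Omega E F (clamp \o u).
Proof.
move=> oO bO [Wu [w [[qw aw] Ew Fw]]]; split; first by case: (clamp_energy oO bO Wu).
exists (clamp \o w); split.
- split; first exact: quasicontinuous_comp continuous_clamp qw.
  by apply: filterS aw => x h Ox /=; rewrite h.
- by apply: qe_sub Ew => x _ /=; exact: clamp_le0.
- by apply: qe_sub Fw => x _ /=; exact: clamp_ge1.
Qed.

Lemma relative_cap_minimizer Omega E F u : open Omega -> bounded_set Omega ->
  dirichlet_minimizer Omega E F u -> relative_cap Omega E F = dirichlet_energy Omega u.
Proof.
move=> oO bO [Ku min_u]; apply/le_anti/andP; split.
  by apply: ereal_inf_lbound; exists u => //; exact: Kclass_admissible.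
apply: le_ereal_inf_tmp => _ [w Aw <-].
apply: le_trans (min_u _ (admissible_clamp oO bO Aw)) _.
by case: Aw => Ww _; case: (clamp_energy oO bO Ww).
Qed.

End capacity.

(** * Minimizers and tangential energy *)

Section nonmeasurable_domain.
Import HBNNSimple.

(* [A] and [f] need not be measurable: the integral of a nonnegative function is
   a supremum over simple functions, which may be compared with [h] off a null set. *)
Lemma ge0_integral_ae_le d (T : measurableType d) (R : realType)
  (mu : {measure set T -> \bar R}) (A D : set T) (f h : T -> \bar R) :
  measurable D -> measurable_fun D h -> A `<=` D ->
  (forall x, A x -> 0 <= f x)%E -> (forall x, D x -> 0 <= h x)%E ->
  {ae mu, forall x, A x -> (f x <= h x)%E} ->
  (\int[mu]_(x in A) f x <= \int[mu]_(x in D) h x)%E.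
Proof.
move=> mD mh AD f0 h0 fh; rewrite (ge0_integralE _ f0).
apply: ge_ereal_sup => _ [k /= kle <-].
have kE := integral_nnsfun mu measurableT k; rewrite patch_setT in kE; rewrite -kE.
rewrite [leRHS]integral_mkcond.
apply: ae_ge0_le_integral => //.
- by move=> x _; rewrite lee_fin; exact: fun_ge0.
- exact/measurable_EFinP.
- by move=> x _; rewrite patchE; case: ifPn => //; rewrite inE => /h0.
- exact/(measurable_restrictT _ mD).
apply: filterS fh => x Hx _; apply: le_trans (kle x) _; rewrite !patchE.
case: ifPn => [|_]; last by case: ifPn => //; rewrite inE => /h0.
by rewrite inE => Ax; rewrite mem_set; [exact: Hx|exact: AD].
Qed.

End nonmeasurable_domain.

Section tangential.
Context {R : realType} {n : nat}.
Implicit Types a b t : 'rV[R]_n.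

Lemma dotv_normalized t : t != 0 -> dotv ((enorm t)^-1 *: t) ((enorm t)^-1 *: t) = 1.
Proof.
move=> t0; rewrite dotvZl dotvC dotvZl -enorm_sqr mulrA -expr2 -exprMn mulVf ?expr1n//.
apply: contra t0 => /eqP e0; apply/eqP/rowP => i; rewrite mxE.
have : dotv t t == 0 by rewrite -enorm_sqr e0 expr0n.
rewrite psumr_eq0; last by move=> j _; rewrite -expr2 sqr_ge0.
by move=> /allP/(_ i); rewrite mem_index_enum => /(_ isT)/=; rewrite mulf_eq0 orbb => /eqP.
Qed.

(* If [a] is parallel to the unit vector [t], then [b] and [b - a] have the same
   component orthogonal to [t]. *)
Lemma dotv_tangential_le a b t : dotv t t = 1 ->
  (forall i j, a ord0 i * t ord0 j = a ord0 j * t ord0 i) ->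
  dotv (b - dotv b t *: t) (b - dotv b t *: t) <= dotv (a - b) (a - b).
Proof.
move=> t1 par.
have aE : a = dotv a t *: t.
  apply/rowP => j; rewrite mxE /dotv mulr_suml -[LHS]mulr1 -t1 /dotv mulr_sumr.
  by apply: eq_bigr => i _; rewrite mulrA -par mulrAC.
have e1 : dotv a a = dotv a t ^+ 2.
  by rewrite {2}aE dotvC dotvZl (dotvC t) expr2.
have e2 : dotv a b = dotv a t * dotv b t by rewrite {1}aE dotvZl (dotvC t).
have e3 : dotv b (dotv b t *: t) = dotv b t ^+ 2 by rewrite [LHS]dotvC dotvZl (dotvC t) expr2.
have e4 : dotv (dotv b t *: t) (dotv b t *: t) = dotv b t ^+ 2.
  by rewrite dotvZl [dotv t _]dotvC dotvZl t1 mulr1 expr2.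
(* Once [a] is written as [dotv a t *: t], the difference of the two sides of the claim is exactly
   this square. *)
have := sqr_ge0 (dotv a t - dotv b t); rewrite sqrrB !dotvB e1 e2 e3 e4.
move=> h; lra.
Qed.

End tangential.

Lemma lipschitz_bound (R : realType) (n : nat) (A : set 'rV[R]_n) (f : 'rV[R]_n -> R) :
  [lipschitz f x | x in A] ->
  exists2 L, 0 <= L & forall x y, A x -> A y -> `|f x - f y| <= L * `|x - y|.
Proof.
move=> [M [_ HM]]; exists (`|M| + 1); first by rewrite addr_ge0.
have /HM H : M < `|M| + 1 by rewrite ltr_pwDr// ler_norm.
by move=> x y Ax Ay; exact: (H (x, y)).
Qed.

Lemma quadratic_ge0_linear (R : realFieldType) (p q : R) : 0 <= q ->
  (forall t, 0 <= 2 * t * p + t ^+ 2 * q) -> p = 0.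
Proof.
move=> q0 H; have q1 : 0 < q + 1 by rewrite ltr_wpDl.
apply/eqP; rewrite -sqrf_eq0; apply/eqP/le_anti; rewrite sqr_ge0 andbT.
(* The natural choice [- p / q] fails for [q = 0]; with [q + 1] the value is still negative unless
   [p] is 0. *)
have := H (- (p / (q + 1))).
have -> : 2 * - (p / (q + 1)) * p + (- (p / (q + 1))) ^+ 2 * q =
    - (p ^+ 2 * ((q + 2) / (q + 1) ^+ 2)) by field; rewrite gt_eqF.
rewrite oppr_ge0 pmulr_lle0// divr_gt0 ?exprn_gt0//.
by rewrite ltr_wpDl.
Qed.

Section main.
Context {R : realType} {n : nat}.
Local Notation V := 'rV[R]_n.
Local Notation mu := (@lebesgue_rV R n).
Variables (Omega : set V) (E F : set V).
Hypotheses (oO : open Omega) (bO : bounded_set Omega).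

Let mO : measurable Omega. Proof. exact: open_measurable_rV. Qed.
Let fO : (mu Omega < +oo)%E. Proof. exact: bounded_lebesgue_fin. Qed.

Lemma minimizer_pythagoras (s f : V -> R) : dirichlet_minimizer Omega E F s ->
  Kclass Omega E F f ->
  (dirichlet_energy Omega f - dirichlet_energy Omega s =
   \int[mu]_(x in Omega) (enorm (wgrad Omega f x - wgrad Omega s x) ^+ 2)%:E)%E.
Proof.
move=> [Ks min_s] Kf; have [Ws _] := Ks; have [Wf _] := Kf.
have [Ls _] := Ws; have [Lf _] := Wf.
have Hs := wgradP Ws; have Hf := wgradP Wf.
set gs := wgrad Omega s in Hs *; set gf := wgrad Omega f in Hf *.
have Lgs : L2v Omega gs by case: Hs.
have Lgf : L2v Omega gf by case: Hf.
have iss := integrable_dotv oO Lgs Lgs; have isf := integrable_dotv oO Lgs Lgf.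
have iff := integrable_dotv oO Lgf Lgf.
pose A := \int[mu]_(x in Omega) dotv (gs x) (gs x).
pose X := \int[mu]_(x in Omega) dotv (gs x) (gf x).
pose C := \int[mu]_(x in Omega) dotv (gf x) (gf x).
have lin a b : \int[mu]_(x in Omega) dotv (a *: gs x + b *: gf x) (a *: gs x + b *: gf x) =
    a ^+ 2 * A + 2 * (a * b) * X + b ^+ 2 * C.
  have i1 := integZ mO (a ^+ 2) iss; have i2 := integZ mO (2 * (a * b)) isf.
  have i3 := integZ mO (b ^+ 2) iff.
  under eq_Rintegral do rewrite dotv_lin.
  rewrite (RintegralD mO (integD mO i1 i2) i3) (RintegralD mO i1 i2).
  by congr (_ + _ + _); apply: RintegralZl.
have D0 : 0 <= A - 2 * X + C.
  have := lin 1 (-1); rewrite (_ : _ + _ + _ = A - 2 * X + C); last by ring.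
  by move=> <-; apply: Rintegral_ge0 => x _; exact: dotv_ge0.
(* The right side is the energy of [s + t (f - s)] minus that of [s]. Its linear coefficient must
   vanish, which is the orthogonality [X = A] of [gs] and [gf - gs]. *)
have q t : 0 <= 2 * t * (X - A) + t ^+ 2 * (A - 2 * X + C).
  have Kt := Kclass_affine t oO Ks Kf; have [Wt _] := Kt.
  have Ht := is_L2_weak_gradient_lin oO (1 - t) t Ls Lf Hs Hf.
  have := min_s _ Kt; rewrite (dirichlet_energyE oO Ws Hs) (dirichlet_energyE oO Wt Ht).
  by rewrite lee_fin lin -/A => h; nra.
have XA := quadratic_ge0_linear D0 q.
have id := integrable_dotv oO (L2v_lin oO 1 (-1) Lgf Lgs) (L2v_lin oO 1 (-1) Lgf Lgs).
rewrite (dirichlet_energyE oO Ws Hs) (dirichlet_energyE oO Wf Hf) -EFinB -/A -/C.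
transitivity (\int[mu]_(x in Omega)
    (dotv (1 *: gf x + -1 *: gs x) (1 *: gf x + -1 *: gs x))%:E)%E; last first.
  by apply: eq_integral => x _; rewrite enorm_sqr scale1r scaleN1r.
rewrite (integral_EFin_Rintegral oO id); congr EFin.
(* Since [X = A], the difference [C - A] equals [A - 2 * X + C], the energy of [f - s]. *)
transitivity ((-1) ^+ 2 * A + 2 * (-1 * 1) * X + 1 ^+ 2 * C); first by lra.
by rewrite -lin; apply: eq_Rintegral => x _; rewrite addrC.
Qed.

(** The result on parallel gradients is about functions integrable on the whole space, so the
    composition and its gradient are extended by zero. The integrals against test functions of
    [Omega] do not change, hence neither does the weak derivative there. *)
Lemma wgrad_comp_parallel (theta : V -> R) (v : R -> R) :
  [lipschitz theta x | x in closure Omega] -> W12 Omega (v \o theta) ->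
  {ae mu, forall x, Omega x -> differentiable theta x -> forall i j,
    wgrad Omega (v \o theta) x ord0 i * grad theta x ord0 j =
    wgrad Omega (v \o theta) x ord0 j * grad theta x ord0 i}.
Proof.
move=> /lipschitz_bound[L L0 HL] Wf; have [Lf _] := Wf.
have HL' x y : Omega x -> Omega y -> `|theta x - theta y| <= L * `|x - y|.
  by move=> Ox Oy; apply: HL; exact: subset_closure.
have [Lg Hg] := (is_L2_weak_gradientP oO _ Lf).1 (wgradP Wf).
set g := wgrad Omega (v \o theta) in Lg Hg *.
have I (w : V -> R) : L2 Omega w -> mu.-integrable setT (EFin \o (w \_ Omega)).
  by move=> Lw; apply: (proj1 (integ_patch mu w mO)); exact: (L2_integrable mO fO Lw).
have P0 (w : V -> R) x : ~ Omega x -> (w \_ Omega) x = 0 by move=> nO; rewrite patchE memNset.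
have PE (w : V -> R) x : Omega x -> (w \_ Omega) x = w x by move=> Ox; rewrite patchE mem_set.
have Hp i : weak_derivative Omega i ((v \o theta) \_ Omega) ((fun x => g x ord0 i) \_ Omega).
  move=> phi tphi; have tD := test_function_derive i tphi.
  have Q (w chi : V -> R) : test_function Omega chi ->
      \int[mu]_x ((w \_ Omega) x * chi x) = \int[mu]_x (w x * chi x).
    move=> tchi; apply: eq_Rintegral => x _.
    have [Ox|nO] := pselect (Omega x); first by rewrite PE.
    by rewrite (test_function0 tchi nO) !mulr0.
  by rewrite (Q _ _ tD) (Q _ _ tphi); exact: Hg.
have H i j := parallel_weak_gradient oO bO L0 HL' (I _ Lf) (P0 _) (PE _)
  (I _ (Lg i)) (P0 _) (Hp i) (I _ (Lg j)) (P0 _) (Hp j).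
have H' i := ae_forall_ord (H i).
apply: filterS (ae_forall_ord H') => x h Ox dx i j.
by have := h i j Ox dx; rewrite !(PE _ _ Ox) !mxE.
Qed.

Lemma grad_tan_le (theta : V -> R) (v : R -> R) (s : V -> R) :
  [lipschitz theta x | x in closure Omega] -> W12 Omega (v \o theta) ->
  W12 Omega s ->
  (\int[mu]_(x in regular_set Omega theta) (enorm (grad_tan Omega theta s x) ^+ 2)%:E <=
   \int[mu]_(x in Omega)
     (enorm (wgrad Omega (v \o theta) x - wgrad Omega s x) ^+ 2)%:E)%E.
Proof.
move=> lip Wf Ws; apply: (ge0_integral_ae_le mO).
- have id := integrable_dotv oO (L2v_lin oO 1 (-1) (W12_L2v Wf) (W12_L2v Ws))
    (L2v_lin oO 1 (-1) (W12_L2v Wf) (W12_L2v Ws)).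
  have := measurable_int _ id; congr (measurable_fun _ _).
  by apply/funext => x /=; rewrite enorm_sqr scale1r scaleN1r.
- by move=> x [].
- by move=> x _; rewrite lee_fin sqr_ge0.
- by move=> x _; rewrite lee_fin sqr_ge0.
apply: filterS (wgrad_comp_parallel lip Wf) => x h [Ox dx gx].
rewrite lee_fin !enorm_sqr; apply: dotv_tangential_le; first exact: dotv_normalized.
have tE k : normal_dir theta x ord0 k = (enorm (grad theta x))^-1 * grad theta x ord0 k.
  by rewrite [LHS]mxE.
by move=> i j; rewrite !tE mulrCA (h Ox dx i j) mulrCA.
Qed.

End main.

Theorem proposition6p6 (R : realType) (n : nat) (Omega : set 'rV[R]_n)
    (theta : 'rV[R]_n -> R) (E F : set 'rV[R]_n) (ustar : 'rV[R]_n -> R)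
    (v : R -> R) :
  open Omega -> bounded_set Omega ->
  [lipschitz theta x | x in closure Omega] ->
  interior_condenser Omega E F ->
  dirichlet_minimizer Omega E F ustar ->
  Kclass Omega E F (v \o theta) ->
  [/\ relative_cap Omega E F = dirichlet_energy Omega ustar,
      (dirichlet_energy Omega (v \o theta) - relative_cap Omega E F =
       \int[lebesgue_rV]_(x in Omega)
         (enorm (wgrad Omega (v \o theta) x - wgrad Omega ustar x) ^+ 2)%:E)%E &
      (\int[lebesgue_rV]_(x in regular_set Omega theta)
         (enorm (grad_tan Omega theta ustar x) ^+ 2)%:E <=
       dirichlet_energy Omega (v \o theta) - relative_cap Omega E F)%E].
Proof.
move=> oO bO lip _ min_u Kf; have capE := relative_cap_minimizer oO bO min_u.
have [[Wu _] _] := min_u; have [Wf _] := Kf.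
rewrite capE (minimizer_pythagoras oO min_u Kf).
by split; [| |exact: (grad_tan_le oO bO lip Wf Wu)].
Qed.
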